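(* Let $F|k$ be an extension of algebraically closed fields of characteristic zero of countably infinite transcendence degree, and $G=G_{F|k}$. Let $A\Pi$ be the set of algebraically closed subfields of $F$ containing $k$ and of finite transcendence degree over $k$. The image of the map $\beta:\{\text{intermediate subfields }k\subseteq K\subseteq F\}\to\{\text{closed subgroups of }G\}$, $K\mapsto G_{F|K}$, is characterized by the following four steps: (1) the groups $G_{\{F,L\}|k}$, for $L\in A\Pi\smallsetminus\{k\}$ (the normalizers of $G_{F|L}$ in $G$), are precisely the maximal open proper subgroups of $G$; (2) the groups $G_{F|L}$, for $L\in A\Pi\smallsetminus\{k\}$, are precisely the minimal closed non-trivial normal subgroups of the groups in (1), with $G_{F|L}$ being such a subgroup of $G_{\{F,L\}|k}$; (3) the groups $G_{F|L}$, for all non-trivial extensions $L\subset F$ of $k$ of finite type, are precisely the open subgroups of $G$ containing a group from (2) as a normal co-compact subgroup (namely $G_{F|\overline{L}}$); (4) the proper subgroups of $G$ in the image of $\beta$ are precisely the intersections of (non-empty families of) groups from (3).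
   Context: For a subfield $K$ of $F$, $G_{F|K}$ is the group of field automorphisms of $F$ that are the identity on $K$; $G=G_{F|k}$. $G$ is a topological group in which the stabilizers of finite subsets of $F$ form a base of open subgroups. $G_{\{F,L\}|k}=\{\sigma\in G\mid\sigma(L)=L\}$. $\overline{L}$ is the algebraic closure of $L$ in $F$. An extension of $k$ is of finite type if it is finitely generated as a field extension. A closed normal subgroup $N$ of $U$ is co-compact if $U/N$ is compact. *)

(* Defs.v *)
From HB Require Import structures.
From mathcomp Require Import all_boot all_order all_algebra.
From mathcomp Require Import mpoly.
From mathcomp Require Import all_classical.
From mathcomp Require Import topology_structure quotient_topology compact.
From mathcomp Require Import subtype_topology.

Set Implicit Arguments.
Unset Strict Implicit.
Unset Printing Implicit Defensive.

Import GRing.Theory.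

Local Open Scope classical_set_scope.
Local Open Scope ring_scope.

Section Subfields.
Variable F : fieldType.
Implicit Types (k K L B S : set F).

(* Subfields of F are represented as sets, so that inclusion between extensions
   of k is literal inclusion. *)
Definition is_subfield K := GRing.divring_closed (mem K).

Definition intermediate_fields k : set (set F) :=
  [set K | is_subfield K /\ k `<=` K].

(* The subfield k(S) of F. *)
Definition adjoin k S : set F := smallest is_subfield (k `|` S).

Definition algebraically_closed K :=
  forall p : {poly F}, p \is a polyOver (mem K) -> (1 < size p)%N ->
    exists2 x, K x & root p x.

(* For a subfield K, the algebraic closure of K in F. *)
Definition alg_closure K : set F :=
  [set x | exists p : {poly F},
    [/\ p \is a polyOver (mem K), p != 0 & root p x]].

Definition alg_independent k B :=
  forall (n : nat) (x : 'I_n -> F), injective x -> (forall i, B (x i)) ->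
  forall p : {mpoly F[n]}, p \is a mpolyOver n (mem k) -> p.@[x] = 0 -> p = 0.

Definition transcendence_basis k L B :=
  [/\ B `<=` L, alg_independent k B & L `<=` alg_closure (adjoin k B)].

Definition finite_trdeg k L :=
  exists2 B, transcendence_basis k L B & finite_set B.

Definition countably_infinite_trdeg k L :=
  exists2 B, transcendence_basis k L B & (B #= [set: nat])%card.

Definition finite_type k : set (set F) :=
  [set L | exists2 S, finite_set S & L = adjoin k S].

(* The set denoted A\Pi in the literature. *)
Definition APi k : set (set F) :=
  [set L | [/\ intermediate_fields k L, algebraically_closed L &
               finite_trdeg k L]].

End Subfields.

Section Automorphisms.
Variables (F : fieldType) (k : set F).

(* The automorphism group G_{F|k}, with composition as product. *)
Record fieldAut := FieldAut {
  fieldAut_fun :> F -> F;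
  fieldAutP : [/\ zmod_morphism fieldAut_fun, monoid_morphism fieldAut_fun,
    bijective fieldAut_fun & forall x, k x -> fieldAut_fun x = x]
}.

Fact fieldAut_zmod_morphism (s : fieldAut) : zmod_morphism s.
Proof. by case: (fieldAutP s). Qed.
Fact fieldAut_monoid_morphism (s : fieldAut) : monoid_morphism s.
Proof. by case: (fieldAutP s). Qed.

HB.instance Definition _ (s : fieldAut) :=
  GRing.isZmodMorphism.Build F F s (fieldAut_zmod_morphism s).
HB.instance Definition _ (s : fieldAut) :=
  GRing.isMonoidMorphism.Build F F s (fieldAut_monoid_morphism s).

Lemma fieldAut_bij (s : fieldAut) : bijective s.
Proof. by case: (fieldAutP s). Qed.

Lemma fieldAut_id (s : fieldAut) x : k x -> s x = x.
Proof. by case: (fieldAutP s) => _ _ _; apply. Qed.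

Lemma fieldAut_ext (s t : fieldAut) : s =1 t -> s = t.
Proof.
case: s t => [s sP] [t tP] /= /funext st.
by case: t / st tP => tP; rewrite (Prop_irrelevance sP tP).
Qed.

HB.instance Definition _ := gen_eqMixin fieldAut.
HB.instance Definition _ := gen_choiceMixin fieldAut.

Fact fieldAut_one_subproof : [/\ zmod_morphism (@id F),
  monoid_morphism (@id F), bijective (@id F) & forall x, k x -> id x = x].
Proof. by split=> //; exists id. Qed.

Definition fieldAut_one := FieldAut fieldAut_one_subproof.

Fact fieldAut_mul_subproof (s t : fieldAut) : [/\ zmod_morphism (s \o t),
  monoid_morphism (s \o t), bijective (s \o t) &
  forall x, k x -> (s \o t) x = x].
Proof.
split=> [x y|| |x kx] /=; first by rewrite !raddfB.
- by split=> [|x y] /=; rewrite ?rmorph1 ?rmorphM.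
- exact: bij_comp (fieldAut_bij s) (fieldAut_bij t).
- by rewrite !fieldAut_id.
Qed.

Definition fieldAut_mul s t := FieldAut (fieldAut_mul_subproof s t).

Fact fieldAut_inv_key (s : fieldAut) : exists g, cancel s g /\ cancel g s.
Proof. by have [g sK gK] := fieldAut_bij s; exists g. Qed.

Definition fieldAut_invfun (s : fieldAut) : F -> F :=
  sval (cid (fieldAut_inv_key s)).

Fact fieldAut_invfunK (s : fieldAut) :
  cancel s (fieldAut_invfun s) /\ cancel (fieldAut_invfun s) s.
Proof. exact: svalP (cid (fieldAut_inv_key s)). Qed.

Fact fieldAut_inv_subproof (s : fieldAut) :
  [/\ zmod_morphism (fieldAut_invfun s), monoid_morphism (fieldAut_invfun s),
      bijective (fieldAut_invfun s) & forall x, k x -> fieldAut_invfun s x = x].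
Proof.
have [sK gK] := fieldAut_invfunK s; set g := fieldAut_invfun s in sK gK *.
have sI := can_inj sK.
split=> [x y|| |x kx]; first by apply: sI; rewrite rmorphB /= !gK.
- by split=> [|x y]; apply: sI; rewrite ?rmorph1 ?rmorphM /= !gK.
- by exists s.
- by apply: sI; rewrite gK fieldAut_id.
Qed.

Definition fieldAut_inv s := FieldAut (fieldAut_inv_subproof s).

Fact fieldAut_mulA : associative fieldAut_mul.
Proof. by move=> s t u; apply: fieldAut_ext => x. Qed.
Fact fieldAut_mul1 : left_id fieldAut_one fieldAut_mul.
Proof. by move=> s; apply: fieldAut_ext => x. Qed.
Fact fieldAut_mulr1 : right_id fieldAut_one fieldAut_mul.
Proof. by move=> s; apply: fieldAut_ext => x. Qed.
Fact fieldAut_mulV : left_inverse fieldAut_one fieldAut_inv fieldAut_mul.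
Proof.
by move=> s; apply: fieldAut_ext => x /=; rewrite (proj1 (fieldAut_invfunK s)).
Qed.
Fact fieldAut_mulrV : right_inverse fieldAut_one fieldAut_inv fieldAut_mul.
Proof.
by move=> s; apply: fieldAut_ext => x /=; rewrite (proj2 (fieldAut_invfunK s)).
Qed.

HB.instance Definition _ := isGroup.Build fieldAut fieldAut_mulA
  fieldAut_mul1 fieldAut_mulr1 fieldAut_mulV fieldAut_mulrV.

Lemma fieldAut1E x : (1%g : fieldAut) x = x. Proof. by []. Qed.
Lemma fieldAutME (s t : fieldAut) x : (s * t)%g x = s (t x). Proof. by []. Qed.

(* [fixing k K] is G_{F|K} and [stabilizing k L] is G_{{F,L}|k}, both as
   subsets of [fieldAut k]. *)
Definition fixing (A : set F) : set fieldAut :=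
  [set s | forall x, A x -> s x = x].

Definition stabilizing (A : set F) : set fieldAut := [set s | s @` A = A].

(* The left translates of the pointwise stabilizers of finite subsets of F form
   a base of the topology; see [nbhs1_fieldAutP] for the neighbourhoods of 1. *)
Definition fieldAut_open (U : set fieldAut) :=
  forall s, U s -> exists2 A : set F, finite_set A &
    [set (s * t)%g | t in fixing A] `<=` U.

Fact fieldAut_openT : fieldAut_open setT.
Proof. by move=> s _; exists set0. Qed.

Fact fieldAut_openI : setI_closed fieldAut_open.
Proof.
move=> U V oU oV s [/oU[A finA AU] /oV[B finB BV]].
exists (A `|` B); first by rewrite finite_setU.
move=> _ [t tAB <-]; split; [apply: AU | apply: BV]; exists t => // x xA.
  by apply: tAB; left.
by apply: tAB; right.
Qed.

Fact fieldAut_open_bigU (I : Type) (f : I -> set fieldAut) :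
  (forall i, fieldAut_open (f i)) -> fieldAut_open (\bigcup_i f i).
Proof.
move=> of_ s [i _ /of_[A finA Af]]; exists A => //.
by apply: subset_trans Af _ => t ft; exists i.
Qed.

HB.instance Definition _ := isOpenTopological.Build fieldAut
  fieldAut_openT fieldAut_openI fieldAut_open_bigU.

Lemma open_fieldAutE : (open : set_system fieldAut) = fieldAut_open.
Proof. by []. Qed.

Lemma fixing_open (A : set F) : finite_set A -> open (fixing A).
Proof.
rewrite open_fieldAutE => finA s sA; exists A => // _ [t tA <-] x Ax.
by rewrite fieldAutME tA ?sA.
Qed.

Lemma nbhs1_fieldAutP (U : set fieldAut) :
  nbhs (1%g : fieldAut) U <-> exists2 A, finite_set A & fixing A `<=` U.
Proof.
rewrite nbhsE; split=> [[V [+ V1] VU]|[A finA AU]].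
  rewrite open_fieldAutE => oV.
  have [A finA AV] := oV _ V1; exists A => // t tA; apply: VU; apply: AV.
  by exists t => //; rewrite mul1g.
by exists (fixing A) => //; split=> //; apply: fixing_open.
Qed.

End Automorphisms.

Arguments fixing {F} k A.
Arguments stabilizing {F} k A.

Section Subgroups.
Variable G : groupType.
Implicit Types (H N U : set G).

Definition is_subgroup H := group_closed (mem H).

Definition normal_subgroup N U :=
  [/\ is_subgroup N, N `<=` U & forall s t, U s -> N t -> N (conjg t s)].

Definition normalizing H : set G := [set s | [set conjg t s | t in H] = H].

End Subgroups.

Section Cosets.
Variables (F : fieldType) (k : set F) (U N : set (fieldAut k)).

(* U / N as a topological space: the quotient, by the relation "s N = t N", of
   the type of elements of U, which carries the topology induced from G. *)
Definition same_coset : rel U := fun s t =>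
  `[< [set (val s * n)%g | n in N] = [set (val t * n)%g | n in N] >].

Fact same_coset_refl : reflexive same_coset.
Proof. by move=> s; apply/asboolP. Qed.
Fact same_coset_sym : ssrbool.symmetric same_coset.
Proof. by move=> s t; apply/asboolP/asboolP. Qed.
Fact same_coset_trans : transitive same_coset.
Proof. by move=> t s u /asboolP st /asboolP tu; apply/asboolP; rewrite st. Qed.

Canonical same_coset_equiv :=
  EquivRel same_coset same_coset_refl same_coset_sym same_coset_trans.

Definition cosets : topologicalType :=
  quotient_topology {eq_quot same_coset_equiv}%qT.

Definition cocompact := compact [set: cosets].

End Cosets.

Section Families.
Variables (F : fieldType) (k : set F).
Local Notation G := (fieldAut k).
Implicit Types (H N U : set G).

Definition open_proper_subgroup H :=
  [/\ is_subgroup H, open H & H <> setT].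

Definition maximal_open_subgroups : set (set G) :=
  [set H : set G | open_proper_subgroup H /\
    forall H', open_proper_subgroup H' -> H `<=` H' -> H' = H].

Definition closed_nontrivial_normal H N :=
  [/\ normal_subgroup N H, closed N & N <> [set 1%g]].

Definition minimal_closed_normal H N :=
  closed_nontrivial_normal H N /\
  forall N', closed_nontrivial_normal H N' -> N' `<=` N -> N' = N.

Definition minimal_closed_normal_subgroups : set (set G) :=
  [set N : set G | exists2 H, maximal_open_subgroups H & minimal_closed_normal H N].

Definition cocompact_overgroup N U := normal_subgroup N U /\ cocompact U N.

Definition open_cocompact_overgroups : set (set G) :=
  [set U : set G | [/\ is_subgroup U, open U &
    exists2 N, minimal_closed_normal_subgroups N & cocompact_overgroup N U]].

Definition intersections_of (D : set (set G)) : set (set G) :=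
  [set H : set G | exists E : set (set G),
    [/\ E `<=` D, E !=set0 & H = \bigcap_(U in E) U]].

End Families.

Arguments maximal_open_subgroups {F} k.
Arguments minimal_closed_normal_subgroups {F} k.
Arguments open_cocompact_overgroups {F} k.

(* Main.v *)
(** The automorphisms of F over k are produced by extending isomorphisms between
    subfields, given by their graphs: along algebraic extensions because F is
    algebraically closed, and along transcendental ones by Zorn's lemma. Algebraic
    closure over k is a pregeometry, so that fields of finite transcendence degree
    have a dimension.

    The heart of the proof is that every open subgroup H lies between G_{F|L} and
    G_{{F,L}|k} for some L in A\Pi. Take L of minimal dimension with G_{F|L} in H;
    it suffices that L is unique, for then hL = L for every h in H.
    If L and L' were two candidates, one could choose them in general position over
    I = L \cap L', and G_{F|L} and G_{F|L'} would generate a group containing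
    G_{F|I}. Both this and the reduction to general position rest on a canonical
    linear relation whose coefficients are fixed by every automorphism fixing the
    vectors; a coefficient outside I could be shifted by an automorphism c |-> c + 1,
    of which some power fixes the vectors, contradicting characteristic 0.

    The nontrivial normal subgroups of G_{F|L} are then dense, since an automorphism
    preserving the algebraic closure of L(y) for every y is trivial. Finally a
    group U containing G_{F|M} as a normal co-compact subgroup has finite orbits on M,
    and Artin's theorem identifies it with the stabilizer of its fixed field. *)

From HB Require Import structures.
Require Import Defs.
From mathcomp Require Import all_boot all_order all_algebra.
From mathcomp Require Import mpoly.
From mathcomp Require Import all_classical.
From mathcomp Require Import topology_structure quotient_topology compact.
From mathcomp Require Import subtype_topology.
From mathcomp Require Import ring.

Set Implicit Arguments.
Unset Strict Implicit.
Unset Printing Implicit Defensive.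

Import GRing.Theory.

Local Open Scope classical_set_scope.
Local Open Scope ring_scope.

(** * Subfields and algebraic closure *)

(** The recurrent obstacle is surjectivity. A self-embedding of a field of infinite transcendence
    degree need not be onto, so extending a partial isomorphism to F needs some control on both
    sides. Two devices supply it: either domain and image coincide, and each new transcendental is
    paired with itself ([extend_onto]), or everything lies in the closure of a finite sequence,
    where counting transcendence degree makes a maximal extension onto ([extend_hom]).
    Characteristic zero enters twice: shifts by 1 have infinite order, so that no power of one can
    fix the shifted element, and minimal polynomials are separable, so that algebraic elements
    outside a subfield can be moved. Uniqueness of L is where general position is needed. Two fields
    in general position over I behave as if linearly disjoint, so any s fixing I can be corrected,
    on one of them, by an automorphism fixing the other; this writes s as a product of two elements
    of H. The infinite transcendence degree of F is what provides room for generic conjugates. *)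

Section SubfieldClosure.
Variables (F : fieldType) (K : set F).
Hypothesis hK : is_subfield K.

Lemma subfield1 : K 1.
Proof. by case: hK => /set_mem. Qed.

Lemma subfieldB x y : K x -> K y -> K (x - y).
Proof.
by case: hK => _ hB _ /mem_set Kx /mem_set Ky; apply/set_mem/hB.
Qed.

Lemma subfield_div x y : K x -> K y -> K (x / y).
Proof.
by case: hK => _ _ hD /mem_set Kx /mem_set Ky; apply/set_mem/hD.
Qed.

Lemma subfield0 : K 0.
Proof. by rewrite -(subrr 1); apply: subfieldB; apply: subfield1. Qed.

Lemma subfieldN x : K x -> K (- x).
Proof. by move=> Kx; rewrite -sub0r; apply: subfieldB => //; apply: subfield0. Qed.

Lemma subfieldD x y : K x -> K y -> K (x + y).
Proof. by move=> Kx Ky; rewrite -(opprK y); apply/subfieldB/subfieldN. Qed.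

Lemma subfieldV x : K x -> K x^-1.
Proof. by move=> Kx; rewrite -div1r; apply/subfield_div/Kx/subfield1. Qed.

Lemma subfieldM x y : K x -> K y -> K (x * y).
Proof. by move=> Kx Ky; rewrite -(invrK y); apply/subfield_div/subfieldV. Qed.

Lemma subfieldX x n : K x -> K (x ^+ n).
Proof.
move=> Kx; elim: n => [|n IHn]; first exact: subfield1.
by rewrite exprS; apply: subfieldM.
Qed.

Lemma subfield_nat n : K n%:R.
Proof.
elim: n => [|n IHn]; first exact: subfield0.
by rewrite -addn1 natrD; apply: subfieldD => //; apply: subfield1.
Qed.

Lemma subfield_sum I (r : seq I) (P : pred I) (E : I -> F) :
  (forall i, P i -> K (E i)) -> K (\sum_(i <- r | P i) E i).
Proof. by move=> KE; elim/big_ind: _ => //; [apply: subfield0|apply: subfieldD]. Qed.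

Lemma subfield_horner (p : {poly F}) x :
  (forall i, K p`_i) -> K x -> K p.[x].
Proof.
move=> Kp Kx; rewrite horner_coef; apply: subfield_sum => i _.
by apply: subfieldM => //; apply: subfieldX.
Qed.

End SubfieldClosure.

Lemma subfieldP (F : fieldType) (K : set F) : K 1 ->
    (forall x y, K x -> K y -> K (x - y)) ->
    (forall x y, K x -> K y -> K (x / y)) -> is_subfield K.
Proof.
move=> K1 KB KD; split; first exact: mem_set.
- by move=> x y /set_mem Kx /set_mem Ky; apply/mem_set/KB.
- by move=> x y /set_mem Kx /set_mem Ky; apply/mem_set/KD.
Qed.

Lemma polyOver_set (F : fieldType) (K : set F) (p : {poly F}) : K 0 ->
  (p \is a polyOver (mem K)) <-> (forall i, K p`_i).
Proof.
move=> K0; split=> [/allP Kp i|Kp]; last first.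
  by apply/allP => _ /(nthP 0)[i _ <-]; apply/mem_set.
have [ip|/(nth_default _)-> //] := ltnP i (size p).
exact/set_mem/Kp/mem_nth.
Qed.

Lemma alg_closureP (F : fieldType) (K : set F) x : K 0 -> alg_closure K x <->
  exists p : {poly F}, [/\ forall i, K p`_i, p != 0 & root p x].
Proof. by move=> K0; split=> -[p [/(polyOver_set _ K0) Kp p0 px]]; exists p. Qed.

Section SubfieldType.
Variables (F : fieldType) (K : set F) (hK : is_subfield K).

(** Carrying the proof as an argument gives a predicate on which the closure structure can be
    declared. The subtype then inherits a field structure, and the theory of [algebraicOver] applies
    to it. *)
Definition subfield_pred (_ : is_subfield K) : {pred F} := mem K.

HB.instance Definition _ := GRing.isDivringClosed.Build F (subfield_pred hK) hK.

Record subfield_type := SubfieldElt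
  { subfield_val : F; _ : subfield_val \in subfield_pred hK }.
HB.instance Definition _ := [isSub for subfield_val].
HB.instance Definition _ := [Choice of subfield_type by <:].
HB.instance Definition _ := [SubChoice_isSubComUnitRing of subfield_type by <:].
HB.instance Definition _ := [SubComUnitRing_isSubIntegralDomain of subfield_type by <:].
HB.instance Definition _ := [SubIntegralDomain_isSubField of subfield_type by <:].

Lemma algebraicOver_subfield x :
  algebraicOver (val : subfield_type -> F) x <-> alg_closure K x.
Proof.
have K0 := subfield0 hK.
split=> [[p p0 px]|/(alg_closureP _ K0)[p [Kp p0 px]]].
  apply/(alg_closureP _ K0); exists (map_poly val p); split=> //; last by rewrite map_poly_eq0.
  by move=> i; rewrite coef_map; apply/set_mem/(valP p`_i).
pose q := map_poly (insubd (0 : subfield_type)) p.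
have qE : map_poly val q = p.
  apply/polyP => i; rewrite coef_map coef_map_id0 /=.
    exact: (insubdK _ (mem_set (Kp i))).
  by apply: val_inj; apply: (insubdK _ (mem_set K0)).
exists q; last by rewrite qE.
by apply: contra_neq p0 => q0; rewrite -qE q0 map_poly0.
Qed.

Lemma alg_closure_subfield : is_subfield (alg_closure K).
Proof.
apply: subfieldP => [|x y|x y].
- apply/algebraicOver_subfield; exact: algebraic1.
- by move=> /algebraicOver_subfield hx /algebraicOver_subfield hy;
    apply/algebraicOver_subfield/algebraic_sub.
- by move=> /algebraicOver_subfield hx /algebraicOver_subfield hy;
    apply/algebraicOver_subfield/algebraic_div.
Qed.

Lemma sub_alg_closure : K `<=` alg_closure K.
Proof.
move=> x Kx; apply/algebraicOver_subfield.
exact: (@algebraic_id _ _ (val : subfield_type -> F) (SubfieldElt (mem_set Kx))).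
Qed.

(** Transitivity of algebraicity, obtained from integrality: over a field the two notions agree, and
    integral elements are stable under roots of polynomials with integral coefficients. *)
Lemma alg_closure_root (p : {poly F}) x :
  (forall i, alg_closure K p`_i) -> p != 0 -> root p x -> alg_closure K x.
Proof.
move=> Kp p0 px; apply/algebraicOver_subfield/integral_algebraic.
apply: integral_root p0 px _.
apply/integral_poly => i; apply/integral_algebraic/algebraicOver_subfield/Kp.
Qed.

End SubfieldType.

Lemma subfield_setT (F : fieldType) : is_subfield [set: F].
Proof. exact: subfieldP. Qed.

Lemma alg_closure_setT (F : fieldType) : alg_closure [set: F] = setT.
Proof.
apply/seteqP; split=> // x _.
by apply: sub_alg_closure => //; apply: subfield_setT.
Qed.

Section MoreClosure.
Variable F : fieldType.
Implicit Types (K L : set F).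

Lemma alg_closure_mono K L : K `<=` L -> alg_closure K `<=` alg_closure L.
Proof.
move=> KL x [p [/allP Kp p0 px]]; exists p; split=> //.
by apply/allP => y /Kp /set_mem/KL/mem_set.
Qed.

Lemma alg_closureK K : is_subfield K ->
  alg_closure (alg_closure K) = alg_closure K.
Proof.
move=> hK; apply/seteqP; split.
  move=> x /alg_closureP[|p [Kp p0 px]]; last exact: alg_closure_root px.
  exact: subfield0 (alg_closure_subfield hK).
exact: sub_alg_closure (alg_closure_subfield hK).
Qed.

Lemma adjoin_subfield K (S : set F) : is_subfield (adjoin K S).
Proof.
apply: subfieldP => [|x y Kx Ky L [hL KSL]|x y Kx Ky L [hL KSL]].
- by move=> L [hL _]; apply: subfield1.
- by apply: subfieldB => //; [apply: Kx|apply: Ky].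
- by apply: subfield_div => //; [apply: Kx|apply: Ky].
Qed.

Lemma sub_adjoinl K (S : set F) : K `<=` adjoin K S.
Proof. by move=> x Kx L [_ KSL]; apply: KSL; left. Qed.

Lemma sub_adjoinr K (S : set F) : S `<=` adjoin K S.
Proof. by move=> x Kx L [_ KSL]; apply: KSL; right. Qed.

Lemma adjoin_min K (S : set F) L : is_subfield L -> K `<=` L -> S `<=` L ->
  adjoin K S `<=` L.
Proof. by move=> hL KL SL x; apply; split=> // y [/KL|/SL]. Qed.

End MoreClosure.

Lemma closed_field_root (F : closedFieldType) (p : {poly F}) :
  (1 < size p)%N -> exists x, root p x.
Proof. by move=> sp; apply/closed_rootP; rewrite neq_ltn sp orbT. Qed.

Lemma alg_closure_closed (F : closedFieldType) (K : set F) : is_subfield K ->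
  algebraically_closed (alg_closure K).
Proof.
move=> hK p Kp sp; have [x px] := closed_field_root sp.
exists x => //; apply: (alg_closure_root hK) px; last by rewrite -size_poly_gt0 ltnW.
apply/polyOver_set; last exact: Kp.
exact: subfield0 (alg_closure_subfield hK).
Qed.

(** The hypothesis provides only one root in K for each polynomial, so the roots are split off one
    by one: x is either the root just found or a root of the quotient, which has smaller degree. *)
Lemma algebraically_closed_alg_closure (F : fieldType) (K : set F) :
  is_subfield K -> algebraically_closed K -> alg_closure K = K.
Proof.
move=> hK cK; apply/seteqP; split; last exact: sub_alg_closure.
move=> x /alg_closureP[|p [Kp p0 px]]; first exact: subfield0.
elim: {p}(size p) {-2}p (leqnn (size p)) Kp p0 px => [|n IHn] p sp Kp p0 px.
  by move: sp p0; rewrite leqn0 size_poly_eq0 => ->.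
have sp1 : (1 < size p)%N.
  rewrite ltnNge; apply: contraL px => sp1; rewrite (size1_polyC sp1) rootC.
  by apply: contra_neq p0 => pc; rewrite (size1_polyC sp1) pc.
have [|y Ky py] := cK p _ sp1; first by apply/polyOver_set => //; exact: subfield0.
have [q pE] := factor_theorem _ _ py.
move: px; rewrite pE rootM root_XsubC => /orP[qx|/eqP-> //].
have q0 : q != 0 by apply: contra_neq p0 => q0; rewrite pE q0 mul0r.
apply: (IHn _ _ _ q0 qx); first by move: sp; rewrite pE (size_Mmonic q0 (monicXsubC y)) size_XsubC addn2.
(* The quotient q of p by the monic X - y again has coefficients in K. *)
have qE i : q`_i = p`_i.+1 + y * q`_i.+1.
  by rewrite pE mulrBr coefB coefMX /= coefMC mulrC subrK.
(* Each coefficient of q is computed from the next one, so the induction goes down from the indices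
   beyond the degree, where the coefficients are 0. *)
move=> i; have [n0] : exists n0, (size q <= n0 + i)%N by exists (size q); rewrite leq_addr.
elim: n0 i => [|m IHm] i; first by move=> h; rewrite nth_default //; apply: subfield0.
move=> h; rewrite qE; apply: subfieldD => //; apply: subfieldM => //.
by apply: IHm; rewrite addnS -addSn.
Qed.

(** * Graphs of isomorphisms between subfields *)

(* An isomorphism between subfields of F is represented by its graph: a set of
   pairs closed under the field operations in which 0 is only paired with 0. *)
Section PartialIsomorphisms.
Variable F : fieldType.
Implicit Types (G H R : set (F * F)) (K : set F) (p q : {poly F}).

Definition ring_graph R :=
  [/\ R (1, 1),
      forall x y x' y', R (x, y) -> R (x', y') -> R (x - x', y - y'),
      forall x y x' y', R (x, y) -> R (x', y') -> R (x * x', y * y') &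
      forall x y, R (x, y) -> (x = 0 <-> y = 0)].

Definition field_graph G :=
  ring_graph G /\ forall x y, G (x, y) -> G (x^-1, y^-1).

Definition dom G : set F := [set x | exists y, G (x, y)].
Definition im G : set F := [set y | exists x, G (x, y)].
(** The inverse isomorphism; passing to it turns statements about domains into statements about
    images. *)
Definition conv G : set (F * F) := [set z | G (z.2, z.1)].
Definition id_graph K : set (F * F) := [set z | K z.1 /\ z.1 = z.2].

Definition poly_graph G p q := forall i, G (p`_i, q`_i).

Definition fractions R : set (F * F) := [set z | exists x y x' y',
  [/\ R (x, y), R (x', y'), x' != 0 & z = (x / x', y / y')]].

Definition adjoin_ring G (a b : F) : set (F * F) :=
  [set z | exists p q, poly_graph G p q /\ z = (p.[a], q.[b])].

Definition adjoin_graph G a b := fractions (adjoin_ring G a b).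

(** The exact condition for the isomorphism to extend by sending a to b. It covers the
    transcendental case, where both sides vanish only for the zero polynomial, and the algebraic
    case, where b is a root of the transported minimal polynomial. *)
Definition compatible G a b :=
  forall p q, poly_graph G p q -> (p.[a] = 0 <-> q.[b] = 0).

Section RingGraph.
Variable R : set (F * F).
Hypothesis hR : ring_graph R.

Lemma ring_graph1 : R (1, 1). Proof. by case: hR. Qed.

Lemma ring_graphB x y x' y' : R (x, y) -> R (x', y') -> R (x - x', y - y').
Proof. by case: hR => _ + _ _; apply. Qed.

Lemma ring_graphM x y x' y' : R (x, y) -> R (x', y') -> R (x * x', y * y').
Proof. by case: hR => _ _ + _; apply. Qed.

Lemma ring_graph_eq0 x y : R (x, y) -> (x = 0 <-> y = 0).
Proof. by case: hR => _ _ _; apply. Qed.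

Lemma ring_graph_neq0 x y : R (x, y) -> (x != 0) = (y != 0).
Proof.
move=> /ring_graph_eq0 xy; congr (~~ _).
by apply/eqP/eqP => /xy.
Qed.

Lemma ring_graph0 : R (0, 0).
Proof. by have := ring_graphB ring_graph1 ring_graph1; rewrite subrr. Qed.

Lemma ring_graphN x y : R (x, y) -> R (- x, - y).
Proof. by move=> xy; have := ring_graphB ring_graph0 xy; rewrite !sub0r. Qed.

Lemma ring_graphD x y x' y' : R (x, y) -> R (x', y') -> R (x + x', y + y').
Proof.
by move=> xy /ring_graphN xy'; have := ring_graphB xy xy'; rewrite !opprK.
Qed.

Lemma ring_graph_sum I (r : seq I) (P : pred I) (f g : I -> F) :
  (forall i, P i -> R (f i, g i)) ->
  R (\sum_(i <- r | P i) f i, \sum_(i <- r | P i) g i).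
Proof.
move=> fg; elim/big_rec2: _ => [|i x y Pi xy]; first exact: ring_graph0.
exact: ring_graphD (fg i Pi) xy.
Qed.

Lemma ring_graph_prod I (r : seq I) (P : pred I) (f g : I -> F) :
  (forall i, P i -> R (f i, g i)) ->
  R (\prod_(i <- r | P i) f i, \prod_(i <- r | P i) g i).
Proof.
move=> fg; elim/big_rec2: _ => [|i x y Pi xy]; first exact: ring_graph1.
exact: ring_graphM (fg i Pi) xy.
Qed.

Lemma ring_graphX n x y : R (x, y) -> R (x ^+ n, y ^+ n).
Proof.
move=> xy; elim: n => [|n IHn]; first exact: ring_graph1.
by rewrite !exprS; apply: ring_graphM.
Qed.

Lemma ring_graph_functional x y y' : R (x, y) -> R (x, y') -> y = y'.
Proof.
move=> xy xy'; have := ring_graphB xy xy'; rewrite subrr => /ring_graph_eq0[+ _].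
by move=> /(_ erefl)/eqP; rewrite subr_eq0 => /eqP.
Qed.

Lemma ring_graph_injective x x' y : R (x, y) -> R (x', y) -> x = x'.
Proof.
move=> xy xy'; have := ring_graphB xy xy'; rewrite subrr => /ring_graph_eq0[_].
by move=> /(_ erefl)/eqP; rewrite subr_eq0 => /eqP.
Qed.

Lemma ring_graph_conv : ring_graph (conv R).
Proof.
split=> [|x y x' y'|x y x' y'|x y]; rewrite /conv /=.
- exact: ring_graph1.
- exact: ring_graphB.
- exact: ring_graphM.
- by move=> /ring_graph_eq0[? ?]; split.
Qed.

Lemma sub_fractions : R `<=` fractions R.
Proof.
move=> [x y] xy; exists x, y, 1, 1.
by rewrite !divr1 oner_neq0; split=> //; apply: ring_graph1.
Qed.

Lemma fractions_field_graph : field_graph (fractions R).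
Proof.
have quot0 (x x' : F) : x' != 0 -> x / x' = 0 <-> x = 0.
  move=> x'0; split=> [/eqP|->]; last by rewrite mul0r.
  by rewrite mulf_eq0 invr_eq0 (negPf x'0) orbF => /eqP.
split; first split.
- by apply: sub_fractions; apply: ring_graph1.
- move=> ? ? ? ? [x [y [x' [y' [xy xy' x'0 [-> ->]]]]]].
  move=> [u [v [u' [v' [uv uv' u'0 [-> ->]]]]]].
  exists (x * u' - u * x'), (y * v' - v * y'), (x' * u'), (y' * v').
  have y'0 : y' != 0 by rewrite -(ring_graph_neq0 xy').
  have v'0 : v' != 0 by rewrite -(ring_graph_neq0 uv').
  split; first by apply: ring_graphB; apply: ring_graphM.
  + exact: ring_graphM.
  + by rewrite mulf_neq0.
  + by rewrite -!mulNr !addf_div // !mulNr.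
- move=> ? ? ? ? [x [y [x' [y' [xy xy' x'0 [-> ->]]]]]].
  move=> [u [v [u' [v' [uv uv' u'0 [-> ->]]]]]].
  exists (x * u), (y * v), (x' * u'), (y' * v').
  split; [exact: ring_graphM|exact: ring_graphM|by rewrite mulf_neq0|].
  by rewrite !mulf_div.
- move=> ? ? [x [y [x' [y' [xy xy' x'0 [-> ->]]]]]].
  rewrite !quot0 // -?(ring_graph_neq0 xy') //; exact: ring_graph_eq0.
- move=> ? ? [x [y [x' [y' [xy xy' x'0 [-> ->]]]]]].
  have [x0|x0] := eqVneq x 0.
    move/(ring_graph_eq0 xy): (x0) => y0.
    by rewrite x0 y0 !mul0r invr0; apply: sub_fractions; apply: ring_graph0.
  by exists x', y', x, y; rewrite !invf_div.
Qed.

End RingGraph.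

Lemma field_graph_conv G : field_graph G -> field_graph (conv G).
Proof.
move=> [hG hV]; split; first exact: ring_graph_conv.
by move=> x y /hV.
Qed.

Lemma field_graph_div G x y x' y' : field_graph G ->
  G (x, y) -> G (x', y') -> G (x / x', y / y').
Proof. by move=> [hG hV] xy /hV xy'; apply: ring_graphM. Qed.

Lemma dom_subfield G : field_graph G -> is_subfield (dom G).
Proof.
move=> hG; have [rG _] := hG; apply: subfieldP => [|x x' [y xy] [y' xy']|].
- by exists 1; apply: ring_graph1.
- by exists (y - y'); apply: ring_graphB.
- by move=> x x' [y xy] [y' xy']; exists (y / y'); apply: field_graph_div.
Qed.

Lemma im_subfield G : field_graph G -> is_subfield (im G).
Proof. by move=> /field_graph_conv/dom_subfield. Qed.

Lemma fractions_min R G : field_graph G -> R `<=` G -> fractions R `<=` G.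
Proof.
move=> hG RG _ [x [y [x' [y' [xy xy' _ ->]]]]].
by apply: field_graph_div => //; apply: RG.
Qed.

Lemma id_graph_field K : is_subfield K -> field_graph (id_graph K).
Proof.
move=> hK; split; first split; rewrite /id_graph /=.
- by split=> //; apply: subfield1.
- by move=> x _ x' _ [Kx <-] [Kx' <-]; split=> //; apply: subfieldB.
- by move=> x _ x' _ [Kx <-] [Kx' <-]; split=> //; apply: subfieldM.
- by move=> x _ [_ <-].
- by move=> x _ [Kx <-]; split=> //; apply: subfieldV.
Qed.

Lemma dom_id_graph K : dom (id_graph K) = K.
Proof. by apply/seteqP; split=> [x [y []]|x Kx] //; exists x. Qed.

Lemma im_id_graph K : im (id_graph K) = K.
Proof. by apply/seteqP; split=> [x [y [+ /= <-]]|x Kx] //; exists x. Qed.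

Section PolyGraph.
Variable G : set (F * F).
Hypothesis hG : ring_graph G.

Lemma poly_graphC x y : G (x, y) -> poly_graph G x%:P y%:P.
Proof. by move=> xy i; rewrite !coefC; case: eqP => _ //; apply: ring_graph0. Qed.

Lemma poly_graphX : poly_graph G 'X 'X.
Proof.
move=> i; rewrite !coefX; case: eqP => _; first exact: ring_graph1.
exact: ring_graph0.
Qed.

Lemma poly_graphB p q p' q' :
  poly_graph G p q -> poly_graph G p' q' -> poly_graph G (p - p') (q - q').
Proof. by move=> pq pq' i; rewrite !coefB; apply: ring_graphB. Qed.

Lemma poly_graphM p q p' q' :
  poly_graph G p q -> poly_graph G p' q' -> poly_graph G (p * p') (q * q').
Proof.
move=> pq pq' i; rewrite !coefM; apply: ring_graph_sum => // j _.
exact: ring_graphM.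
Qed.

Lemma poly_graph_size p q : poly_graph G p q -> size p = size q.
Proof.
suff H G' p' q' : ring_graph G' -> poly_graph G' p' q' -> (size p' <= size q')%N.
  move=> pq; apply/eqP; rewrite eqn_leq (H G) //= (H (conv G)) //.
  exact: ring_graph_conv.
move=> hG' pq; apply/leq_sizeP => j /(nth_default 0) qj.
by have := pq j; rewrite qj => /(ring_graph_eq0 hG')[_ ->].
Qed.

Lemma poly_graph_neq0 p q : poly_graph G p q -> (p != 0) = (q != 0).
Proof. by move=> /poly_graph_size pq; rewrite -!size_poly_eq0 pq. Qed.

Lemma dom_poly_graph p :
  (forall i, dom G p`_i) -> exists q, poly_graph G p q.
Proof.
move=> /choice[f fP]; exists (\poly_(i < size p) f i) => i.
rewrite coef_poly; case: ltnP => // pi.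
by rewrite nth_default //; apply: ring_graph0.
Qed.

Lemma compatible_adjoin_ring a b : compatible G a b ->
  ring_graph (adjoin_ring G a b).
Proof.
move=> ab; split=> [|? ? ? ? [p [q [pq [-> ->]]]] [p' [q' [pq' [-> ->]]]]| |].
- by exists 1%:P, 1%:P; rewrite !hornerC; split=> //; apply: poly_graphC; exact: ring_graph1.
- by exists (p - p'), (q - q'); rewrite !hornerD !hornerN; split=> //; apply: poly_graphB.
- move=> ? ? ? ? [p [q [pq [-> ->]]]] [p' [q' [pq' [-> ->]]]].
  by exists (p * p'), (q * q'); rewrite !hornerM; split=> //; apply: poly_graphM.
- by move=> ? ? [p [q [pq [-> ->]]]]; apply: ab.
Qed.

Lemma sub_adjoin_ring a b : G `<=` adjoin_ring G a b.
Proof.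
move=> [x y] xy; exists x%:P, y%:P; rewrite !hornerC; split=> //.
exact: poly_graphC.
Qed.

Lemma mem_adjoin_ring a b : adjoin_ring G a b (a, b).
Proof. by exists 'X, 'X; rewrite !hornerX; split=> //; apply: poly_graphX. Qed.

Section AdjoinGraph.
Variables a b : F.
Hypothesis ab : compatible G a b.

Lemma adjoin_graph_field : field_graph (adjoin_graph G a b).
Proof. exact/fractions_field_graph/compatible_adjoin_ring. Qed.

Lemma sub_adjoin_graph : G `<=` adjoin_graph G a b.
Proof.
apply: subset_trans (@sub_adjoin_ring a b) _.
exact/sub_fractions/compatible_adjoin_ring.
Qed.

Lemma mem_adjoin_graph : adjoin_graph G a b (a, b).
Proof.
apply: sub_fractions; first exact: compatible_adjoin_ring.
exact: mem_adjoin_ring.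
Qed.

End AdjoinGraph.

End PolyGraph.

Lemma adjoin_graph_min G a b H : field_graph H -> G `<=` H -> H (a, b) ->
  adjoin_graph G a b `<=` H.
Proof.
move=> hH GH ab; apply: fractions_min => // _ [p [q [pq ->]]].
have [rH _] := hH.
rewrite !(@horner_coef_wide _ (maxn (size p) (size q))) ?leq_maxl ?leq_maxr //.
apply: ring_graph_sum => // i _; apply: ring_graphM => //; first exact/GH/pq.
exact: ring_graphX.
Qed.

Lemma dom_adjoin_graph G a b : field_graph G -> compatible G a b ->
  dom (adjoin_graph G a b) = adjoin (dom G) [set a].
Proof.
move=> [rG hG] ab; apply/seteqP; split.
  move=> ? [? [x [y [x' [y' [xy xy' x'0 [-> _]]]]]]].
  case: xy xy' x'0 => p [q [pq [-> _]]] [p' [q' [pq' [-> _]]]] p'a.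
  have hA := @adjoin_subfield _ (dom G) [set a].
  have Aa : adjoin (dom G) [set a] a by apply: sub_adjoinr.
  apply: (subfield_div hA); apply: (subfield_horner hA) => // i; apply: sub_adjoinl.
    by exists q`_i.
  by exists q'`_i.
apply: adjoin_min; first exact/dom_subfield/adjoin_graph_field.
  by move=> x [y xy]; exists y; apply: sub_adjoin_graph.
by move=> _ ->; exists b; apply: mem_adjoin_graph.
Qed.

Lemma conv_adjoin_graph G a b : field_graph G -> compatible G a b ->
  conv (adjoin_graph G a b) = adjoin_graph (conv G) b a.
Proof.
move=> [rG hG] ab.
have ba : compatible (conv G) b a.
  by move=> p q pq; have [] := ab q p pq; split.
apply/seteqP; split; last first.
  apply: adjoin_graph_min.
  - exact/field_graph_conv/adjoin_graph_field.
  - by move=> [x y] /= xy; apply: sub_adjoin_graph.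
  - by apply: mem_adjoin_graph.
suff : adjoin_graph G a b `<=` conv (adjoin_graph (conv G) b a).
  by move=> H [x y] /H.
apply: adjoin_graph_min.
- exact/field_graph_conv/adjoin_graph_field/ba/ring_graph_conv.
- move=> [x y] /= xy; apply: sub_adjoin_graph => //; exact: ring_graph_conv.
- apply: mem_adjoin_graph => //; exact: ring_graph_conv.
Qed.

Lemma im_adjoin_graph G a b : field_graph G -> compatible G a b ->
  im (adjoin_graph G a b) = adjoin (im G) [set b].
Proof.
move=> hG ab; have := conv_adjoin_graph hG ab.
have ba : compatible (conv G) b a.
  by move=> p q pq; have [] := ab q p pq; split.
move=> E; rewrite -[RHS](dom_adjoin_graph (field_graph_conv hG) ba) -E.
by [].
Qed.

Lemma compatible_transcendental G a b : field_graph G ->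
  ~ alg_closure (dom G) a -> ~ alg_closure (im G) b -> compatible G a b.
Proof.
move=> hG na nb p q pq; have [rG _] := hG.
have [p0|p0] := eqVneq p 0.
  have q0 : q = 0 by apply/eqP; rewrite -[_ == _]negbK -(poly_graph_neq0 rG pq) p0 eqxx.
  by rewrite p0 q0 !horner0.
have q0 : q != 0 by rewrite -(poly_graph_neq0 rG pq).
split=> [pa|qb].
  case: na; apply/alg_closureP; first exact: subfield0 (dom_subfield hG).
  by exists p; split=> // [i|]; [exists q`_i|apply/rootP].
case: nb; apply/alg_closureP; first exact: subfield0 (im_subfield hG).
by exists q; split=> // [i|]; [exists p`_i|apply/rootP].
Qed.

(** Corresponding polynomials have equal sizes and corresponding leading coefficients, so the usual
    cancellation of leading terms can be run on both sides at once. *)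
Lemma poly_graph_divmod G p q : field_graph G -> poly_graph G p q -> p != 0 ->
  forall f g, poly_graph G f g -> exists h h' r r',
    [/\ poly_graph G h h', poly_graph G r r', f = h * p + r, g = h' * q + r' &
        (size r < size p)%N].
Proof.
move=> [rG hV] pq p0 f g; have [n] := ubnP (size f); elim: n f g => // n IHn f g.
rewrite ltnS => sf fg.
have G0 : poly_graph G 0 0 by move=> i; rewrite coef0; apply: ring_graph0.
have [sfp|spf] := ltnP (size f) (size p).
  by exists 0, 0, f, g; rewrite !mul0r !add0r.
pose c := lead_coef f / lead_coef p; pose c' := lead_coef g / lead_coef q.
pose d := (size f - size p)%N.
have sfg := poly_graph_size rG fg; have spq := poly_graph_size rG pq.
have cc : G (c, c').
  apply: field_graph_div => //; first by rewrite !lead_coefE -sfg; apply: fg.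
  by rewrite !lead_coefE -spq; apply: pq.
pose m : {poly F} := c *: 'X^d; pose m' : {poly F} := c' *: 'X^d.
have mm : poly_graph G m m'.
  move=> i; rewrite !coefZ !coefXn; apply: ring_graphM => //.
  by case: eqP => _; [apply: ring_graph1|apply: ring_graph0].
have lp0 : lead_coef p != 0 by rewrite lead_coef_eq0.
have f0 : f != 0.
  by rewrite -size_poly_gt0; apply: leq_trans spf; rewrite size_poly_gt0.
have c0 : c != 0 by rewrite mulf_neq0 ?invr_eq0 // lead_coef_eq0.
have sm : size (m * p) = size f.
  rewrite /m -scalerAl size_scale // mulrC size_mulXn //; by rewrite subnK.
have lm : lead_coef (m * p) = lead_coef f.
  by rewrite lead_coefM lead_coefZ lead_coefXn mulr1 divfK.
have sfm : (size (f - m * p)%R < n)%N.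
  apply: leq_trans sf; rewrite -(prednK (_ : 0 < size f)%N) ?size_poly_gt0 // ltnS.
  apply/leq_sizeP => j; rewrite leq_eqVlt => /orP[/eqP<-|].
    by rewrite coefB -lead_coefE -{1}sm -lead_coefE lm subrr.
  move=> jf; rewrite coefB !nth_default ?subrr //.
    by rewrite sm -(prednK (_ : 0 < size f)%N) ?size_poly_gt0.
  by rewrite -(prednK (_ : 0 < size f)%N) ?size_poly_gt0.
have [|h [h' [r [r' [hh rr fE gE sr]]]]] := IHn (f - m * p) (g - m' * q) sfm.
  by apply: poly_graphB => //; apply: poly_graphM.
exists (h + m), (h' + m'), r, r'; split=> //.
- by move=> i; rewrite !coefD; apply: ring_graphD.
- by rewrite mulrDl addrAC -fE subrK.
- by rewrite mulrDl addrAC -gE subrK.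
Qed.

End PartialIsomorphisms.

(** * Extension of isomorphisms *)

(** [Zorn_bigcup] also asks for the union of the empty chain. Applying it to the sets A with Q of
    the union of G0 and A turns that case into Q G0. *)
Lemma Zorn_above T (Q : set (set T)) (G0 : set T) : Q G0 ->
    (forall C : set (set T), C !=set0 -> (forall X, C X -> G0 `<=` X /\ Q X) ->
       total_on C subset -> Q (\bigcup_(X in C) X)) ->
  exists G, [/\ G0 `<=` G, Q G & forall H, Q H -> G `<=` H -> H = G].
Proof.
move=> QG0 Qcup; pose P := [set A : set T | Q (G0 `|` A)].
have [C CP Ctot|A [PA Amax]] := @Zorn_bigcup _ P.
  have [->|/set0P[X0 CX0]] := eqVneq C set0.
    by rewrite /P /= bigcup_set0 setU0.
  rewrite /P /=; pose C' := [set G0 `|` X | X in C].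
  have -> : G0 `|` \bigcup_(X in C) X = \bigcup_(X in C') X.
    apply/seteqP; split=> [x [Gx|[X CX Xx]]|x [_ [X CX <-] [Gx|Xx]]].
    - by exists (G0 `|` X0); [exists X0|left].
    - by exists (G0 `|` X); [exists X|right].
    - by left.
    - by right; exists X.
  apply: Qcup; first by exists (G0 `|` X0), X0.
    by move=> _ [X CX <-]; split; [move=> x; left|exact: CP].
  move=> _ _ [X CX <-] [Y CY <-].
  by case: (Ctot _ _ CX CY) => XY; [left|right]; apply: setUS.
exists (G0 `|` A); split=> [x||H QH AH]; [by left|by []|].
have GH : G0 `<=` H by move=> x Gx; apply: AH; left.
have PH : P H by rewrite /P /= ((setUidPr _ _).2 GH).
apply/seteqP; split=> //; apply: contrapT => HA.
apply: (Amax H) => //; split; last by move=> AHe; apply: HA => x Hx; right; apply: AHe.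
by move=> x Ax; apply: AH; right.
Qed.

Section GraphExtension.
Variable F : closedFieldType.
Implicit Types (G H : set (F * F)) (K N : set F) (p q : {poly F}).

Lemma field_graph_bigcup (C : set (set (F * F))) : C !=set0 ->
  (forall G, C G -> field_graph G) -> total_on C subset ->
  field_graph (\bigcup_(G in C) G).
Proof.
move=> [G0 CG0] CG tot; split; first split.
- by exists G0 => //; case: (CG _ CG0) => /ring_graph1.
- move=> x y x' y' [G GC xy] [G' G'C xy'].
  case: (tot _ _ GC G'C) => [/(_ _ xy) {}xy|/(_ _ xy') {}xy'].
    by exists G' => //; case: (CG _ G'C) => hG _; apply: ring_graphB.
  by exists G => //; case: (CG _ GC) => hG _; apply: ring_graphB.
- move=> x y x' y' [G GC xy] [G' G'C xy'].
  case: (tot _ _ GC G'C) => [/(_ _ xy) {}xy|/(_ _ xy') {}xy'].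
    by exists G' => //; case: (CG _ G'C) => hG _; apply: ring_graphM.
  by exists G => //; case: (CG _ GC) => hG _; apply: ring_graphM.
- by move=> x y [G /CG[hG _] /(ring_graph_eq0 hG)].
- by move=> x y [G GC xy]; exists G => //; case: (CG _ GC) => _; apply.
Qed.

Lemma dom_bigcup (C : set (set (F * F))) :
  dom (\bigcup_(G in C) G) = \bigcup_(G in C) dom G.
Proof. by apply/seteqP; split=> [x [y [G CG xy]]|x [G CG [y xy]]]; [exists G => //; exists y|exists y, G]. Qed.

Lemma im_bigcup (C : set (set (F * F))) :
  im (\bigcup_(G in C) G) = \bigcup_(G in C) im G.
Proof. by apply/seteqP; split=> [x [y [G CG xy]]|x [G CG [y xy]]]; [exists G => //; exists y|exists y, G]. Qed.

Lemma dom_mono G H : G `<=` H -> dom G `<=` dom H.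
Proof. by move=> GH x [y /GH xy]; exists y. Qed.

Lemma im_mono G H : G `<=` H -> im G `<=` im H.
Proof. by move=> GH x [y /GH xy]; exists y. Qed.

Lemma minimal_poly K a : K 0 -> alg_closure K a -> exists p,
  [/\ forall i, K p`_i, p != 0, p.[a] = 0 &
      forall f : {poly F}, (forall i, K f`_i) -> f != 0 -> f.[a] = 0 -> (size p <= size f)%N].
Proof.
move=> K0 /(alg_closureP _ K0)[p0 [Kp0 p00 /rootP p0a]].
pose S n := exists p, [/\ forall i, K p`_i, p != 0, p.[a] = 0 & size p = n].
have [n [[p [Kp p_0 pa <-]] nmin]] : exists n, S n /\ forall m, S m -> (n <= m)%N.
  have exS : exists n, `[< S n >] by exists (size p0); apply/asboolP; exists p0.
  have [n /asboolP Sn nmin] := ex_minnP exS.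
  by exists n; split=> // m Sm; apply: nmin; apply/asboolP.
by exists p; split=> // f Kf f0 fa; apply: nmin; exists f.
Qed.

Lemma compatible_minimal_poly G p q a b : field_graph G ->
    poly_graph G p q -> p != 0 -> p.[a] = 0 -> q.[b] = 0 ->
    (forall f : {poly F}, (forall i, dom G f`_i) -> f != 0 -> f.[a] = 0 ->
       (size p <= size f)%N) ->
  compatible G a b.
Proof.
move=> hG pq p0 pa qb pmin f g fg; have [rG _] := hG.
have domp f' g' : poly_graph G f' g' -> forall i, dom G f'`_i.
  by move=> fg' i; exists g'`_i.
have eq0 f' g' : poly_graph G f' g' -> f' = 0 -> g' = 0.
  move=> fg' f0; apply/eqP; rewrite -[_ == _]negbK -(poly_graph_neq0 rG fg').
  by rewrite f0 eqxx.
(* Minimality is known only for p at a; this is its counterpart for q at b. Divide p by r: a nonzero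
   remainder is a smaller counterexample. If r divides p, then a is a root of r or of the cofactor;
   minimality of p excludes the former and, in the latter case, makes r, hence r', a nonzero
   constant. *)
have none n : forall r r', poly_graph G r r' -> r != 0 -> (size r <= n)%N ->
    (size r < size p)%N -> r'.[b] = 0 -> False.
  elim: n => [|n IHn] r r' rr r0 srn srp rb.
    by move: srn; rewrite leqn0 size_poly_eq0 (negPf r0).
  have [h [h' [s [s' [hh ss pE qE sr]]]]] := poly_graph_divmod hG rr r0 pq.
  have sb : s'.[b] = 0 by move: qb; rewrite qE hornerD hornerM rb mulr0 add0r.
  have [s0|s0] := eqVneq s 0; last first.
    apply: (IHn s s') => //; first by rewrite -ltnS (leq_trans sr).
    exact: ltn_trans sr srp.
  move: pE; rewrite s0 addr0 => pE.
  have h0 : h != 0 by apply: contra_neq p0 => h0; rewrite pE h0 mul0r.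
  have : h.[a] * r.[a] = 0 by rewrite -hornerM -pE.
  move/eqP; rewrite mulf_eq0 => /orP[/eqP ha|/eqP ra]; last first.
    by have := pmin r (domp _ _ rr) r0 ra; rewrite leqNgt srp.
  have := pmin h (domp _ _ hh) h0 ha; rewrite pE size_mul //.
  move=> hrh; have r1 : (size r <= 1)%N.
    move: hrh; move: h0; rewrite -size_poly_gt0; case: (size h) => // m _.
    by rewrite addSn /= -addn1 leq_add2l.
  have r'0 : r' != 0 by rewrite -(poly_graph_neq0 rG rr).
  move: r1 rb r'0; rewrite (poly_graph_size rG rr) => /size1_polyC ->.
  by rewrite hornerC => ->; rewrite eqxx.
have [h [h' [r [r' [hh rr fE gE sr]]]]] := poly_graph_divmod hG pq p0 fg.
have -> : f.[a] = r.[a] by rewrite fE hornerD hornerM pa mulr0 add0r.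
have -> : g.[b] = r'.[b] by rewrite gE hornerD hornerM qb mulr0 add0r.
have [r0|r0] := eqVneq r 0; first by rewrite r0 (eq0 _ _ rr r0) !horner0.
split=> [ra|rb].
  by have := pmin r (domp _ _ rr) r0 ra; rewrite leqNgt sr.
by case: (none (size r) r r').
Qed.

Lemma compatible_algebraic G a : field_graph G -> alg_closure (dom G) a ->
  exists2 b, alg_closure (im G) b & compatible G a b.
Proof.
move=> hG Ga; have [rG _] := hG.
have [p [Kp p0 pa pmin]] := minimal_poly (subfield0 (dom_subfield hG)) Ga.
have [q pq] := dom_poly_graph rG Kp.
have spq := poly_graph_size rG pq.
have sq : (1 < size q)%N.
  rewrite -spq ltnNge; apply/negP => /size1_polyC pE.
  by move: pa p0; rewrite pE hornerC => ->; rewrite eqxx.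
have [b /rootP qb] := closed_field_root sq.
exists b; last exact: (compatible_minimal_poly hG pq p0 pa qb).
apply/alg_closureP; first exact: subfield0 (im_subfield hG).
exists q; split; [by move=> i; exists p`_i| |exact/rootP].
by rewrite -(poly_graph_neq0 rG pq).
Qed.

(** A maximal extension H between the two closures already contains every compatible pair. Since F
    is algebraically closed, [compatible_algebraic] finds a partner for each a, and applied to
    [conv H] for each b. *)
Lemma extend_alg_closure G : field_graph G -> exists H,
  [/\ G `<=` H, field_graph H, dom H = alg_closure (dom G) &
      im H = alg_closure (im G)].
Proof.
move=> hG.
have hdG := dom_subfield hG; have hiG := im_subfield hG.
pose Q H := [/\ field_graph H, dom H `<=` alg_closure (dom G) &
                im H `<=` alg_closure (im G)].
have [|C C0 CQ tot|H [GH [hH dH iH] Hmax]] := @Zorn_above _ Q G.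
- by split=> //; apply: sub_alg_closure.
- split; first by apply: field_graph_bigcup => // X /CQ[_ []].
    by rewrite dom_bigcup => x [X /CQ[_ [_ + _]]]; apply.
  by rewrite im_bigcup => x [X /CQ[_ [_ _]]]; apply.
have [rH _] := hH.
have Gd : alg_closure (dom G) `<=` alg_closure (dom H) := alg_closure_mono (dom_mono GH).
have Gi : alg_closure (im G) `<=` alg_closure (im H) := alg_closure_mono (im_mono GH).
have dH' : alg_closure (dom H) `<=` alg_closure (dom G).
  by rewrite -[X in _ `<=` X]alg_closureK //; apply: alg_closure_mono.
have iH' : alg_closure (im H) `<=` alg_closure (im G).
  by rewrite -[X in _ `<=` X]alg_closureK //; apply: alg_closure_mono.
have step a b : alg_closure (dom G) a -> alg_closure (im G) b ->
    compatible H a b -> H (a, b).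
  move=> Ga Gb ab.
  rewrite -(Hmax (adjoin_graph H a b)); first exact: mem_adjoin_graph.
    split; first exact: adjoin_graph_field.
      rewrite dom_adjoin_graph //; apply: adjoin_min => //.
        exact: alg_closure_subfield.
      by move=> _ ->.
    rewrite im_adjoin_graph //; apply: adjoin_min => //.
      exact: alg_closure_subfield.
    by move=> _ ->.
  exact: sub_adjoin_graph.
exists H; split=> //; apply/seteqP; split=> //.
  move=> a Ga; have [b Hb ab] := compatible_algebraic hH (Gd _ Ga).
  by exists b; apply: step => //; apply: iH'.
move=> b Gb; have [a Ha ba] := compatible_algebraic (field_graph_conv hH) (Gi _ Gb).
exists a; apply: step => //; first exact: dH'.
by move=> p q pq; have [] := ba q p pq; split.
Qed.

(* Adjoining a transcendental c paired with itself keeps domain and image equal;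
   a maximal such extension inside N has N algebraic over its domain. *)
Lemma extend_onto G N : field_graph G -> dom G = im G -> dom G `<=` N ->
  is_subfield N -> alg_closure N = N ->
  exists H, [/\ G `<=` H, field_graph H, dom H = N & im H = N].
Proof.
move=> hG dG GN hN cN.
pose Q H := [/\ field_graph H, dom H = im H & dom H `<=` N].
have [|C C0 CQ tot|H [GH [hH dH HN] Hmax]] := @Zorn_above _ Q G.
- by [].
- split; first by apply: field_graph_bigcup => // X /CQ[_ []].
    by rewrite dom_bigcup im_bigcup; apply: eq_bigcupr => X /CQ[_ []].
  by rewrite dom_bigcup => x [X /CQ[_ [_ _]]]; apply.
have [rH _] := hH.
have NH : N `<=` alg_closure (dom H).
  move=> c Nc; apply: contrapT => nHc.
  have cc : compatible H c c by apply: compatible_transcendental; rewrite -?dH.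
  apply: nHc; apply: sub_alg_closure; first exact: dom_subfield.
  rewrite -(Hmax (adjoin_graph H c c)).
  + by exists c; apply: mem_adjoin_graph.
  + split; first exact: adjoin_graph_field.
      by rewrite dom_adjoin_graph // im_adjoin_graph // dH.
    by rewrite dom_adjoin_graph //; apply: adjoin_min => // _ ->.
  + exact: sub_adjoin_graph.
have [H' [HH' hH' dH' iH']] := extend_alg_closure hH.
have HN' : alg_closure (dom H) = N.
  by apply/seteqP; split=> //; rewrite -[X in _ `<=` X]cN; apply: alg_closure_mono.
exists H'; split=> //; first exact: subset_trans HH'.
  by rewrite dH'.
by rewrite iH' -dH.
Qed.

End GraphExtension.

Section AutomorphismExtension.
Variables (F : closedFieldType) (k : set F).
Implicit Types (G : set (F * F)) (K N S T L : set F).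

Lemma field_graph_fieldAut G : field_graph G -> dom G = setT -> im G = setT ->
  id_graph k `<=` G -> exists s : fieldAut k, forall x y, G (x, y) -> s x = y.
Proof.
move=> hG dG iG kG; have [rG _] := hG.
have /choice[f fP] : forall x, exists y, G (x, y) by move=> x; have : [set: F] x by []; rewrite -dG.
have /choice[g gP] : forall y, exists x, G (x, y) by move=> x; have : [set: F] x by []; rewrite -iG.
have fE x y : G (x, y) -> f x = y by move=> xy; apply: ring_graph_functional (fP x) xy.
have fA : [/\ zmod_morphism f, monoid_morphism f, bijective f & forall x, k x -> f x = x].
  split.
  - by move=> x y; apply: fE; apply: ring_graphB.
  - by split=> [|x y]; apply: fE; [apply: ring_graph1|apply: ring_graphM].
  - exists g => [x|x]; last exact: fE.
    exact: (ring_graph_injective rG (gP (f x)) (fP x)).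
  - by move=> x kx; apply/fE/kG.
by exists (FieldAut fA) => x y /fE.
Qed.

(** The extension is made onto N first and onto F afterwards; the intermediate stage forces the
    automorphism to stabilize N. *)
Lemma extend_fieldAut_in G N : field_graph G -> dom G = im G -> dom G `<=` N ->
  id_graph k `<=` G -> is_subfield N -> alg_closure N = N ->
  exists s : fieldAut k, (forall x y, G (x, y) -> s x = y) /\ stabilizing k N s.
Proof.
move=> hG dG GN kG hN cN.
have [H [GH hH dH iH]] := extend_onto hG dG GN hN cN.
have hT := subfield_setT F; have cT := alg_closure_setT F.
have [H' [HH' hH' dH' iH']] :
    exists H', [/\ H `<=` H', field_graph H', dom H' = setT & im H' = setT].
  by apply: extend_onto => //; rewrite dH iH.
have [s sP] := field_graph_fieldAut hH' dH' iH' (subset_trans kG (subset_trans GH HH')).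
exists s; split=> [x y /GH/HH'/sP //|].
apply/seteqP; split=> [_ [x + <-]|y].
  by rewrite -{1}dH -{1}iH => -[y xy]; rewrite (sP _ _ (HH' _ xy)); exists x.
rewrite -iH => -[x xy]; exists x; last exact/sP/HH'.
by rewrite iH -dH; exists y.
Qed.

End AutomorphismExtension.

(** * The pregeometry of algebraic closure over k *)

Section Pregeometry.
Variables (F : closedFieldType) (k : set F).
Implicit Types (G : set (F * F)) (K N S T L : set F).

Definition acl S := alg_closure (adjoin k S).

Definition acl_closed L := [/\ is_subfield L, k `<=` L & alg_closure L = L].

Lemma acl_subfield S : is_subfield (acl S).
Proof. exact/alg_closure_subfield/adjoin_subfield. Qed.

Lemma sub_acl S : S `<=` acl S.
Proof.
apply: subset_trans (@sub_adjoinr _ k S) _.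
exact/sub_alg_closure/adjoin_subfield.
Qed.

Lemma base_acl S : k `<=` acl S.
Proof.
apply: subset_trans (@sub_adjoinl _ k S) _.
exact/sub_alg_closure/adjoin_subfield.
Qed.

Lemma acl_aclosed S : acl_closed (acl S).
Proof.
split; [exact: acl_subfield|exact: base_acl|].
exact/alg_closureK/adjoin_subfield.
Qed.

Lemma acl_min S L : acl_closed L -> S `<=` L -> acl S `<=` L.
Proof.
by move=> [hL kL cL] SL; rewrite -cL; apply: alg_closure_mono; apply: adjoin_min.
Qed.

Lemma acl_id L : acl_closed L -> acl L = L.
Proof. by move=> hL; apply/seteqP; split; [apply: acl_min|apply: sub_acl]. Qed.

Lemma acl_sub S T : S `<=` acl T -> acl S `<=` acl T.
Proof. by move=> ST; apply: acl_min => //; apply: acl_aclosed. Qed.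

Lemma acl_mono S T : S `<=` T -> acl S `<=` acl T.
Proof. by move=> ST; apply: acl_sub; apply: subset_trans ST (@sub_acl T). Qed.

Lemma acl_setU1 S a : alg_closure (adjoin (acl S) [set a]) = acl (a |` S).
Proof.
have hA := @adjoin_subfield _ (acl S) [set a].
apply/seteqP; split.
  case: (acl_aclosed (a |` S)) => h1 _ <-; apply: alg_closure_mono.
  apply: adjoin_min => //; first by apply: acl_mono => x; right.
  by move=> _ ->; apply: sub_acl; left.
apply: acl_min.
  split; first exact: alg_closure_subfield.
    apply: subset_trans (@base_acl S) _; apply: subset_trans (@sub_adjoinl _ _ _) _.
    exact: sub_alg_closure.
  exact: alg_closureK.
move=> x [->|Sx]; apply: sub_alg_closure => //; first exact: sub_adjoinr.
by apply: sub_adjoinl; apply: sub_acl.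
Qed.

Lemma transcendental_eq0 K b (p : {poly F}) : is_subfield K ->
  ~ alg_closure K b -> (forall i, K p`_i) -> p.[b] = 0 -> p = 0.
Proof.
move=> hK nb Kp pb; apply: contrapT => /eqP p0; apply: nb.
by apply/alg_closureP; [exact: subfield0|exists p; split=> //; apply/rootP].
Qed.

(** The pair (a, a) is always compatible with the identity of K, and the domain of the graph it
    generates consists of such fractions by construction. *)
Lemma adjoin1P K a x : is_subfield K -> adjoin K [set a] x <->
  exists p q : {poly F}, [/\ forall i, K p`_i, forall i, K q`_i, q.[a] != 0 &
     x = p.[a] / q.[a]].
Proof.
move=> hK; split=> [|[p [q [Kp Kq qa ->]]]]; last first.
  have hA := @adjoin_subfield _ K [set a].
  have Aa : adjoin K [set a] a by apply: sub_adjoinr.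
  by apply: (subfield_div hA); apply: (subfield_horner hA) => // i; apply: sub_adjoinl.
have [rK _] := id_graph_field hK.
have gr (p q : {poly F}) : poly_graph (id_graph K) p q -> p = q.
  by move=> pq; apply/polyP => i; case: (pq i).
have aa : compatible (id_graph K) a a by move=> p q /gr ->.
have := dom_adjoin_graph (id_graph_field hK) aa; rewrite dom_id_graph => <-.
move=> [? [u [v [u' [v' [[p [? [pq [-> _]]]] [q [? [pq' [-> _]]]] qa [-> _]]]]]]].
by exists p, q; split=> // i; [case: (pq i)|case: (pq' i)].
Qed.

(** Multiplying p by the product c of the denominators of its coefficients leaves a polynomial in
    two variables over K, the inner one specialized at a. *)
Lemma clear_denominators K a (p : {poly F}) : is_subfield K ->
  (forall i, adjoin K [set a] p`_i) -> exists (c : F) (P : {poly {poly F}}),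
  [/\ c != 0, forall i j, K P`_i`_j & map_poly (horner_eval a) P = c *: p].
Proof.
move=> hK Kp.
have [f fP] := choice (fun i => (adjoin1P a _ hK).1 (Kp i)).
have [g gP] := choice fP.
pose D (i : nat) : {poly F} := \prod_(j < size p | j != i :> nat) g j.
exists (\prod_(j < size p) (g j).[a]), (\poly_(i < size p) (f i * D i)); split.
- by apply/prodf_neq0 => j _; case: (gP j).
- move=> i j; rewrite coef_poly; case: ifP => _; last by rewrite coef0; apply: subfield0.
  suff: (f i * D i) \is a polyOver (subfield_pred hK).
    by move=> /polyOverP/(_ j)/set_mem.
  have PO (q : {poly F}) : (forall i, K q`_i) -> q \is a polyOver (subfield_pred hK).
    by move=> Kq; apply/polyOverP => l; apply: (mem_set (Kq l)).
  apply: rpredM; first by apply: PO; case: (gP i).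
  by apply: rpred_prod => l _; apply: PO; case: (gP l).
- apply/polyP => i; rewrite coef_map_id0 ?/horner_eval ?horner0 // coef_poly coefZ.
  case: ltnP => ip; last by rewrite horner0 nth_default // mulr0.
  have [_ _ ga ->] := gP i.
  have -> : \prod_(j < size p) (g j).[a] = (g i).[a] * (D i).[a].
    by rewrite (bigD1 (Ordinal ip)) //= /D horner_prod.
  by rewrite hornerM [RHS]mulrC mulrA divfK.
Qed.

(** A relation for b over K(a), cleared of denominators, is a two-variable polynomial P over K.
    Specializing the outer variable at b instead of the inner one at a gives a relation for a over
    K(b). It is nonzero because b, being transcendental over K, kills no nonzero coefficient
    polynomial. *)
Lemma exchange K a b : is_subfield K ->
  alg_closure (adjoin K [set a]) b -> ~ alg_closure K b ->
  alg_closure (adjoin K [set b]) a.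
Proof.
move=> hK ab nb; have hA c := @adjoin_subfield _ K [set c].
have /(alg_closureP _ (subfield0 (hA a)))[p [Kp p0 /rootP pb]] := ab.
have [c [P [c0 KP PE]]] := clear_denominators hK Kp.
have cP j : (P.[b%:P])`_j = (\poly_(i < size P) P`_i`_j).[b].
  rewrite horner_coef coef_sum horner_poly; apply: eq_bigr => l _.
  by rewrite -polyC_exp coefMC.
apply/(alg_closureP _ (subfield0 (hA b))); exists P.[b%:P]; split.
- move=> j; rewrite cP; apply: (subfield_horner (hA b)); last exact: sub_adjoinr.
  move=> i; rewrite coef_poly; case: ifP => _; last by apply: sub_adjoinl; apply: subfield0.
  exact: sub_adjoinl.
- apply/eqP => P0; case/eqP: p0; apply/polyP => i.
  have : (c *: p)`_i = 0.
    rewrite -PE coef_map_id0 ?/horner_eval ?horner0 //.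
    suff -> : P = 0 by rewrite coef0 horner0.
    apply/polyP => l; apply/polyP => j; rewrite !coef0.
    have Q0 : \poly_(i < size P) P`_i`_j = 0.
      apply: (transcendental_eq0 hK nb); last by rewrite -cP // P0 coef0.
      by move=> m; rewrite coef_poly; case: ifP => _ //; apply: subfield0.
    have := congr1 (fun q : {poly F} => q`_l) Q0; rewrite coef_poly coef0.
    by case: ltnP => // lP _; rewrite (nth_default 0 lP) coef0.
  by rewrite coefZ coef0 => /eqP; rewrite mulf_eq0 (negPf c0) => /eqP.
- apply/rootP; have -> : P.[b%:P].[a] = (map_poly (horner_eval a) P).[b].
    rewrite -[RHS]/((map_poly (horner_eval a) P).[b]) -[in RHS](hornerC b a).
    by rewrite -[(b%:P).[a]]/(horner_eval a b%:P) horner_map.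
  by rewrite PE hornerZ pb mulr0.
Qed.

Lemma acl_exchange S a b : acl (a |` S) b -> ~ acl S b -> acl (b |` S) a.
Proof.
rewrite -!acl_setU1 => ab nb; apply: exchange => //; first exact: acl_subfield.
by case: (acl_aclosed S) => _ _ ->.
Qed.

End Pregeometry.

(** * Algebraic dependence *)

Section FieldAutTheory.
Variables (F : closedFieldType) (k : set F).
Local Notation acl := (acl k).
Implicit Types (s t : fieldAut k) (S T K : set F).

Lemma fieldAutK s : cancel s (s^-1)%g.
Proof. by move=> x; rewrite -fieldAutME mulVg. Qed.

Lemma fieldAutVK s : cancel (s^-1)%g s.
Proof. by move=> x; rewrite -fieldAutME mulgV. Qed.

Lemma fieldAut_inj s : injective s.
Proof. exact: can_inj (fieldAutK s). Qed.

Lemma adjoin_fieldAut s S x : adjoin k S x -> adjoin k (s @` S) (s x).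
Proof.
have hA := @adjoin_subfield _ k (s @` S).
pose P : set F := [set x | adjoin k (s @` S) (s x)].
have PF : is_subfield P.
  apply: subfieldP => [|y z Py Pz|y z Py Pz]; rewrite /P /=.
  - by rewrite rmorph1; apply: (subfield1 hA).
  - by rewrite rmorphB; apply: (subfieldB hA).
  - by rewrite fmorph_div; apply: (subfield_div hA).
move: x; apply: (adjoin_min PF) => x.
  by move=> kx; rewrite /P /= fieldAut_id //; apply: sub_adjoinl.
by move=> Sx; apply: sub_adjoinr; exists x.
Qed.

Lemma acl_fieldAut s S x : acl S x -> acl (s @` S) (s x).
Proof.
have h0 T := subfield0 (@adjoin_subfield _ k T).
move=> /(alg_closureP _ (h0 _))[p [Kp p0 /rootP px]].
apply/(alg_closureP _ (h0 _)); exists (map_poly s p).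
split; [by move=> i; rewrite coef_map; apply: adjoin_fieldAut|by rewrite map_poly_eq0|].
by apply/rootP; rewrite horner_map px rmorph0.
Qed.

Lemma fieldAut_imageK s S : (s^-1)%g @` (s @` S) = S.
Proof.
apply/seteqP; split=> [_ [_ [x Sx <-] <-]|x Sx]; first by rewrite fieldAutK.
by exists (s x); [exists x|rewrite fieldAutK].
Qed.

Lemma acl_fieldAutE s S x : acl (s @` S) (s x) <-> acl S x.
Proof.
split=> [/(acl_fieldAut (s^-1)%g)|/acl_fieldAut //].
by rewrite fieldAut_imageK fieldAutK.
Qed.

Lemma image_acl s S : s @` acl S = acl (s @` S).
Proof.
apply/seteqP; split=> [_ [x /acl_fieldAut + <-] //|y].
by rewrite -{1}(fieldAutVK s y) => /acl_fieldAutE ay; exists ((s^-1)%g y) => //; apply: fieldAutVK.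
Qed.

Lemma fixing_image s S : fixing k S s -> s @` S = S.
Proof.
move=> sS; apply/seteqP; split=> [_ [x Sx <-]|x Sx]; first by rewrite sS.
by exists x => //; apply: sS.
Qed.

Lemma fixingV S s : fixing k S s -> fixing k S (s^-1)%g.
Proof. by move=> sS x Sx; rewrite -{1}(sS x Sx) fieldAutK. Qed.

Lemma fixingM S s t : fixing k S s -> fixing k S t -> fixing k S (s * t)%g.
Proof. by move=> sS tS x Sx; rewrite fieldAutME tS ?sS. Qed.

Lemma fixing_sub S T : S `<=` T -> fixing k T `<=` fixing k S.
Proof. by move=> ST s sT x /ST/sT. Qed.

Lemma fixing_adjoin S s : fixing k S s -> fixing k (adjoin k S) s.
Proof.
move=> sS; apply: adjoin_min; last exact: sS.
  apply: subfieldP => [|x y /= sx sy|x y /= sx sy].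
  - exact: rmorph1.
  - by rewrite rmorphB /= sx sy.
  - by rewrite fmorph_div /= sx sy.
by move=> x kx; apply: fieldAut_id.
Qed.

End FieldAutTheory.

(** * Independent sequences and dimension *)

Section Independence.
Variables (F : closedFieldType) (k : set F).
Local Notation acl := (acl k).
Implicit Types (S T N L : set F) (xs ys : seq F).

(** Each entry is compared only with N and the entries before it, which suits induction along the
    list; [indep_perm] shows that the order is immaterial. *)
Fixpoint indep N xs : Prop :=
  if xs is x :: xs' then ~ acl N x /\ indep (x |` N) xs' else True.

Lemma setU_cons N x xs : N `|` [set` x :: xs] = (x |` N) `|` [set` xs].
Proof.
apply/seteqP; split=> y /=.
  by rewrite inE => -[Ny|/orP[/eqP->|yx]]; [left; right|left; left|right].
by rewrite inE => -[[->|Ny]|->]; rewrite ?eqxx ?orbT; [right|left|right].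
Qed.

Lemma setU_nil N : N `|` [set` [::]] = N.
Proof. by apply/seteqP; split=> y /=; [case|left]. Qed.

(** The vector x replaces the first entry of ys whose addition brings x into the closure. *)
Lemma exchange_seq N ys x : acl (N `|` [set` ys]) x -> ~ acl N x ->
  exists2 ys', size ys = (size ys').+1 &
    acl (N `|` [set` ys]) `<=` acl (x |` N `|` [set` ys']).
Proof.
elim: ys N => [|y ys IHys] N; first by rewrite setU_nil.
rewrite setU_cons => xy nx; have [yx|nyx] := pselect (acl (y |` N) x).
  have xy' := acl_exchange yx nx.
  exists ys => //; apply: acl_sub => z [[->|Nz]|zs].
  - by apply: acl_mono xy' => w; left.
  - by apply: sub_acl; left; right.
  - by apply: sub_acl; right.
have [ys' sys sub] := IHys _ xy nyx; exists (y :: ys'); first by rewrite /= sys.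
rewrite setU_cons; apply: subset_trans sub _; apply: acl_mono => z.
by move=> [[->|[->|Nz]]|zs]; [left; right; left|left; left|left; right; right|right].
Qed.

Lemma steinitz N xs ys : indep N xs ->
  [set` xs] `<=` acl (N `|` [set` ys]) -> (size xs <= size ys)%N.
Proof.
elim: xs N ys => [//|x xs IHxs] N ys [nx ix] sub.
have xy : acl (N `|` [set` ys]) x by apply: sub; rewrite /= mem_head.
have [ys' -> sub'] := exchange_seq xy nx; rewrite ltnS; apply: IHxs ix _.
by move=> z zx; apply/sub'/sub; rewrite /= inE (zx : z \in xs) orbT.
Qed.

Lemma not_indep N xs : ~ indep N xs -> exists2 ys, (size ys < size xs)%N &
  [set` xs] `<=` acl (N `|` [set` ys]).
Proof.
elim: xs N => [|x xs IHxs] N; first by move=> /(_ I).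
move=> /not_andP[/contrapT Nx|/IHxs[ys sy sub]].
  exists xs => // y /=; rewrite inE => /orP[/eqP->|yx].
    by apply: acl_mono Nx => w; left.
  by apply: sub_acl; right.
exists (x :: ys) => // y /=; rewrite inE setU_cons => /orP[/eqP->|/sub //].
by apply: sub_acl; left; left.
Qed.

Lemma indep_perm N xs ys : perm_eq xs ys -> indep N xs -> indep N ys.
Proof.
move=> xy ix; apply: contrapT => /not_indep[zs sz sub].
suff : (size xs <= size zs)%N by rewrite leqNgt (perm_size xy) sz.
by apply: (steinitz ix) => z /= zx; apply: sub; rewrite /= -(perm_mem xy).
Qed.

Lemma indep_cat N xs ys :
  indep N (xs ++ ys) <-> indep N xs /\ indep (N `|` [set` xs]) ys.
Proof.
elim: xs N => [|x xs IHxs] N; first by rewrite setU_nil /=; split=> [//|[]].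
rewrite /= setU_cons; split; first by move=> [nx /IHxs[? ?]].
by move=> [[nx ix] iy]; split=> //; apply/IHxs.
Qed.

Lemma indep_anti N N' xs : N' `<=` acl N -> indep N xs -> indep N' xs.
Proof.
elim: xs N N' => [//|x xs IHxs] N N' NN' [nx ix]; split.
  by move=> /(acl_sub NN').
apply: IHxs ix => y [->|/NN' Ny]; first by apply: sub_acl; left.
by apply: acl_mono Ny => z; right.
Qed.

Lemma indep_sym N xs ys : indep N xs -> indep (N `|` [set` xs]) ys ->
  indep (N `|` [set` ys]) xs.
Proof.
move=> ix iy; have : indep N (xs ++ ys) by apply/indep_cat.
move=> /(indep_perm (_ : perm_eq _ (ys ++ xs))) -/(_ _)/indep_cat[] //.
by rewrite perm_catC.
Qed.

Lemma indep_rcons N xs y : indep N xs -> ~ acl (N `|` [set` xs]) y ->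
  indep N (rcons xs y).
Proof. by move=> ix ny; rewrite -cats1; apply/indep_cat. Qed.

Lemma maximal_indep_span N L xs : indep N xs -> [set` xs] `<=` L ->
  (forall ys, indep N ys -> [set` ys] `<=` L -> (size ys <= size xs)%N) ->
  L `<=` acl (N `|` [set` xs]).
Proof.
move=> ix xL max y Ly; apply: contrapT => ny.
have := max _ (indep_rcons ix ny); rewrite size_rcons ltnn => /(_ _)/negP[] // z.
by rewrite /= mem_rcons inE => /orP[/eqP-> //|/xL].
Qed.

Lemma exists_basis N L (ms : seq F) : L `<=` acl (N `|` [set` ms]) -> exists xs : seq F,
  [/\ indep N xs, [set` xs] `<=` L & L `<=` acl (N `|` [set` xs])].
Proof.
move=> Lms.
pose P n := `[< exists xs : seq F, [/\ indep N xs, [set` xs] `<=` L & size xs = n] >].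
have P0 : exists n, P n by exists 0%N; apply/asboolP; exists [::].
have Pmax n : P n -> (n <= size ms)%N.
  move=> /asboolP[xs [ix xL <-]]; apply: (steinitz ix).
  exact: subset_trans Lms.
have [n /asboolP[xs [ix xL sx]] nmax] := ex_maxnP P0 Pmax.
exists xs; split=> //; apply: maximal_indep_span => // ys iy yL.
by rewrite sx; apply: nmax; apply/asboolP; exists ys.
Qed.

Lemma indep_fieldAut (s : fieldAut k) N xs :
  indep N xs -> indep (s @` N) (map s xs).
Proof.
elim: xs N => [//|x xs IHxs] N [nx ix] /=; split; first by move=> /acl_fieldAutE.
by have := IHxs _ ix; rewrite image_setU image_set1.
Qed.

Lemma indep_size_span N L xs ys : indep N xs -> [set` xs] `<=` L ->
  L `<=` acl (N `|` [set` ys]) -> (size ys <= size xs)%N ->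
  L `<=` acl (N `|` [set` xs]).
Proof.
move=> ix xL Ly sy; apply: maximal_indep_span => // zs iz zL.
by apply: leq_trans sy; apply: (steinitz iz); apply: subset_trans zL Ly.
Qed.

Definition finitely_spanned L := exists ms : seq F, L `<=` acl [set` ms].

Lemma finitely_spannedU L L' : finitely_spanned L -> finitely_spanned L' ->
  finitely_spanned (L `|` L').
Proof.
move=> [ms Lms] [ms' L'ms]; exists (ms ++ ms') => x [/Lms|/L'ms].
  by apply: acl_mono => z /= zm; rewrite mem_cat zm.
by apply: acl_mono => z /= zm; rewrite mem_cat zm orbT.
Qed.

Lemma finitely_spanned_seq (ms : seq F) : finitely_spanned [set` ms].
Proof. by exists ms; apply: sub_acl. Qed.

Lemma finitely_spanned_sub L L' : L `<=` L' -> finitely_spanned L' ->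
  finitely_spanned L.
Proof. by move=> LL' [ms L'ms]; exists ms; apply: subset_trans L'ms. Qed.

Lemma finitely_spanned_acl L : finitely_spanned L -> finitely_spanned (acl L).
Proof. by move=> [ms Lms]; exists ms; apply: acl_sub. Qed.

Lemma finitely_spanned_image (s : fieldAut k) L :
  finitely_spanned L -> finitely_spanned (s @` L).
Proof.
move=> [ms Lms]; exists (map s ms) => _ [x /Lms/(acl_fieldAut s) + <-].
by apply: acl_mono => _ [y /= ym <-]; apply: map_f.
Qed.

Hypothesis Finf : ~ finitely_spanned [set: F].

Lemma exists_generic L : finitely_spanned L -> exists y, ~ acl L y.
Proof.
move=> fL; apply: contrapT => ny; apply: Finf.
apply: finitely_spanned_sub (finitely_spanned_acl fL) => y _.
by apply: contrapT => nLy; apply: ny; exists y.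
Qed.

Lemma exists_indep n L : finitely_spanned L ->
  exists2 ys, size ys = n & indep L ys.
Proof.
elim: n L => [|n IHn] L fL; first by exists [::].
have [y ny] := exists_generic fL.
have [|ys sy iy] := IHn (y |` L).
  apply: finitely_spannedU => //; apply: finitely_spanned_sub (finitely_spanned_seq [:: y]).
  by move=> z -> /=; rewrite inE.
by exists (y :: ys) => //=; rewrite sy.
Qed.

End Independence.
Arguments finitely_spanned {F} k L.

(** * Construction of automorphisms *)

Section ConstructAutomorphisms.
Variables (F : closedFieldType) (k : set F).
Local Notation acl := (acl k).
Local Notation acl_closed := (acl_closed k).
Implicit Types (s t : fieldAut k) (G H : set (F * F)) (S T K L M N P : set F).
Implicit Types (xs ys ms : seq F).

Lemma horner_graph H (p q : {poly F}) x y : field_graph H -> poly_graph H p q ->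
  H (x, y) -> H (p.[x], q.[y]).
Proof.
move=> hH pq xy; have [rH _] := hH.
rewrite !(@horner_coef_wide _ (maxn (size p) (size q))) ?leq_maxl ?leq_maxr //.
by apply: ring_graph_sum => // i _; apply: ring_graphM => //; apply: ring_graphX.
Qed.

Lemma id_graph_sub S T : S `<=` T -> id_graph S `<=` id_graph T.
Proof. by move=> ST [x y] [/ST Tx xy]; split. Qed.

Lemma acl_setU1_sub L x : acl_closed L ->
  adjoin L [set x] `<=` acl (x |` L).
Proof.
move=> hL; apply: adjoin_min; first exact: acl_subfield.
  by move=> y Ly; apply: sub_acl; right.
by move=> _ ->; apply: sub_acl; left.
Qed.

Lemma extend_fixing H N xs : field_graph H -> dom H = N -> im H = N ->
  acl_closed N -> id_graph k `<=` H -> indep k N xs -> exists s : fieldAut k,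
  [/\ forall x y, H (x, y) -> s x = y, stabilizing k N s &
      forall x, x \in xs -> s x = x].
Proof.
move=> hH dH iH hN kH ix.
suff [s [sH sx]] : exists s : fieldAut k,
    (forall x y, H (x, y) -> s x = y) /\ forall x, x \in xs -> s x = x.
  exists s; split=> //; apply/seteqP; split=> [_ [x + <-]|y].
    by rewrite -{1}dH => -[y xy]; rewrite (sH _ _ xy) -iH; exists x.
  by rewrite -{1}iH => -[x xy]; exists x; [rewrite -dH; exists y|exact: sH].
elim: xs H N hH dH iH hN kH ix => [|x xs IHxs] H N hH dH iH hN kH.
  move=> _; have [hN1 hN2 hN3] := hN.
  have [||s [sH _]] := extend_fieldAut_in (N := N) hH _ _ kH hN1 hN3.
  - by rewrite dH.
  - by rewrite dH.
  - by exists s; split.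
move=> [nx ix].
have [_ _ cN] := hN.
have nx' : ~ alg_closure N x by rewrite cN => Nx; apply: nx; apply: sub_acl.
have xx : compatible H x x by apply: compatible_transcendental; rewrite ?dH ?iH.
have [rH _] := hH.
pose H1 := adjoin_graph H x x.
have hH1 : field_graph H1 by apply: adjoin_graph_field.
have dH1 : dom H1 = adjoin N [set x] by rewrite dom_adjoin_graph ?dH.
have iH1 : im H1 = adjoin N [set x] by rewrite im_adjoin_graph ?iH.
have [h1 h2 h3] := acl_aclosed k (x |` N).
have [||H2 [H12 hH2 dH2 iH2]] := extend_onto hH1 _ _ h1 h3.
- by rewrite dH1.
- by rewrite dH1; apply: acl_setU1_sub.
have HH1 : H `<=` H1 by apply: sub_adjoin_graph.
have [|||s [sH sx]] := IHxs H2 _ hH2 dH2 iH2.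
- exact: acl_aclosed.
- exact: subset_trans kH (subset_trans HH1 H12).
- exact: indep_anti ix.
exists s; split=> [y z /HH1/H12/sH //|y]; rewrite inE => /orP[/eqP->|/sx //].
by apply/sH/H12; apply: mem_adjoin_graph.
Qed.

Lemma adjoin_affine P (c u a : F) : is_subfield P -> P u -> P a -> u != 0 ->
  adjoin P [set u * c + a] = adjoin P [set c].
Proof.
move=> hP Pu Pa u0; have hA b := @adjoin_subfield _ P [set b].
have PA b : P `<=` adjoin P [set b] by apply: sub_adjoinl.
have Ab b : adjoin P [set b] b by apply: sub_adjoinr.
apply/seteqP; split; apply: adjoin_min => // _ ->.
  by apply: (subfieldD (hA c)); [apply: (subfieldM (hA c)) => //|]; apply: PA.
have cE : (u * c + a - a) / u = c by rewrite addrK mulrAC divff // mul1r.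
rewrite -[X in _ X]cE.
by apply: (subfield_div (hA _)); [apply: (subfieldB (hA _)) => //|]; apply: PA.
Qed.

(** Since c and u c + a generate the same field over P, the graph sending one to the other has equal
    domain and image and extends onto N. Shifts (u = 1) and the doubling (u = 2, a = 0) used later
    are instances. *)
Lemma affine_fieldAut P N (c u a : F) xs : acl_closed P -> acl_closed N ->
  P `<=` N -> N c -> ~ P c -> P u -> P a -> u != 0 -> indep k N xs ->
  exists s : fieldAut k, [/\ fixing k P s, stabilizing k N s,
    s c = u * c + a & forall x, x \in xs -> s x = x].
Proof.
move=> hP hN PN Nc nPc Pu Pa u0 ix; have [hP1 kP cP] := hP.
have [hN1 kN cN] := hN.
have hG := id_graph_field hP1; have [rG _] := hG.
have nPc' : ~ P (u * c + a).
  move=> h; apply: nPc; have -> : c = (u * c + a - a) / u.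
    by rewrite addrK mulrAC divff // mul1r.
  by apply: (subfield_div hP1) => //; apply: (subfieldB hP1).
have cc : compatible (id_graph P) c (u * c + a).
  by apply: compatible_transcendental; rewrite ?dom_id_graph ?im_id_graph ?cP.
pose G := adjoin_graph (id_graph P) c (u * c + a).
have hG' : field_graph G by apply: adjoin_graph_field.
have dG : dom G = adjoin P [set c] by rewrite dom_adjoin_graph // dom_id_graph.
have iG : im G = adjoin P [set c].
  by rewrite im_adjoin_graph // im_id_graph adjoin_affine.
have [||H [GH hH dH iH]] := extend_onto hG' _ _ hN1 cN.
- by rewrite dG.
- by rewrite dG; apply: adjoin_min => // _ ->.
have PH : id_graph P `<=` H by apply: subset_trans GH; apply: sub_adjoin_graph.
have [|s [sH sN sx]] := extend_fixing hH dH iH hN _ ix.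
  exact: subset_trans (id_graph_sub kP) PH.
exists s; split=> // [x Px|]; first by apply/sH/PH.
by apply/sH/GH/mem_adjoin_graph.
Qed.

Lemma acl_graph H (f : F -> F) S x y : field_graph H -> id_graph k `<=` H ->
  (forall z, S z -> H (z, f z)) -> H (x, y) -> acl (f @` S) y -> acl S x.
Proof.
move=> hH kH Sf xy; have [rH hV] := hH.
have hA T := @adjoin_subfield _ k T.
pose P := [set v | exists2 u, adjoin k S u & H (u, v)].
have hP : is_subfield P.
  apply: subfieldP => [|v v' [u Au uv] [u' Au' uv']|v v' [u Au uv] [u' Au' uv']].
  - by exists 1; [apply: (subfield1 (hA S))|apply: ring_graph1].
  - by exists (u - u'); [apply: (subfieldB (hA S))|apply: ring_graphB].
  - by exists (u / u'); [apply: (subfield_div (hA S))|apply: field_graph_div].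
have sP : adjoin k (f @` S) `<=` P.
  apply: adjoin_min => // [v kv|_ [z Sz <-]].
    by exists v; [apply: sub_adjoinl|apply: kH].
  by exists z; [apply: sub_adjoinr|apply: Sf].
move=> /(alg_closureP _ (subfield0 (hA _)))[q [Kq q0 /rootP qy]].
have /choice[g gP] : forall i, exists u, adjoin k S u /\ H (u, q`_i).
  by move=> i; have [u Au uq] := sP _ (Kq i); exists u.
have pq : poly_graph H (\poly_(i < size q) g i) q.
  move=> i; rewrite coef_poly; case: ltnP => qi; first by case: (gP i).
  by rewrite nth_default //; apply: ring_graph0.
apply/(alg_closureP _ (subfield0 (hA _))); exists (\poly_(i < size q) g i); split.
- move=> i; rewrite coef_poly; case: ifP => _; first by case: (gP i).
  exact: (subfield0 (hA _)).
- by rewrite (poly_graph_neq0 rH pq).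
- have := horner_graph hH pq xy; rewrite qy => /(ring_graph_eq0 rH)[_ h].
  exact/rootP/h.
Qed.

Lemma indep_graph H (f : F -> F) S xs : field_graph H -> id_graph k `<=` H ->
  (forall z, (S `|` [set` xs]) z -> H (z, f z)) ->
  indep k S xs -> indep k (f @` S) (map f xs).
Proof.
move=> hH kH; elim: xs S => [//|x xs IHxs] S; rewrite setU_cons => Sf [nx ix] /=.
split.
  move=> /(acl_graph hH kH) h; apply: nx; apply: (h x) => [z Sz|].
    by apply: Sf; left; right.
  by apply: Sf; left; left.
by have := IHxs _ Sf ix; rewrite image_setU image_set1.
Qed.

(** An isomorphism carries a transcendence basis to an independent sequence of the same length,
    which must span by finiteness of the dimension; the image, being algebraically closed, is then
    everything. *)
Lemma im_full H ms : field_graph H -> id_graph k `<=` H ->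
  dom H = acl [set` ms] -> im H `<=` acl [set` ms] -> alg_closure (im H) = im H ->
  im H = acl [set` ms].
Proof.
move=> hH kH dH iM cH; set M := acl _ in dH iM *.
have [|xs [ix xM Mx]] := @exists_basis _ k set0 M ms; first by rewrite set0U.
have /choice[f fP] : forall x, exists y, M x -> H (x, y).
  move=> x; have [|nMx] := pselect (M x); last by exists 0.
  by rewrite -dH => -[y xy]; exists y.
have xH z : (set0 `|` [set` xs]) z -> H (z, f z).
  by rewrite set0U => zx; apply/fP/xM.
have ify := indep_graph hH kH xH ix; rewrite image_set0 in ify.
have fM : [set` map f xs] `<=` im H.
  by move=> _ /mapP[x xxs ->]; exists x; apply: xH; right.
have := indep_size_span ify (subset_trans fM iM) Mx.
rewrite size_map leqnn set0U => /(_ isT) Mf.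
apply/seteqP; split=> //; apply: subset_trans Mf _; apply: acl_min => //.
split=> //; first exact: im_subfield.
by move=> x kx; exists x; apply: kH.
Qed.

(** Take a maximal extension inside M. If its domain and its image both missed a point of M, these
    two transcendental points could be paired; so one side is all of M, and [im_full] makes the
    other side full too. *)
Lemma extend_hom G ms : field_graph G -> id_graph k `<=` G ->
  dom G `<=` acl [set` ms] -> im G `<=` acl [set` ms] ->
  exists s : fieldAut k, forall x y, G (x, y) -> s x = y.
Proof.
move=> hG kG; set M := acl _ => dG iG; have [hM kM cM] := acl_aclosed k [set` ms].
pose Q H := [/\ field_graph H, dom H `<=` M & im H `<=` M].
have [|C C0 CQ tot|H [GH [hH dH iH] Hmax]] := @Zorn_above _ Q G.
- by [].
- split; first by apply: field_graph_bigcup => // X /CQ[_ []].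
    by rewrite dom_bigcup => x [X /CQ[_ [_ + _]]]; apply.
  by rewrite im_bigcup => x [X /CQ[_ [_ _]]]; apply.
have algM T : T `<=` M -> alg_closure T `<=` M.
  by move=> TM; rewrite /M -cM; apply: alg_closure_mono.
have [H' [HH' hH' dH' iH']] := extend_alg_closure hH.
have H'E : H' = H.
  by apply: Hmax => //; split=> //; rewrite ?dH' ?iH'; apply: algM.
rewrite {}H'E in dH' iH' hH' HH'.
have kH : id_graph k `<=` H := subset_trans kG GH.
have [rH _] := hH.
have full : dom H = M \/ im H = M.
  apply: contrapT => /not_orP[nd ni].
  have [x Mx nx] : exists2 x, M x & ~ dom H x.
    apply: contrapT => h; apply: nd; apply/seteqP; split=> // x Mx.
    by apply: contrapT => nx; apply: h; exists x.
  have [y My ny] : exists2 x, M x & ~ im H x.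
    apply: contrapT => h; apply: ni; apply/seteqP; split=> // y My.
    by apply: contrapT => ny; apply: h; exists y.
  have xy : compatible H x y by apply: compatible_transcendental; rewrite -?dH' -?iH'.
  apply: nx; exists y; rewrite -(Hmax (adjoin_graph H x y)).
  - exact: mem_adjoin_graph.
  - split; first exact: adjoin_graph_field.
      by rewrite dom_adjoin_graph //; apply: adjoin_min => // _ ->.
    by rewrite im_adjoin_graph //; apply: adjoin_min => // _ ->.
  - exact: sub_adjoin_graph.
have [dM iM] : dom H = M /\ im H = M.
  have kH' : id_graph k `<=` conv H by move=> [x y] [/= kx xy]; apply: kH; split; rewrite /= -?xy.
  case: full => E; split=> //; first exact: im_full.
  exact: (@im_full (conv H) ms (field_graph_conv hH) kH').
have [||s [sH _]] := extend_fieldAut_in hH _ _ kH hM cM.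
- by rewrite dM.
- by rewrite dM.
by exists s => x y /GH/sH.
Qed.

Lemma extend_pairs H xs ys : field_graph H -> id_graph k `<=` H ->
  acl_closed (dom H) -> acl_closed (im H) ->
  indep k (dom H) xs -> indep k (im H) ys -> size xs = size ys ->
  exists H', [/\ H `<=` H', field_graph H',
    dom H' `<=` acl (dom H `|` [set` xs]), im H' `<=` acl (im H `|` [set` ys]) &
    forall i, (i < size xs)%N -> H' (nth 0 xs i, nth 0 ys i)].
Proof.
elim: xs ys H => [|x xs IHxs] [|y ys] H //= hH kH cd ci.
  by exists H; split=> //; rewrite setU_nil; apply: sub_acl.
move=> [nx ix] [ny iy] [sxy]; have [rH _] := hH.
have xy : compatible H x y.
  apply: compatible_transcendental => //.
    by case: cd => _ _ -> h; apply: nx; apply: sub_acl.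
  by case: ci => _ _ -> h; apply: ny; apply: sub_acl.
have [H2 [H12 hH2 dH2 iH2]] := extend_alg_closure (adjoin_graph_field rH xy).
have HH2 : H `<=` H2 by apply: subset_trans H12; apply: sub_adjoin_graph.
have dE : dom H2 = acl (x |` dom H).
  by rewrite dH2 dom_adjoin_graph // -acl_setU1 (acl_id cd).
have iE : im H2 = acl (y |` im H).
  by rewrite iH2 im_adjoin_graph // -acl_setU1 (acl_id ci).
have [|||||H3 [H23 hH3 dH3 iH3 H3P]] := IHxs ys H2 hH2 _ _ _ _ _ sxy.
- exact: subset_trans kH HH2.
- by rewrite dE; apply: acl_aclosed.
- by rewrite iE; apply: acl_aclosed.
- by rewrite dE; apply: indep_anti ix.
- by rewrite iE; apply: indep_anti iy.
have sub (L : set F) z zs : acl (acl (z |` L) `|` [set` zs]) `<=` acl (L `|` [set` z :: zs]).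
  apply: acl_sub => w [|ws].
    by rewrite setU_cons; apply: acl_mono => v; left.
  by rewrite setU_cons; apply: sub_acl; right.
exists H3; split=> //.
- exact: subset_trans HH2 H23.
- by apply: subset_trans dH3 _; rewrite dE; apply: sub.
- by apply: subset_trans iH3 _; rewrite iE; apply: sub.
- by move=> [|i] /= h; [apply/H23/H12/mem_adjoin_graph|apply: H3P].
Qed.

(** Homogeneity of F: the generic positions used below are reached by automorphisms given here. *)
Lemma hom_indep N xs ys : finitely_spanned k N -> indep k N xs -> indep k N ys ->
  size xs = size ys -> exists2 s : fieldAut k, fixing k N s & map s xs = ys.
Proof.
move=> [ms Nms] ix iy sxy.
have [hN kN cN] := acl_aclosed k N.
have hG := id_graph_field hN.
have kG : id_graph k `<=` id_graph (acl N) by apply: id_graph_sub.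
have dE := dom_id_graph (acl N); have iE := im_id_graph (acl N).
have [||||H [GH hH dH iH HP]] := @extend_pairs (id_graph (acl N)) xs ys hG kG _ _ _ _ sxy.
- by rewrite dE; apply: acl_aclosed.
- by rewrite iE; apply: acl_aclosed.
- by rewrite dE; apply: indep_anti ix.
- by rewrite iE; apply: indep_anti iy.
have [|||s sP] := @extend_hom H (ms ++ xs ++ ys) hH.
- exact: subset_trans GH.
- apply: subset_trans dH _; rewrite dE; apply: acl_sub => z [|zx].
    by apply: acl_sub => w /Nms; apply: acl_mono => v /= vm; rewrite mem_cat vm.
  by apply: sub_acl; rewrite /= !mem_cat (zx : z \in xs) orbT.
- apply: subset_trans iH _; rewrite iE; apply: acl_sub => z [|zx].
    by apply: acl_sub => w /Nms; apply: acl_mono => v /= vm; rewrite mem_cat vm.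
  by apply: sub_acl; rewrite /= !mem_cat (zx : z \in ys) !orbT.
exists s; first by move=> x Nx; apply/sP/GH; split=> //; apply: sub_acl.
apply: (@eq_from_nth _ 0); first by rewrite size_map.
by move=> i; rewrite size_map => h; rewrite (nth_map 0) //; apply/sP/HP.
Qed.

Hypothesis char0 : [pchar F] =i pred0.

Lemma natr_neq0 n : (n.+1%:R : F) != 0.
Proof. by move/pcharf0P: char0 => ->. Qed.

(** A transcendental x is moved to x + 1. An algebraic one has a minimal polynomial of degree at
    least 2, whose roots are simple in characteristic zero, and is moved to another root. *)
Lemma fixed_field K x : is_subfield K -> k `<=` K -> ~ K x ->
  exists2 s : fieldAut k, fixing k K s & s x <> x.
Proof.
move=> hK kK nKx; have K0 := subfield0 hK.
have hG := id_graph_field hK; have [rG _] := hG.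
have kG : id_graph k `<=` id_graph K by apply: id_graph_sub.
have hT := subfield_setT F; have cT := alg_closure_setT F.
have [Kx|nx] := pselect (alg_closure K x); last first.
  (* The factor 1 gives the form u x + a expected by [adjoin_affine]. *)
  have nx1 : ~ alg_closure K (1 * x + 1).
    rewrite mul1r => /(subfieldB (alg_closure_subfield hK)) h; apply: nx.
    rewrite -(addrK 1 x); apply: h; apply: sub_alg_closure => //; exact: subfield1.
  have xx : compatible (id_graph K) x (1 * x + 1).
    by apply: compatible_transcendental; rewrite ?dom_id_graph ?im_id_graph.
  have hH := adjoin_graph_field rG xx.
  have [|//||s [sH _]] := extend_fieldAut_in (N := setT) (k := k) hH _ _ _ hT cT.
  - rewrite dom_adjoin_graph // im_adjoin_graph // dom_id_graph im_id_graph.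
    by rewrite adjoin_affine ?oner_neq0 //; apply: subfield1.
  - by apply: subset_trans kG _; apply: sub_adjoin_graph.
  exists s => [y Ky|]; first by apply: sH; apply: sub_adjoin_graph.
  rewrite (sH x (1 * x + 1)); last exact: mem_adjoin_graph.
  by rewrite mul1r => /eqP; rewrite -subr_eq0 addrAC subrr add0r oner_eq0.
have [p [Kp p0 px pmin]] := minimal_poly K0 Kx.
have /factor_theorem[q pE] : root p x by apply/rootP.
have q0 : q != 0 by apply: contra_neq p0 => q0; rewrite pE q0 mul0r.
have sp : size p = (size q).+1.
  by rewrite pE size_Mmonic ?monicXsubC // size_XsubC addn2.
have sq1 : (1 < size q)%N.
  rewrite ltnNge; apply/negP => sq1; apply: nKx.
  have [c qc] : exists c, q = c%:P by exists q`_0; apply: size1_polyC.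
  have c0 : c != 0 by move: q0; rewrite qc polyC_eq0.
  have Kc : K c.
    by have := Kp 1%N; rewrite pE qc mul_polyC coefZ coefB coefX coefC /= subr0 mulr1.
  have := Kp 0%N; rewrite pE qc mul_polyC coefZ coefB coefX coefC /= sub0r mulrN.
  move=> /(subfieldN hK); rewrite opprK => h.
  have -> : x = c * x / c by rewrite mulrAC divff // mul1r.
  exact: subfield_div.
have [y /rootP qy] := closed_field_root sq1.
(* Otherwise x is a double root, hence a root of the derivative, which is nonzero and of smaller
   degree: this contradicts minimality. *)
have yx : y <> x.
  move=> yx; have dx : p^`().[x] = 0.
    rewrite pE derivM hornerD !hornerM derivXsubC hornerC mulr1 -{1}yx.
    by rewrite hornerXsubC -{2}yx yx subrr mulr0 add0r -{1}yx.
  have dK i : K p^`()`_i.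
    rewrite coef_deriv -mulr_natr; apply: subfieldM => //; exact: subfield_nat.
  have d0 : p^`() != 0.
    apply/eqP => d0; have := congr1 (fun r : {poly F} => r`_(size q).-1) d0.
    rewrite coef_deriv coef0 prednK ?(ltnW sq1) // -mulr_natr => /eqP.
    rewrite mulf_eq0 => /orP[|].
      have -> : p`_(size q) = lead_coef p by rewrite lead_coefE sp.
      by rewrite lead_coef_eq0 (negPf p0).
    by case: (size q) sq1 => // m _; rewrite (negPf (natr_neq0 m)).
  have := pmin _ dK d0 dx; rewrite leqNgt lt_size_deriv //.
have pp : poly_graph (id_graph K) p p by move=> i; split=> /=.
have py : p.[y] = 0 by rewrite pE hornerM qy mul0r.
have xy : compatible (id_graph K) x y.
  by apply: (compatible_minimal_poly hG pp p0 px py); rewrite dom_id_graph.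
have Ky : alg_closure K y by apply/alg_closureP => //; exists p; split=> //; apply/rootP.
have [H [GH hH dH iH]] := extend_alg_closure (adjoin_graph_field rG xy).
have aK z : alg_closure K z -> alg_closure (adjoin K [set z]) = alg_closure K.
  move=> Kz; apply/seteqP; split; last by apply: alg_closure_mono; apply: sub_adjoinl.
  rewrite -[X in _ `<=` X]alg_closureK //; apply: alg_closure_mono.
  apply: adjoin_min; [exact: alg_closure_subfield|exact: sub_alg_closure|].
  by move=> _ ->.
rewrite dom_adjoin_graph // dom_id_graph aK // in dH.
rewrite im_adjoin_graph // im_id_graph aK // in iH.
have GH' : id_graph K `<=` H by apply: subset_trans GH; apply: sub_adjoin_graph.
have [|//||s [sH _]] := extend_fieldAut_in (N := setT) (k := k) hH _ _ _ hT cT.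
- by rewrite dH.
- exact: subset_trans GH'.
exists s => [z Kz|]; first by apply/sH/GH'.
by rewrite (sH x y) //; apply/GH/mem_adjoin_graph.
Qed.

End ConstructAutomorphisms.

(** * Linear disjointness *)

Section LinearDisjointness.
Variables (F : closedFieldType) (k : set F).
Hypothesis char0 : [pchar F] =i pred0.
Local Notation acl := (acl k).
Local Notation acl_closed := (acl_closed k).
Implicit Types (s t g h : fieldAut k) (S K L M N P I : set F).
Implicit Types (xs ys ms : seq F).

Lemma fieldAutX s n x : (s ^+ n)%g x = iter n s x.
Proof. by elim: n => [//|n IHn]; rewrite expgS fieldAutME IHn. Qed.

Lemma fieldAut_relation s (T : finType) (v c : T -> F) :
  \sum_i c i * v i = 0 -> \sum_i s (c i) * s (v i) = 0.
Proof.
move=> E; transitivity (s (\sum_i c i * v i)); last by rewrite E rmorph0.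
by rewrite rmorph_sum; apply: eq_bigr => i _; rewrite rmorphM.
Qed.

(* A nontrivial linear relation of minimal support, normalised at one
   coefficient, is unique: it is fixed by every automorphism that preserves K
   and fixes the vectors. *)
Lemma canonical_relation K (T : finType) (v a : T -> F) : is_subfield K ->
    (forall i, K (a i)) -> \sum_i a i * v i = 0 -> (exists i, a i != 0) ->
  exists c : T -> F, [/\ forall i, K (c i), \sum_i c i * v i = 0,
    exists i, c i != 0, forall i, c i != 0 -> a i != 0 &
    forall s, (forall x, K x -> K (s x)) -> (forall i, s (v i) = v i) ->
      forall i, s (c i) = c i].
Proof.
move=> hK Ka av a0.
pose rel (c : T -> F) := [/\ forall i, K (c i), \sum_i c i * v i = 0,
  exists i, c i != 0 & forall i, c i != 0 -> a i != 0].
pose Q n := `[< exists2 c, rel c & #|[pred i | c i != 0]| = n >].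
have exQ : exists n, Q n.
  by exists #|[pred i | a i != 0]|; apply/asboolP; exists a.
have [_ /asboolP[c [Kc cv [i0 ci0] ca] <-] cmin] := ex_minnP exQ.
exists (fun i => c i / c i0); split.
- by move=> i; apply: subfield_div.
- under eq_bigr do rewrite mulrAC.
  by rewrite -mulr_suml cv mul0r.
- by exists i0; rewrite divff ?oner_neq0.
- by move=> i; rewrite mulf_eq0 negb_or => /andP[/ca].
(* The difference d is again a relation supported in the support of c, and it vanishes at i0, where
   the coefficient is 1; minimality of the support makes it zero. *)
move=> s Ks sv; pose d i := s (c i / c i0) - c i / c i0.
suff d0 i : d i = 0 by move=> i; apply/eqP; rewrite -subr_eq0 -/(d i) d0.
apply: contrapT => /eqP di.
have Kd j : K (d j).
  by apply: subfieldB => //; [apply: Ks|]; apply: subfield_div.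
have dc j : d j != 0 -> c j != 0.
  by apply: contra_neq => cj; rewrite /d cj mul0r rmorph0 subrr.
have reld : rel d.
  split=> //; [|by exists i|by move=> j /dc/ca].
  have E : \sum_i c i / c i0 * v i = 0.
    under eq_bigr do rewrite mulrAC.
    by rewrite -mulr_suml cv mul0r.
  under eq_bigr do rewrite mulrBl.
  rewrite sumrB E subr0 -[RHS](fieldAut_relation s E); apply: eq_bigr => j _.
  by rewrite sv.
have /cmin : Q #|[pred i | d i != 0]| by apply/asboolP; exists d.
rewrite leqNgt => /negP; apply; apply: proper_card; apply/properP; split.
  by apply/fintype.subsetP => j; rewrite !inE => /dc.
by exists i0; rewrite !inE ?ci0 // /d divff // rmorph1 subrr eqxx.
Qed.

(** The orbit of x under s stays among the finitely many roots of a polynomial over k(S), so two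
    iterates agree, and s is injective. *)
Lemma fieldAut_periodic S s x : fixing k S s -> acl S x ->
  exists n, iter n.+1 s x = x.
Proof.
move=> sS; have hA := @adjoin_subfield _ k S.
move=> /(alg_closureP _ (subfield0 hA))[p [Kp p0 px]].
have sp : map_poly s p = p.
  apply/polyP => i; rewrite coef_map /=; exact: (fixing_adjoin sS).
have root_iter i : root p (iter i s x).
  elim: i => [//|i IHi]; rewrite iterS -sp; apply/rootP.
  by rewrite horner_map (rootP IHi) rmorph0.
pose rs := [seq iter i s x | i <- iota 0 (size p)].
have : ~~ uniq rs.
  apply/negP => urs; have := max_poly_roots p0 _ urs.
  rewrite size_map size_iota ltnn => h; suff : false by []; apply: h.
  by apply/allP => _ /mapP[i _ ->].
move=> /(uniqPn 0)[i [j [ij]]]; rewrite size_map size_iota => jp.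
have ip := ltn_trans ij jp.
rewrite !(nth_map 0%N) ?size_iota // !nth_iota // !add0n.
rewrite -(subnKC (ltnW ij)) iterD => E.
have inj m : injective (iter m s).
  elim: m => [|m IHm] y z //=; by move/(@fieldAut_inj _ _ s)/IHm.
exists (j - i).-1; rewrite prednK ?subn_gt0 //.
exact/esym/(inj i).
Qed.

Lemma iter_period (T : Type) (f : T -> T) n m x :
  iter n f x = x -> iter (m * n) f x = x.
Proof. by move=> E; elim: m => [//|m IHm]; rewrite mulSn iterD IHm. Qed.

Lemma fieldAut_common_period S s (T : finType) (v : T -> F) :
  fixing k S s -> (forall i, acl S (v i)) ->
  exists n, forall i, iter n.+1 s (v i) = v i.
Proof.
move=> sS Sv; have /choice[N NP] i := fieldAut_periodic sS (Sv i).
exists (\prod_i (N i).+1).-1 => i.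
rewrite prednK; last by apply/prodn_gt0.
by rewrite (bigD1 i) //= mulnC; apply: iter_period.
Qed.

(** The shift of c i by 1 over I must also preserve K and fix xs, which is possible because xs is
    independent over K. The vectors v are algebraic over the fixed set, so some power of the shift
    fixes them all and, by the hypothesis on c, also fixes c i. *)
Lemma relation_descent K I xs (T : finType) (v c : T -> F) :
    acl_closed K -> acl_closed I -> I `<=` K -> indep k K xs ->
    (forall i, acl (I `|` [set` xs]) (v i)) -> (forall i, K (c i)) ->
    (forall s, (forall x, K x -> K (s x)) -> (forall i, s (v i) = v i) ->
      forall i, s (c i) = c i) ->
  forall i, I (c i).
Proof.
move=> hK hI IK ix Iv Kc cs i; apply: contrapT => nI.
have [hI1 _ _] := hI; have I1 := subfield1 hI1.
have [s [sI sK sc sx]] := affine_fieldAut hI hK IK (Kc i) nI I1 I1 (oner_neq0 _) ix.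
have sIx : fixing k (I `|` [set` xs]) s by move=> x [/sI|/sx].
have [n nP] := fieldAut_common_period sIx Iv.
have Ks x : K x -> K (s x) by move=> Kx; rewrite -sK; exists x.
have scn m : iter m s (c i) = c i + m%:R.
  elim: m => [|m IHm]; first by rewrite addr0.
  by rewrite iterS IHm rmorphD /= sc mul1r rmorph_nat -addrA -natr1 [1 + _]addrC.
have := cs (s ^+ n.+1)%g _ _ i; rewrite fieldAutX scn => /(_ _ _)/eqP.
rewrite -subr_eq0 addrAC subrr add0r (negPf (natr_neq0 char0 n)) => h.
suff : false by []; apply: h.
  by move=> x Kx; rewrite fieldAutX; elim: n.+1 => [//|m IHm]; apply: Ks.
by move=> j; rewrite fieldAutX.
Qed.

Lemma acl_closedI L1 L2 : acl_closed L1 -> acl_closed L2 -> acl_closed (L1 `&` L2).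
Proof.
move=> [h1 k1 c1] [h2 k2 c2].
have hI : is_subfield (L1 `&` L2).
  apply: subfieldP => [|x y [? ?] [? ?]|x y [? ?] [? ?]].
  - by split; apply: subfield1.
  - by split; apply: subfieldB.
  - by split; apply: subfield_div.
split=> // [x kx|]; first by split; [apply: k1|apply: k2].
apply/seteqP; split; last exact: sub_alg_closure.
move=> x Ix; split; first by rewrite -c1; apply: alg_closure_mono Ix => y [].
by rewrite -c2; apply: alg_closure_mono Ix => y [].
Qed.

(** A relation for w over L1(x) is a linear relation among the monomials in x and w. Its canonical
    form over the larger field K favours neither L1 nor L2, so [relation_descent] puts the
    coefficients in both. The result is a nontrivial equation for w because x is transcendental over
    the intersection. *)
Lemma acl_inter1 L1 L2 x w : acl_closed L1 -> acl_closed L2 ->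
  ~ acl (L1 `|` L2) x -> acl (x |` L1) w -> acl (x |` L2) w ->
  acl (x |` (L1 `&` L2)) w.
Proof.
move=> hL1 hL2 nx w1 w2; have [h1 k1 c1] := hL1.
have hI := acl_closedI hL1 hL2; have [hI1 kI cI] := hI.
set K := acl (L1 `|` L2) in nx.
have hK : acl_closed K by apply: acl_aclosed.
have hA := @adjoin_subfield _ L1 [set x].
have := w1; rewrite -acl_setU1 (acl_id hL1).
move=> /(alg_closureP _ (subfield0 hA))[p [Kp p0 /rootP pw]].
have [e [P [e0 LP PE]]] := clear_denominators h1 Kp.
pose n := size P; pose m := \max_(i < n) size (P`_i)%R.
(* The pair (i, j) stands for the monomial with w to the power i and x to the power j. The
   successors make both index types inhabited, as [inord] requires when the polynomial is
   rebuilt. *)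
pose T := ('I_n.+1 * 'I_m.+1)%type.
have bigT (E : nat -> nat -> F) :
    \sum_(t : T) E t.1 t.2 = \sum_(i < n.+1) \sum_(j < m.+1) E i j.
  by rewrite (pair_bigA _ (fun (i : 'I_n.+1) (j : 'I_m.+1) => E i j)).
pose v (t : T) := x ^+ t.2 * w ^+ t.1.
pose a (t : T) := P`_(t.1)`_(t.2).
have av : \sum_t a t * v t = 0.
  have /esym : (map_poly (horner_eval x) P).[w] = 0 by rewrite PE hornerZ pw mulr0.
  rewrite (@horner_coef_wide _ n.+1); last first.
    by apply: leq_trans (size_poly _ _) _; apply: leqnSn.
  move=> E0; rewrite [RHS]E0; transitivity (\sum_(i < n.+1) \sum_(j < m.+1) P`_i`_j * (x ^+ j * w ^+ i)).
    exact: (bigT (fun i j => P`_i`_j * (x ^+ j * w ^+ i))).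
  apply: eq_bigr => i _; rewrite coef_map_id0 ?/horner_eval ?horner0 //.
  rewrite (@horner_coef_wide _ m.+1) ?mulr_suml.
    by apply: eq_bigr => j _; rewrite mulrA.
  have [im|im] := ltnP i n; last by rewrite nth_default // size_poly0.
  by apply: leqW; apply: (leq_bigmax (Ordinal im)).
have a0 : exists t : T, a t != 0.
  apply: contrapT => na; case/eqP: p0.
  suff P0 : P = 0.
    have : e *: p = 0 by rewrite -PE P0 map_poly0.
    by move/eqP; rewrite scaler_eq0 (negPf e0) => /eqP.
  apply/polyP => i; apply/polyP => j; rewrite !coef0.
  have [im|im] := ltnP i n; last by rewrite (nth_default 0 im) coef0.
  have [jm|jm] := ltnP j m.
    apply: contrapT => /eqP aij; apply: na.
    by exists (Ordinal (ltnW im : i < n.+1)%N, Ordinal (ltnW jm : j < m.+1)%N).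
  rewrite nth_default //; apply: leq_trans jm.
  exact: (leq_bigmax (Ordinal im)).
have [h3 _ _] := hK.
have KL1 : L1 `<=` K by move=> y Ly; apply: sub_acl; left.
have KL2 : L2 `<=` K by move=> y Ly; apply: sub_acl; right.
have [|c [Kc cv [t0 ct0] _ cs]] := canonical_relation h3 _ av a0.
  by move=> t; apply/KL1/LP.
have ix : indep k K [:: x].
  by split=> //; rewrite /K; case: (acl_aclosed k (L1 `|` L2)) => _ _; rewrite -/K (acl_id hK).
have vL L : acl (x |` L) w -> forall t : T, acl (L `|` [set` [:: x]]) (v t).
  move=> Lw t; rewrite setU_cons setU_nil.
  have hL := acl_subfield k (x |` L).
  apply: (subfieldM hL); apply: (subfieldX hL) => //.
  by apply: sub_acl; left.
have Ic (t : T) : (L1 `&` L2) (c t).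
  split; first exact: (relation_descent hK hL1 KL1 ix (vL _ w1) Kc cs).
  exact: (relation_descent hK hL2 KL2 ix (vL _ w2) Kc cs).
have nIx : ~ alg_closure (L1 `&` L2) x.
  by rewrite cI => -[Lx _]; apply: nx; apply: sub_acl; left.
have hA' := @adjoin_subfield _ (L1 `&` L2) [set x].
have IA : L1 `&` L2 `<=` adjoin (L1 `&` L2) [set x] by apply: sub_adjoinl.
rewrite -acl_setU1 (acl_id hI).
apply/(alg_closureP _ (subfield0 hA')).
exists (\poly_(i < n.+1) \sum_(j < m.+1) c (inord i, j) * x ^+ j); split.
- move=> i; rewrite coef_poly; case: ifP => _; last exact: (subfield0 hA').
  apply: (subfield_sum hA') => j _; apply: (subfieldM hA'); first exact: IA.
  by apply: (subfieldX hA'); apply: sub_adjoinr.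
- apply/eqP => q0; move: ct0; case: t0 => i0 j0.
  have := congr1 (fun q : {poly F} => q`_i0) q0; rewrite coef_poly ltn_ord coef0 inord_val.
  move=> E; have r0 : \poly_(j < m.+1) c (i0, inord j) = 0.
    apply: (transcendental_eq0 hI1 nIx).
      move=> j; rewrite coef_poly; case: ifP => _; first exact: Ic.
      exact: subfield0.
    by rewrite horner_poly -[RHS]E; apply: eq_bigr => j _; rewrite inord_val.
  have := congr1 (fun q : {poly F} => q`_j0) r0; rewrite coef_poly ltn_ord coef0 inord_val.
  by move=> ->; rewrite eqxx.
- apply/rootP; rewrite horner_poly -[RHS]cv.
  transitivity (\sum_(i < n.+1) \sum_(j < m.+1) c (i, j) * v (i, j)); last first.
    by rewrite (pair_bigA _ (fun (i : 'I_n.+1) (j : 'I_m.+1) => c (i, j) * v (i, j))) /=; apply: eq_bigr => -[].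
  apply: eq_bigr => i _; rewrite mulr_suml; apply: eq_bigr => j _.
  by rewrite inord_val /v /= mulrA.
Qed.

Lemma acl_inter_seq L1 L2 xs w : acl_closed L1 -> acl_closed L2 ->
  indep k (L1 `|` L2) xs -> acl (L1 `|` [set` xs]) w -> acl (L2 `|` [set` xs]) w ->
  acl ((L1 `&` L2) `|` [set` xs]) w.
Proof.
elim: xs L1 L2 => [|x xs IHxs] L1 L2 hL1 hL2.
  rewrite !setU_nil (acl_id hL1) (acl_id hL2) => _ L1w L2w.
  by apply: sub_acl.
move=> [nx ix]; rewrite !setU_cons => w1 w2.
have lift L : acl ((x |` L) `|` [set` xs]) `<=` acl (acl (x |` L) `|` [set` xs]).
  by apply: acl_mono => y [h|]; [left; apply: sub_acl|right].
have := IHxs _ _ (acl_aclosed k (x |` L1)) (acl_aclosed k (x |` L2)) _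
  (lift _ _ w1) (lift _ _ w2).
move=> /(_ _)/(acl_sub _) h; apply: h; last first.
  apply: indep_anti ix => y [|]; apply: acl_mono => z [->|Lz].
  - by left.
  - by right; left.
  - by left.
  - by right; right.
move=> y [[y1 y2]|yx]; last by apply: sub_acl; right.
by apply: acl_mono (acl_inter1 hL1 hL2 nx y1 y2) => z; left.
Qed.

Lemma relation_transport N I xs s (T : finType) (v a : T -> F) :
    acl_closed N -> acl_closed I -> I `<=` N -> indep k N xs -> fixing k I s ->
    (forall i, acl (I `|` [set` xs]) (v i)) -> (forall i, N (a i)) ->
  \sum_i a i * v i = 0 -> \sum_i a i * s (v i) = 0.
Proof.
move=> hN hI IN ix sI Iv; have [h1 _ _] := hN.
have [m] := ubnP #|[pred i | a i != 0]|; elim: m a => // m IHm a sa Na av.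
have [a0|/existsNP[i0 /eqP ai0]] := pselect (forall i, a i = 0).
  by rewrite big1 // => i _; rewrite a0 mul0r.
have [|c [Nc cv [i1 ci1] ca cs]] := canonical_relation h1 Na av.
  by exists i0.
have Ic := relation_descent hN hI IN ix Iv Nc cs.
have scv : \sum_i c i * s (v i) = 0.
  rewrite -[RHS](fieldAut_relation s cv); apply: eq_bigr => i _.
  by rewrite (sI _ (Ic i)).
pose r := a i1 / c i1; pose a' i := a i - r * c i.
have : \sum_i a' i * s (v i) = 0.
  apply: IHm.
  - rewrite ltnS in sa; apply: leq_trans sa; apply: proper_card; apply/properP; split.
      apply/fintype.subsetP => i; rewrite !inE; apply: contra_neq => ai.
      have ci : c i = 0 by apply: contrapT => /eqP/ca; rewrite ai eqxx.
      by rewrite /a' ai ci mulr0 subrr.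
    by exists i1; rewrite !inE ?ca // /a' /r divfK // subrr eqxx.
  - move=> i; apply: subfieldB => //; apply: subfieldM => //; exact: subfield_div.
  - under eq_bigr do rewrite mulrBl -mulrA.
    by rewrite sumrB av -mulr_sumr cv mulr0 subr0.
under eq_bigr do rewrite mulrBl -mulrA.
by rewrite sumrB -mulr_sumr scv mulr0 subr0.
Qed.

(** On the ring generated by N and L, a sum of products a l is sent to the sum of the a s(l).
    [relation_transport] for s makes this well defined, and for the inverse of s injective; the
    fractions then extend to F by [extend_hom]. *)
Lemma extend_disjoint N I L xs s : acl_closed N -> acl_closed I -> is_subfield L ->
    I `<=` N -> k `<=` L -> L `<=` acl (I `|` [set` xs]) ->
    indep k N xs -> indep k N (map s xs) -> fixing k I s ->
    finitely_spanned k N -> finitely_spanned k L ->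
  exists2 h : fieldAut k, fixing k N h & forall x, L x -> h x = s x.
Proof.
move=> hN hI hL IN kL LI ix isx sI fN fL; have [hN1 kN cN] := hN.
pose ev (f : F -> F) (r : seq (F * F)) := \sum_(z <- r) z.1 * f z.2.
pose ok (r : seq (F * F)) := forall z, z \in r -> N z.1 /\ L z.2.
pose R : set (F * F) := [set z | exists2 r, ok r & z = (ev id r, ev s r)].
have evE f r : ev f r = \sum_(i < size r) (tnth (in_tuple r) i).1 * f (tnth (in_tuple r) i).2.
  by rewrite /ev big_tnth.
have okT r : ok r -> forall i, N (tnth (in_tuple r) i).1 /\ L (tnth (in_tuple r) i).2.
  by move=> okr i; apply/okr/mem_tnth.
have sI' : fixing k I (s^-1)%g by apply: fixingV.
have evs r : ok r -> ev id r = 0 <-> ev s r = 0.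
  move=> okr; rewrite !evE; split=> E.
    apply: (@relation_transport N I xs s _ (fun i => (tnth (in_tuple r) i).2)
      (fun i => (tnth (in_tuple r) i).1) hN hI IN ix sI) => // i.
      by apply: LI; case: (okT r okr i).
    by case: (okT r okr i).
  rewrite -[RHS](@relation_transport N I (map s xs) (s^-1)%g _
    (fun i => s (tnth (in_tuple r) i).2)
    (fun i => (tnth (in_tuple r) i).1) hN hI IN isx sI' _ _ E).
  - by apply: eq_bigr => i _; rewrite fieldAutK.
  - move=> i; have -> : I `|` [set` map s xs] = s @` (I `|` [set` xs]).
      rewrite image_setU (fixing_image sI); congr (_ `|` _).
      apply/seteqP; split=> [_ /mapP[z zx ->]|_ [z zx <-]]; first by exists z.
      exact: map_f.
    by apply: acl_fieldAut; apply: LI; case: (okT r okr i).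
  - by move=> i; case: (okT r okr i).
have rR : ring_graph R.
  split=> [|x y x' y' [r okr [-> ->]] [r' okr' [-> ->]]|x y x' y' [r okr [-> ->]] [r' okr' [-> ->]]|x y [r okr [-> ->]]].
  - exists [:: (1, 1)]; last by rewrite /ev !big_seq1 /= rmorph1 mulr1.
    by move=> z; rewrite inE => /eqP->; split; apply: subfield1.
  - exists (r ++ [seq (- z.1, z.2) | z <- r']).
      move=> z; rewrite mem_cat => /orP[/okr //|/mapP[u /okr'[? ?] ->]].
      by split=> //; apply: subfieldN.
    rewrite /ev !big_cat !big_map /= -!sumrN.
    by congr (_ + _, _ + _); apply: eq_bigr => z _; rewrite mulNr.
  - exists [seq (z.1 * u.1, z.2 * u.2) | z <- r, u <- r'].
      move=> z /allpairsP[[u u'] /= [/okr[? ?] /okr'[? ?] ->]].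
      by split; apply: subfieldM.
    rewrite /ev !big_allpairs_dep /= !big_distrlr /=; congr (_, _).
      by apply: eq_bigr => z _; apply: eq_bigr => u _; rewrite mulrACA.
    by apply: eq_bigr => z _; apply: eq_bigr => u _; rewrite mulrACA rmorphM.
  - exact: evs.
have NR x : N x -> R (x, x).
  move=> Nx; exists [:: (x, 1)]; last by rewrite /ev !big_seq1 /= rmorph1 mulr1.
  by move=> z; rewrite inE => /eqP->; split=> //; apply: subfield1.
have LR x : L x -> R (x, s x).
  move=> Lx; exists [:: (1, x)]; last by rewrite /ev !big_seq1 /= !mul1r.
  by move=> z; rewrite inE => /eqP->; split=> //; apply: subfield1.
have [ms msP] : finitely_spanned k (N `|` L `|` s @` L).
  apply: finitely_spannedU; first exact: finitely_spannedU.
  exact: finitely_spanned_image.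
have hM := acl_subfield k [set` ms].
have RM x y : R (x, y) -> acl [set` ms] x /\ acl [set` ms] y.
  move=> [r okr [-> ->]]; split; rewrite evE; apply: (subfield_sum hM) => i _;
    apply: (subfieldM hM); apply: msP; have [? ?] := okT r okr i.
  - by left; left.
  - by left; right.
  - by left; left.
  - by right; exists (tnth (in_tuple r) i).2.
have [|||h hP] := @extend_hom _ k (fractions R) ms (fractions_field_graph rR).
- by move=> [x _] [/= kx <-]; apply: sub_fractions => //; apply/NR/kN.
- move=> x [_ [u [v [u' [v' [uv uv' _ [-> _]]]]]]].
  by apply: (subfield_div hM); [case: (RM _ _ uv)|case: (RM _ _ uv')].
- move=> x [_ [u [v [u' [v' [uv uv' _ [_ ->]]]]]]].
  by apply: (subfield_div hM); [case: (RM _ _ uv)|case: (RM _ _ uv')].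
exists h => [x /NR xx|x /LR xx]; exact/hP/sub_fractions.
Qed.

End LinearDisjointness.

(** * Open subgroups *)

Section OpenSubgroups.
Variables (F : closedFieldType) (k : set F).
Hypothesis char0 : [pchar F] =i pred0.
Hypothesis Finf : ~ finitely_spanned k [set: F].
Local Notation acl := (acl k).
Local Notation acl_closed := (acl_closed k).
Implicit Types (s t g h : fieldAut k) (S K L M N P I : set F).
Implicit Types (xs ys zs ms : seq F) (H : set (fieldAut k)).

Lemma image_seq (s : fieldAut k) xs : s @` [set` xs] = [set` map s xs].
Proof.
apply/seteqP; split=> [_ [z zx <-]|_ /mapP[z zx ->]]; last by exists z.
exact: map_f.
Qed.

Lemma fixing_imageV L s t : fixing k (s @` L) t -> fixing k L (s^-1 * t * s)%g.
Proof.
move=> tL x Lx; rewrite !fieldAutME tL ?fieldAutK //; by exists x.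
Qed.

(* L is unique among the fields of minimal transcendence degree with
   fixing k L contained in H. Two distinct such fields could be chosen with
   maximal relative transcendence degree; then both are in general position
   over their intersection, and fixing k (L `&` L') would be contained in H. *)
Lemma open_subgroup_core H : H 1%g ->
    (forall s t, H s -> H t -> H (s * t)%g) -> (forall s, H s -> H (s^-1)%g) ->
    (exists ms : seq F, fixing k [set` ms] `<=` H) ->
  exists L, [/\ acl_closed L, finitely_spanned k L, fixing k L `<=` H &
    H `<=` stabilizing k L].
Proof.
move=> H1 HM HV [ms Hms].
pose Q n := `[< exists2 zs : seq F, size zs = n & fixing k (acl [set` zs]) `<=` H >].
have exQ : exists n, Q n.
  exists (size ms); apply/asboolP; exists ms => //.
  by apply: subset_trans Hms; apply: fixing_sub; apply: sub_acl.
have [n /asboolP[zs0 sz0 Hzs0] nmin] := ex_minnP exQ.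
have {}nmin zs : fixing k (acl [set` zs]) `<=` H -> (n <= size zs)%N.
  by move=> Hzs; apply: nmin; apply/asboolP; exists zs.
pose good L := fixing k L `<=` H /\ exists2 zs : seq F, size zs = n & L = acl [set` zs].
have good_closed L : good L -> acl_closed L.
  by move=> [_ [zs _ ->]]; apply: acl_aclosed.
have good_fin L : good L -> finitely_spanned k L.
  by move=> [_ [zs _ ->]]; exists zs.
have good_im g L : H g -> good L -> good (g @` L).
  move=> Hg [HL [zs szs LE]]; split; last first.
    by exists (map g zs); rewrite ?size_map // LE image_acl image_seq.
  move=> t tgL; have := HL _ (fixing_imageV tgL) => Ht.
  have -> : t = (g * (g^-1 * t * g) * g^-1)%g.
    by rewrite !mulgA mulgV mul1g -mulgA mulgV mulg1.
  exact: (HM _ _ (HM _ _ Hg Ht) (HV _ Hg)).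
have good_size L xs N : good L -> indep k N xs -> [set` xs] `<=` L -> (size xs <= n)%N.
  move=> [_ [zs szs LE]] ix xL; rewrite -szs.
  apply: (@steinitz _ k set0); first by apply: indep_anti ix.
  by rewrite set0U -LE.
(* A basis of I has at least n elements by minimality, and at most n inside L, so it spans L. *)
have good_sub L I : good L -> acl_closed I -> I `<=` L -> fixing k I `<=` H -> L = I.
  move=> gL hI IL HI; apply/seteqP; split=> //.
  have [_ [zs szs LE]] := gL.
  have [|xs [ix xI Ix]] := @exists_basis _ k set0 I zs; first by rewrite set0U -LE.
  rewrite set0U in Ix.
  have IE : I = acl [set` xs].
    by apply/seteqP; split=> //; apply: acl_min.
  have := @indep_size_span _ k set0 L xs zs ix (subset_trans xI IL).
  by rewrite set0U -LE szs set0U -IE; apply=> //; apply: nmin; rewrite -IE.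
suff good_uniq L L' : good L -> good L' -> L = L'.
  have g0 : good (acl [set` zs0]) by split=> //; exists zs0.
  exists (acl [set` zs0]); split; [exact: acl_aclosed|exact: good_fin|by case: g0|].
  by move=> g Hg; apply: good_uniq => //; apply: good_im.
move=> gL0 gL0'; apply: contrapT => nLL0.
pose D d := `[< exists L L' xs, [/\ good L, good L', L <> L' &
  [/\ indep k L' xs, [set` xs] `<=` L & size xs = d]] >].
have exD : exists d, D d by exists 0%N; apply/asboolP; exists L, L', [::].
have [|d /asboolP[{gL0 gL0' nLL0}L1 [L2 [xs [gL gL' nLL [ix xL sx]]]]] dmax] := ex_maxnP (m := n) exD.
  move=> d /asboolP[L1 [L2 [xs [gL _ _ [ix xL <-]]]]]; exact: good_size ix xL.
have {}dmax M M' ys : good M -> good M' -> M <> M' -> indep k M' ys ->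
    [set` ys] `<=` M -> (size ys <= d)%N.
  by move=> gM gM' nMM iy yM; apply: dmax; apply/asboolP; exists M, M', ys.
have hL := good_closed _ gL; have hL' := good_closed _ gL'.
have fL := good_fin _ gL; have fL' := good_fin _ gL'.
have HL : fixing k L1 `<=` H by case: gL.
have HL' : fixing k L2 `<=` H by case: gL'.
have span : L1 `<=` acl (L2 `|` [set` xs]).
  by apply: maximal_indep_span => // ys iy yL; rewrite sx; apply: (dmax L1 L2).
(* Moving xs to a sequence independent over both fields, by an element of H fixing L2, replaces L1
   by a good field M in general position with respect to L1 and L2. *)
have [ys sy iy] := exists_indep Finf d (finitely_spannedU fL fL').
have iyL : indep k L1 ys by apply: indep_anti iy => z Lz; apply: sub_acl; left.
have iyL' : indep k L2 ys by apply: indep_anti iy => z Lz; apply: sub_acl; right.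
have [|g gfix gxy] := hom_indep fL' ix iyL'; first by rewrite sx sy.
have Hg : H g by apply: HL'.
pose M := g @` L1.
have gM : good M by apply: good_im.
have yM : [set` ys] `<=` M by rewrite -gxy -image_seq; apply: image_subset.
have ML' : M `<=` acl (L2 `|` [set` ys]).
  move=> _ [z /span/(acl_fieldAut g) + <-].
  by rewrite image_setU (fixing_image gfix) image_seq gxy.
(* For d > 0 the first entry of ys lies in M but not in L1; for d = 0 the field L1 is contained in
   L2, hence equal to it by minimality. *)
have nML : M <> L1.
  move=> ME; case: ys sy iyL {iy iyL' gxy ML'} yM => [|y ys] sy.
    move=> _ _; apply: nLL; apply: (good_sub _ _ gL hL' _ HL').
    rewrite -(_ : L1 = L2); first by [].
    move: xs sx {ix xL} span; rewrite -sy => -[] // _; rewrite setU_nil (acl_id hL') => LL'.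
    exact/esym/(good_sub _ _ gL' hL LL' HL).
  move=> [ny _] yM; apply: ny; rewrite -ME; apply: sub_acl; apply: yM.
  by rewrite /= mem_head.
(* Maximality of d is applied a second time, now to the pair (M, L1), in which ys already attains
   it. *)
have ML : M `<=` acl (L1 `|` [set` ys]).
  by apply: maximal_indep_span => // zs iz zM; rewrite sy; apply: (dmax M L1).
pose I := L1 `&` L2.
have hI : acl_closed I by apply: acl_closedI.
have IL : I `<=` L1 by move=> z [].
have IL' : I `<=` L2 by move=> z [].
have gI : fixing k I g by apply: fixing_sub gfix.
have MI : M `<=` acl (I `|` [set` ys]).
  by move=> z Mz; apply: acl_inter_seq => //; [apply: ML|apply: ML'].
have LI : L1 `<=` acl (I `|` [set` xs]).
  move=> z Lz; apply/(acl_fieldAutE g); rewrite image_setU (fixing_image gI) image_seq gxy.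
  by apply: MI; exists z.
suff HI : fixing k I `<=` H.
  have LE : L1 = I by apply: good_sub.
  apply/nLL/esym; apply: good_sub => //; by rewrite LE.
move=> s sI.
(* A sequence independent over L1 and its image under s gives a good field N, a conjugate of M, over
   which xs and its image under s are both independent. *)
have [|ws sw iw] := exists_indep Finf d (finitely_spannedU fL _ : finitely_spanned k (L1 `|` s @` L1)).
  exact: finitely_spanned_image.
have iwL : indep k L1 ws by apply: indep_anti iw => z Lz; apply: sub_acl; left.
have iwsL : indep k (s @` L1) ws by apply: indep_anti iw => z Lz; apply: sub_acl; right.
have [|g1 g1fix g1yw] := hom_indep fL iyL iwL; first by rewrite sy sw.
have Hg1 : H g1 by apply: HL.
have g1I : fixing k I g1 by apply: fixing_sub g1fix.
pose N := g1 @` M.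
have gN : good N by apply: good_im.
have hN := good_closed _ gN.
have NI : N `<=` acl (I `|` [set` ws]).
  move=> _ [z /MI/(acl_fieldAut g1) + <-].
  by rewrite image_setU (fixing_image g1I) image_seq g1yw.
have IN : I `<=` N.
  rewrite -(fixing_image g1I); apply: image_subset.
  by rewrite -(fixing_image gI); apply: image_subset.
have iIx : indep k I xs by apply: indep_anti ix => z /IL' Iz; apply: sub_acl.
have ixN : indep k N xs.
  apply: indep_anti NI _; apply: indep_sym iIx _; apply: indep_anti iwL => z [/IL|/xL] Lz; exact: sub_acl.
have isxN : indep k N (map s xs).
  apply: indep_anti NI _; apply: indep_sym.
    by rewrite -(fixing_image sI); apply: indep_fieldAut.
  apply: indep_anti iwsL => z; rewrite -image_seq -{1}(fixing_image sI) => -[[u]|[u]].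
    by move=> /IL Lu <-; apply: sub_acl; exists u.
  by move=> /xL Lu <-; apply: sub_acl; exists u.
have [hL1 kL1 _] := hL.
(* Here h fixes N and agrees with s on L1, so h and the quotient of s by h both lie in H. *)
have [h hN' hs] := extend_disjoint char0 hN hI hL1 IN kL1 LI ixN isxN sI (good_fin _ gN) fL.
have -> : s = (h * (h^-1 * s))%g by rewrite mulgA mulgV mul1g.
apply: HM; first by case: gN => + _; apply.
apply: HL => x Lx; by rewrite fieldAutME -hs // fieldAutK.
Qed.

End OpenSubgroups.

(** * Normal subgroups *)

Section FieldAutGroup.
Variables (F : fieldType) (k : set F).
Implicit Types (s t g h : fieldAut k) (L K : set F) (ms : seq F).
Implicit Types (H N U : set (fieldAut k)).

Lemma is_subgroupP (G : groupType) (H : set G) : is_subgroup H <->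
  [/\ H 1%g, forall s t : G, H s -> H t -> H (s * t)%g &
      forall s : G, H s -> H (s^-1)%g].
Proof.
split=> [hH|[H1 HM HV]]; last first.
  split; first exact: mem_set.
  by move=> s t /set_mem Hs /set_mem Ht; apply/mem_set/HM/HV.
split; first by case: hH => /set_mem.
  move=> s t /mem_set Hs /mem_set Ht; apply/set_mem; exact: group_closedM hH _ _ Hs Ht.
by move=> s /mem_set Hs; apply/set_mem; exact: group_closedV hH _ Hs.
Qed.

Lemma open_subgroupP H : is_subgroup H ->
  open H <-> exists ms : seq F, fixing k [set` ms] `<=` H.
Proof.
move=> /is_subgroupP[H1 HM HV]; split=> [oH|[ms Hms]].
  have : nbhs (1%g : fieldAut k) H by apply: open_nbhs_nbhs.
  by move=> /nbhs1_fieldAutP[A /finite_seqP[ms ->] Hms]; exists ms.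
rewrite open_fieldAutE => s Hs; exists [set` ms]; first exact: finite_seq.
by move=> _ [t /Hms Ht <-]; apply: HM.
Qed.

Lemma closed_fieldAutP N : closed N <-> forall s,
  (forall ms : seq F, exists2 n, N n & forall x, x \in ms -> n x = s x) -> N s.
Proof.
split=> [/closed_openC|clN].
  rewrite open_fieldAutE => oN s sN; apply: contrapT => nNs.
  have [A /finite_seqP[ms ->] sub] := oN s nNs.
  have [n Nn ns] := sN ms; apply: (sub n) => //.
  exists (s^-1 * n)%g; last by rewrite mulgA mulgV mul1g.
  move=> x xm; rewrite fieldAutME ns //; by rewrite -fieldAutME mulVg.
rewrite -[N]setCK; apply: open_closedC; rewrite open_fieldAutE => s nNs.
have [ms msP] : exists ms : seq F, forall n, N n -> ~ forall x, x \in ms -> n x = s x.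
  apply: contrapT => h; apply/nNs/clN => ms.
  apply: contrapT => h'; apply: h; exists ms => n Nn ns; apply: h'.
  by exists n.
exists [set` ms]; first exact: finite_seq.
move=> _ [t tms <-] Nst; apply: (msP _ Nst) => x xm.
by rewrite fieldAutME tms.
Qed.

Lemma fixing_subgroup K : is_subgroup (fixing k K).
Proof.
apply/is_subgroupP; split=> [x //|s t sK tK x Kx|s sK x Kx].
  by rewrite fieldAutME tK ?sK.
by rewrite -{1}(sK x Kx) -fieldAutME mulVg.
Qed.

Lemma fixing_closed K : closed (fixing k K).
Proof.
apply/closed_fieldAutP => s sK x Kx; have [n nK ns] := sK [:: x].
by rewrite -ns ?mem_head // nK.
Qed.

Lemma stabilizing_subgroup L : is_subgroup (stabilizing k L).
Proof.
apply/is_subgroupP; rewrite /stabilizing /=; split=> [|s t sL tL|s sL].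
- by apply/seteqP; split=> [_ [x Lx <-] //|x Lx]; exists x.
- by rewrite -[in RHS]sL -[in RHS]tL -image_comp.
- change ((s^-1)%g @` L = L).
  have sK x : (s^-1)%g (s x) = x by rewrite -fieldAutME mulVg.
  apply/seteqP; split=> [_ [x + <-]|x Lx]; first by rewrite -{1}sL => -[y Ly <-]; rewrite sK.
  by exists (s x); [rewrite -sL; exists x|rewrite sK].
Qed.

Lemma fixing_sub_stabilizing L : fixing k L `<=` stabilizing k L.
Proof.
move=> s sL; apply/seteqP; split=> [_ [x Lx <-]|x Lx]; first by rewrite sL.
by exists x => //; apply: sL.
Qed.

Lemma stabilizing_mem L s x : stabilizing k L s -> L x -> L (s x).
Proof. by move=> sL Lx; rewrite -sL; exists x. Qed.

Lemma fixing_normal L U : is_subgroup U -> U `<=` stabilizing k L ->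
  fixing k L `<=` U -> normal_subgroup (fixing k L) U.
Proof.
move=> hU UL LU; split=> //; first exact: fixing_subgroup.
move=> s t /UL sL tL x Lx; rewrite conjgE !fieldAutME tL; last exact: stabilizing_mem.
by rewrite -fieldAutME mulVg.
Qed.

End FieldAutGroup.
Arguments fixing_subgroup {F} k K.
Arguments fixing_closed {F} k K.
Arguments stabilizing_subgroup {F} k L.

Lemma indep_nil (F : closedFieldType) (k N : set F) : indep k N [::].
Proof. by []. Qed.

Section NormalSubgroups.
Variables (F : closedFieldType) (k : set F).
Hypothesis char0 : [pchar F] =i pred0.
Hypothesis hk : acl_closed k k.
Hypothesis Finf : ~ finitely_spanned k [set: F].
Local Notation acl := (acl k).
Local Notation acl_closed := (acl_closed k).
Implicit Types (s t g h : fieldAut k) (S K L M N P I : set F).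
Implicit Types (xs ys zs ms : seq F) (H : set (fieldAut k)).

Lemma fixing_subset K L : is_subfield K -> k `<=` K ->
  fixing k K `<=` fixing k L -> L `<=` K.
Proof.
move=> hK kK KL x Lx; apply: contrapT => nKx.
have [s sK sx] := fixed_field char0 hK kK nKx; apply: sx; exact: (KL s sK x Lx).
Qed.

Lemma finitely_spanned_basis L : acl_closed L -> finitely_spanned k L ->
  exists ls : seq F, [set` ls] `<=` L /\ L = acl [set` ls].
Proof.
move=> hL [ms Lms]; have [|xs [_ xL Lx]] := @exists_basis _ k set0 L ms.
  by rewrite set0U.
exists xs; split=> //; apply/seteqP; split; first by move: Lx; rewrite set0U.
exact: acl_min.
Qed.

Lemma fixing_seq_stabilizing (ls : seq F) :
  fixing k [set` ls] `<=` stabilizing k (acl [set` ls]).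
Proof. by move=> s sls; rewrite /stabilizing /= image_acl (fixing_image sls). Qed.

Lemma stabilizing_open L : acl_closed L -> finitely_spanned k L ->
  open (stabilizing k L).
Proof.
move=> hL fL; have [ls [_ ->]] := finitely_spanned_basis hL fL.
apply/open_subgroupP; first exact: stabilizing_subgroup.
by exists ls; apply: fixing_seq_stabilizing.
Qed.

Lemma acl_nin L x : acl_closed L -> ~ L x -> ~ acl L x.
Proof. by move=> hL; rewrite acl_id. Qed.

Lemma move_outside L M x : acl_closed L -> finitely_spanned k L ->
  finitely_spanned k M -> ~ L x -> exists2 s : fieldAut k, fixing k L s & ~ M (s x).
Proof.
move=> hL fL fM nLx; have [y ny] := exists_generic Finf (finitely_spannedU fL fM).
have [||//|s sL [sx]] := @hom_indep _ k L [:: x] [:: y] fL.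
- by split=> //; apply: acl_nin.
- split=> // h; apply: ny; apply: acl_mono h => z; by left.
exists s => //; rewrite sx => My; apply: ny; apply: sub_acl; by right.
Qed.

Lemma normalizing_fixing L : is_subfield L -> k `<=` L ->
  normalizing (fixing k L) = stabilizing k L.
Proof.
move=> hL kL; have J s : [set conjg t s | t in fixing k L] = fixing k ((s^-1)%g @` L).
  apply/seteqP; split=> [_ [t tL <-]|t tL].
    by rewrite conjgE => _ [x Lx <-]; rewrite !fieldAutME fieldAutVK tL.
  exists (s * t * s^-1)%g; last by rewrite conjgE !mulgA mulVg mul1g -mulgA mulVg mulg1.
  move=> x Lx; rewrite !fieldAutME tL ?fieldAutVK //; by exists x.
have imF s : is_subfield (s @` L) /\ k `<=` s @` L.
  split; last by move=> x kx; exists x; [apply: kL|apply: fieldAut_id].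
  apply: subfieldP => [|_ _ [x Lx <-] [y Ly <-]|_ _ [x Lx <-] [y Ly <-]].
  - by exists 1; [apply: subfield1|apply: rmorph1].
  - by exists (x - y); [apply: subfieldB|apply: rmorphB].
  - by exists (x / y); [apply: subfield_div|apply: fmorph_div].
apply/seteqP; split=> s; rewrite /normalizing /= J.
  move=> E; have sL : (s^-1)%g @` L = L.
    have [h1 h2] := imF (s^-1)%g.
    by apply/seteqP; split; apply: fixing_subset => //; rewrite E.
  have /is_subgroupP[_ _ HV] := stabilizing_subgroup k L.
  by rewrite -[s]invgK; apply: HV.
have /is_subgroupP[_ _ HV] := stabilizing_subgroup k L.
by move=> /HV ->.
Qed.

(** A point of L' outside L could be moved out of L' while fixing L. Conversely, given y in L but
    not in L', choose x in L' outside k. By exchange x is transcendental over k(y), so some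
    automorphism stabilizing L sends x to x + y; then x + y is in L', and so is y. *)
Lemma stabilizing_inj L L' : acl_closed L -> finitely_spanned k L ->
  acl_closed L' -> finitely_spanned k L' -> L' <> k ->
  stabilizing k L `<=` stabilizing k L' -> L' = L.
Proof.
move=> hL fL hL' fL' nk' sub.
have L'L : L' `<=` L.
  move=> x L'x; apply: contrapT => nLx.
  have [s sL nsx] := move_outside hL fL fL' nLx; apply: nsx.
  by apply: stabilizing_mem L'x; apply: sub; apply: fixing_sub_stabilizing.
apply/seteqP; split=> // y Ly; apply: contrapT => nL'y.
have [x L'x nkx] : exists2 x, L' x & ~ k x.
  apply: contrapT => h; apply: nk'; have [_ kL' _] := hL'.
  by apply/seteqP; split=> // x L'x; apply: contrapT => nkx; apply: h; exists x.
have xy : ~ acl [set y] x.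
  rewrite -[[set y]]setU0 => h; apply: nL'y.
  have nx : ~ acl set0 x by move=> h'; apply: nkx; rewrite -(acl_id hk); apply: acl_mono h'.
  rewrite -(acl_id hL'); apply: acl_mono (acl_exchange h nx) => z [->|] //.
have yL : [set y] `<=` L by move=> z ->.
have yP : acl [set y] `<=` L by apply: acl_min.
have P1 : acl [set y] 1 := subfield1 (acl_subfield k _).
have Py : acl [set y] y by apply: sub_acl.
have [s [_ sL sx _]] := affine_fieldAut (acl_aclosed k [set y]) hL yP (L'L _ L'x)
  xy P1 Py (oner_neq0 _) (indep_nil k L).
have := stabilizing_mem (sub _ sL) L'x; rewrite sx mul1r.
have [h1 _ _] := hL'.
by move=> /(subfieldB h1)/(_ L'x); rewrite addrAC subrr add0r.
Qed.

(** The members of [APi k] other than k, in the form suited to [acl]; see [APi_proper_core]. *)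
Definition proper_core L := [/\ acl_closed L, finitely_spanned k L & L <> k].

Lemma stabilizing_proper L : proper_core L -> stabilizing k L <> setT.
Proof.
move=> [hL fL nk] E.
have [x Lx nkx] : exists2 x, L x & ~ k x.
  apply: contrapT => h; apply: nk; have [_ kL _] := hL.
  by apply/seteqP; split=> // x Lx; apply: contrapT => nkx; apply: h; exists x.
have fk : finitely_spanned k k by exists [::]; apply: base_acl.
have [s _ nsx] := move_outside hk fk fL nkx; apply: nsx.
by apply: stabilizing_mem Lx; rewrite E.
Qed.

Lemma open_proper_sub_stabilizing H : open_proper_subgroup H ->
  exists2 L, proper_core L & H `<=` stabilizing k L.
Proof.
move=> [hH oH nH]; have [ms Hms] := (open_subgroupP hH).1 oH.
have /is_subgroupP[H1 HM HV] := hH.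
have [L [hL fL LH HL]] := open_subgroup_core char0 Finf H1 HM HV (ex_intro _ ms Hms).
exists L => //; split=> // Lk; apply: nH; apply/seteqP; split=> // s _.
by apply: LH; rewrite Lk => x; apply: fieldAut_id.
Qed.

Lemma maximal_open_subgroupsE :
  [set stabilizing k L | L in proper_core] = maximal_open_subgroups k.
Proof.
have pO L : proper_core L -> open_proper_subgroup (stabilizing k L).
  move=> pL; have [hL fL _] := pL; split; first exact: stabilizing_subgroup.
    exact: stabilizing_open.
  exact: stabilizing_proper.
apply/seteqP; split=> [_ [L pL <-]|H [pH Hmax]].
  split; first exact: pO.
  move=> H' pH' LH'; have [L' pL' H'L'] := open_proper_sub_stabilizing pH'.
  have [hL fL _] := pL; have [hL' fL' nk'] := pL'.
  have E := stabilizing_inj hL fL hL' fL' nk' (subset_trans LH' H'L').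
  by apply/seteqP; split=> //; rewrite -E.
have [L pL HL] := open_proper_sub_stabilizing pH.
by exists L => //; apply: Hmax => //; apply: pO.
Qed.

(* A finite orbit is impossible for y |-> y + 1 in characteristic 0. *)
Lemma shift_transcendental s S y : fixing k S s -> s y = y + 1 -> ~ acl S y.
Proof.
move=> sS sy /(fieldAut_periodic sS)[n].
have -> m : iter m s y = y + m%:R.
  elim: m => [|m IHm]; first by rewrite addr0.
  by rewrite iterS IHm rmorphD /= sy rmorph_nat -addrA -natr1 [1 + _]addrC.
by move=> /eqP; rewrite -subr_eq0 addrAC subrr add0r (negPf (natr_neq0 char0 n)).
Qed.

(** If e were outside L, then by exchange y would be algebraic over L(e), on which s is the
    identity, and a shifted element cannot be. *)
Lemma shift_fixed_mem L s y e : acl_closed L -> fixing k L s -> s y = y + 1 ->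
  acl (y |` L) e -> s e = e -> L e.
Proof.
move=> hL sL sy ye se; apply: contrapT => nLe.
apply: (@shift_transcendental s (e |` L) y) => //; first by move=> z [->|/sL].
by apply: acl_exchange => //; apply: acl_nin.
Qed.

Lemma quadratic_eq0 L y c0 c1 c2 : acl_closed L -> ~ L y -> L c0 -> L c1 -> L c2 ->
  c0 + c1 * y + c2 * y ^+ 2 = 0 -> [/\ c0 = 0, c1 = 0 & c2 = 0].
Proof.
move=> [hL _ cL] nLy L0 L1 L2 E.
have : Poly [:: c0; c1; c2] = 0.
  apply: (transcendental_eq0 hL (b := y)); first by rewrite cL.
    move=> i; rewrite coef_Poly; case: i => [|[|[|i]]] //=.
    by rewrite nth_nil; apply: subfield0.
  by rewrite horner_Poly /= mul0r add0r -E expr2 mulrDl addrC -mulrA addrA addrAC.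
move=> P0; have c i : [:: c0; c1; c2]`_i = 0 by rewrite -coef_Poly P0 coef0.
by split; [apply: (c 0%N)|apply: (c 1%N)|apply: (c 2%N)].
Qed.

Lemma nin_add L y a : acl_closed L -> L a -> ~ L y -> ~ L (y + a).
Proof.
move=> [hL _ _] La nLy Lya; apply: nLy; rewrite -(addrK a y).
exact: subfieldB.
Qed.

Lemma nin_sqr L y : acl_closed L -> ~ L y -> ~ L (y ^+ 2).
Proof.
move=> hL nLy Ly2; have [h1 _ _] := hL.
have [||_ _ /eqP] := @quadratic_eq0 L y (- y ^+ 2) 0 1 hL nLy _ (subfield0 h1) (subfield1 h1) _.
- exact: subfieldN.
- by rewrite mul0r addr0 mul1r addNr.
- by rewrite oner_eq0.
Qed.

(** Shifting y by an automorphism that fixes a generic x shows that v is affine at y: v y = b y + e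
    with b and e in L. Comparison with the value at the square of y gives e = 0, and comparison with
    the value at y + 1 gives b = 1. *)
Lemma locally_preserving_trivial L v : acl_closed L -> finitely_spanned k L ->
  fixing k L v -> (forall y, ~ L y -> acl (y |` L) (v y)) -> v = 1%g.
Proof.
move=> hL fL vL vy; have [hL1 kL cL] := hL.
have aff y : ~ L y -> exists b e, [/\ L b, L e & v y = b * y + e].
  move=> nLy.
  have fyL : finitely_spanned k (y |` L).
    apply: finitely_spannedU => //; exists [:: y] => z ->.
    by apply: sub_acl; rewrite /= mem_head.
  have [x nx] := exists_generic Finf fyL.
  have nLx : ~ L x by move=> Lx; apply: nx; apply: sub_acl; right.
  have nxy : ~ acl (x |` L) y.
    by move=> /acl_exchange h; apply/nx/h/acl_nin.
  pose P := acl (x |` L); pose N := acl (y |` (x |` L)).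
  have P1 : P 1 := subfield1 (acl_subfield k _).
  have [||s [sP _ sy _]] := affine_fieldAut (acl_aclosed k (x |` L))
    (acl_aclosed k (y |` (x |` L))) _ _ nxy P1 P1 (oner_neq0 _) (indep_nil k _).
  - by apply: acl_mono => z; right.
  - by apply: sub_acl; left.
  rewrite mul1r in sy.
  have sL : fixing k L s by move=> z Lz; apply: sP; apply: sub_acl; right.
  have sx z : acl (x |` L) z -> s z = z by apply: sP.
  (* The automorphism s shifts z as well and fixes v x, so y and z yield the same difference b. *)
  pose z := x + y.
  have hy := acl_subfield k (y |` L); have hz := acl_subfield k (z |` L).
  have xE : x = z - y by rewrite addrK.
  have yy : acl (y |` L) y by apply: sub_acl; left.
  have zz : acl (z |` L) z by apply: sub_acl; left.
  have nLz : ~ L z.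
    move=> Lz; apply: nx; rewrite xE; apply: (subfieldB hy) => //.
    by apply: sub_acl; right.
  have nzy : ~ acl (z |` L) y.
    move=> /acl_exchange h; apply: nx; rewrite xE; apply: (subfieldB hy) => //.
    by apply/h/acl_nin.
  have sz : s z = z + 1 by rewrite rmorphD /= sy sx ?addrA //; apply: sub_acl; left.
  have pres w u : s w = w + 1 -> acl (w |` L) u -> acl (w |` L) (s u).
    move=> sw /(acl_fieldAut s); apply: acl_sub => _ [r [->|Lr] <-].
      rewrite sw; have hw := acl_subfield k (w |` L).
      by apply: (subfieldD hw); [apply: sub_acl; left|apply: (subfield1 hw)].
    by rewrite sL //; apply: sub_acl; right.
  pose b := s (v y) - v y.
  have by_ : acl (y |` L) b by apply: (subfieldB hy); [apply: pres|]; auto.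
  have bz : acl (z |` L) b.
    have -> : b = s (v z) - v z.
      rewrite /b /z !rmorphD /= (sx (v x)); last exact: vy.
      by rewrite opprD addrACA subrr add0r.
    by apply: (subfieldB hz); [apply: pres|]; auto.
  (* As y is not algebraic over L(z), the closures of L(y) and L(z) meet only in L. *)
  have Lb : L b.
    apply: contrapT => nLb; apply: nzy.
    have yb := acl_exchange by_ (acl_nin hL nLb).
    apply: acl_sub yb => w [->|Lw] //; apply: sub_acl; by right.
  exists b, (v y - b * y); split=> //; last by rewrite addrC subrK.
  apply: (shift_fixed_mem hL sL sy).
    apply: (subfieldB hy); first exact: vy.
    by apply: (subfieldM hy).
  have sv : s (v y) = v y + b by rewrite /b addrC subrK.
  by rewrite rmorphB rmorphM /= sy (sL b Lb) sv; ring.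
have inj := @fieldAut_inj _ k v.
have lin y : ~ L y -> exists2 b, L b & v y = b * y.
  move=> nLy; have [b [e [Lb Le vE]]] := aff y nLy.
  have b0 : b != 0.
    apply/eqP => b0; apply: nLy; rewrite (_ : y = e) //; apply: inj.
    by rewrite vE b0 mul0r add0r vL.
  have [b2 [e2 [Lb2 Le2 vE2]]] := aff (y ^+ 2) (nin_sqr hL nLy).
  have E : (e ^+ 2 - e2) + (2%:R * b * e) * y + (b ^+ 2 - b2) * y ^+ 2 = 0.
    have : v (y ^+ 2) = (b * y + e) ^+ 2 by rewrite rmorphXn /= vE.
    by rewrite vE2 => /eqP; rewrite -subr_eq0 => /eqP E; rewrite -[RHS]oppr0 -[X in _ = - X]E; ring.
  have [|||_ be _] := quadratic_eq0 hL nLy _ _ _ E.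
  - by apply: subfieldB => //; apply: subfieldX.
  - by apply: subfieldM => //; apply: subfieldM => //; apply: subfield_nat.
  - by apply: subfieldB => //; apply: subfieldX.
  exists b => //; rewrite vE; move/eqP: be.
  rewrite !mulf_eq0 (negPf (natr_neq0 char0 1)) (negPf b0) /= => /eqP ->.
  by rewrite addr0.
apply: fieldAut_ext => y; rewrite fieldAut1E.
have [Ly|nLy] := pselect (L y); first exact: vL.
have [b Lb vE] := lin y nLy.
have [b' Lb' vE'] := lin _ (nin_add hL (subfield1 hL1) nLy).
have E : (b' - 1) + (b' - b) * y + 0 * y ^+ 2 = 0.
  move: vE'; rewrite rmorphD rmorph1 /= vE => /eqP.
  by rewrite -subr_eq0 => /eqP E; rewrite -[RHS]oppr0 -[X in _ = - X]E; ring.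
have [|||/eqP + /eqP + _] := quadratic_eq0 hL nLy _ _ _ E.
- by apply: subfieldB => //; apply: subfield1.
- exact: subfieldB.
- exact: subfield0.
by rewrite !subr_eq0 vE => /eqP-> /eqP<-; rewrite mul1r.
Qed.

(** For a finite set A, the product of N and [fixing k A] is an open subgroup, so it lies between
    the groups of some M. Nontriviality of N forces M into L; every s fixing L then lies in the
    product and agrees on A with an element of N. Closedness concludes. *)
Lemma normal_fixing_dense L (N : set (fieldAut k)) : acl_closed L ->
    finitely_spanned k L -> normal_subgroup N (stabilizing k L) ->
    N `<=` fixing k L -> closed N -> N <> [set 1%g] ->
  N = fixing k L.
Proof.
move=> hL fL [hN _ NJ] NL clN N1.
have /is_subgroupP[N1' NM NV] := hN.
have [v Nv v1] : exists2 v, N v & v <> 1%g.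
  apply: contrapT => h; apply: N1; apply/seteqP; split=> [v Nv|_ -> //].
  by apply: contrapT => v1; apply: h; exists v.
have [y nLy vy] : exists2 y, ~ L y & ~ acl (y |` L) (v y).
  apply: contrapT => h; apply: v1.
  apply: locally_preserving_trivial hL fL (NL _ Nv) _ => y nLy.
  by apply: contrapT => h'; apply: h; exists y.
apply/seteqP; split=> // s sL.
apply: (closed_fieldAutP N).1 => // ms.
have [ls [lsL LE]] := finitely_spanned_basis hL fL.
(* Including a spanning sequence of L makes [fixing k A] stabilize L, hence normalize N, so that the
   product is a group. *)
pose A := [set` ls ++ ms].
have AL : fixing k A `<=` stabilizing k L.
  rewrite LE => g gA; apply: fixing_seq_stabilizing => x xl; apply: gA.
  by rewrite /A /= mem_cat (xl : x \in ls).
pose H : set (fieldAut k) := [set g | exists n a, [/\ N n, fixing k A a & g = (n * a)%g]].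
have NJ' a n : fixing k A a -> N n -> N (a * n * a^-1)%g.
  move=> aA Nn; have /is_subgroupP[_ _ HV] := stabilizing_subgroup k L.
  by have := NJ (a^-1)%g n (HV _ (AL _ aA)) Nn; rewrite conjgE invgK mulgA.
have H1 : H 1%g by exists 1%g, 1%g; rewrite mulg1; split.
have HM g h : H g -> H h -> H (g * h)%g.
  move=> [n [a [Nn aA ->]]] [n' [a' [Nn' aA' ->]]].
  exists (n * (a * n' * a^-1))%g, (a * a')%g; split.
  - by apply: NM => //; apply: NJ'.
  - exact: fixingM.
  - by rewrite !mulgA; congr (_ * _)%g; rewrite -!mulgA mulVg mulg1.
have HV g : H g -> H (g^-1)%g.
  move=> [n [a [Nn aA ->]]]; exists (a^-1 * n^-1 * a)%g, (a^-1)%g; split.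
  - by rewrite -{2}[a]invgK; apply: NJ'; [apply: fixingV|apply: NV].
  - exact: fixingV.
  - by rewrite invgM -!mulgA mulgV mulg1.
have [|M [hM fM MH HMs]] := open_subgroup_core char0 Finf H1 HM HV.
  by exists (ls ++ ms) => a aA; exists 1%g, a; rewrite mul1g.
have ML : M `<=` L.
  move=> u Mu; apply: contrapT => nLu.
  have [w nw] := exists_generic Finf (finitely_spannedU fL fM).
  (* Conjugating v by t gives an element of N sending u, in M, to w, outside M. *)
  have [|||t tL [tu tw]] := @hom_indep _ k L [:: y; v y] [:: u; w] fL.
  - by split; [apply: acl_nin|split].
  - split; [exact: acl_nin|split=> // h; apply: nw].
    by apply: acl_mono h => z [->|]; [right|left].
  - by [].
  apply: nw; apply: sub_acl; right.
  have : stabilizing k M (t * v * t^-1)%g.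
    apply: HMs; exists (t * v * t^-1)%g, 1%g; rewrite mulg1; split=> //.
    have /is_subgroupP[_ _ HV'] := stabilizing_subgroup k L.
    have := NJ (t^-1)%g v (HV' _ (fixing_sub_stabilizing tL)) Nv.
    by rewrite conjgE invgK mulgA.
  move=> /stabilizing_mem/(_ Mu); rewrite -{1}tu !fieldAutME fieldAutK.
  by rewrite tw.
have [n [a [Nn aA sE]]] : H s by apply: MH; apply: fixing_sub sL.
exists n => // x xm; rewrite sE fieldAutME aA //.
by rewrite /A /= mem_cat (xm : x \in ms) orbT.
Qed.

(** Commuting with [fixing k L] keeps v y in the closure of L(y) and, through the shift of y, makes
    v y - y an element e of L. The value at the square of y gives e = 0. *)
Lemma centralizing_trivial L v : acl_closed L -> finitely_spanned k L ->
  (forall t, fixing k L t -> (v * t)%g = (t * v)%g) -> v = 1%g.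
Proof.
move=> hL fL vt; have [hL1 kL cL] := hL.
have comm t x : fixing k L t -> v (t x) = t (v x).
  by move=> /vt E; rewrite -!fieldAutME E.
have trans y : ~ L y -> exists2 e, L e & v y = y + e.
  move=> nLy; have vy : acl (y |` L) (v y).
    apply: contrapT => nvy.
    have [t tK tv] := fixed_field char0 (acl_subfield k _) (@base_acl _ k _) nvy.
    apply: tv; rewrite -comm; last by move=> z Lz; apply: tK; apply: sub_acl; right.
    by rewrite tK //; apply: sub_acl; left.
  have L1 := subfield1 hL1.
  have [||s [sL _ sy _]] := affine_fieldAut hL (acl_aclosed k (y |` L))
    _ _ nLy L1 L1 (oner_neq0 _) (indep_nil k _).
  - by move=> z Lz; apply: sub_acl; right.
  - by apply: sub_acl; left.
  rewrite mul1r in sy; exists (v y - y); last by rewrite addrC subrK.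
  apply: (shift_fixed_mem hL sL sy).
    by apply: (subfieldB (acl_subfield k _)) => //; apply: sub_acl; left.
  rewrite rmorphB /= -comm // sy rmorphD rmorph1 opprD addrACA subrr addr0.
  by [].
have fixed y : ~ L y -> v y = y.
  move=> nLy; have [e Le vE] := trans y nLy.
  have [e2 Le2 vE2] := trans _ (nin_sqr hL nLy).
  have E : (e ^+ 2 - e2) + (2%:R * e) * y + 0 * y ^+ 2 = 0.
    have : v (y ^+ 2) = (y + e) ^+ 2 by rewrite rmorphXn /= vE.
    by rewrite vE2 => /eqP; rewrite -subr_eq0 => /eqP E; rewrite -[RHS]oppr0 -[X in _ = - X]E; ring.
  have [|||_ /eqP + _] := quadratic_eq0 hL nLy _ _ _ E.
  - by apply: subfieldB => //; apply: subfieldX.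
  - by apply: subfieldM => //; apply: subfield_nat.
  - exact: subfield0.
  by rewrite mulf_eq0 (negPf (natr_neq0 char0 1)) /= => /eqP e0; rewrite vE e0 addr0.
apply: fieldAut_ext => x; rewrite fieldAut1E.
have [Lx|/fixed //] := pselect (L x).
(* An element x of L is the difference of y + x and y, both outside L and therefore fixed by v. *)
have [y ny] := exists_generic Finf fL.
have nLy : ~ L y by move=> Ly; apply: ny; apply: sub_acl.
have := fixed _ (nin_add hL Lx nLy); rewrite rmorphD /= (fixed y nLy).
by move=> /addrI.
Qed.

Lemma fixing_neq1 L : acl_closed L -> finitely_spanned k L -> fixing k L <> [set 1%g].
Proof.
move=> hL fL E; have [y ny] := exists_generic Finf fL.
have nLy : ~ L y by move=> Ly; apply: ny; apply: sub_acl.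
have [hL1 kL _] := hL.
have [s sL sy] := fixed_field char0 hL1 kL nLy.
by move: sL; rewrite E => s1; apply: sy; rewrite s1.
Qed.

Lemma fixing_minimal L : acl_closed L -> finitely_spanned k L ->
  minimal_closed_normal (stabilizing k L) (fixing k L).
Proof.
move=> hL fL; split; first split.
- apply: fixing_normal; first exact: stabilizing_subgroup.
    by [].
  exact: fixing_sub_stabilizing.
- exact: fixing_closed.
- exact: fixing_neq1.
by move=> N [nN clN N1] NL; apply: normal_fixing_dense.
Qed.

(** If N met [fixing k L] trivially, the commutators of the two normal subgroups would be trivial
    and N would centralize [fixing k L]. So the intersection is nontrivial, equals N by minimality,
    and [normal_fixing_dense] applies. *)
Lemma minimal_closed_normal_eq L (N : set (fieldAut k)) : acl_closed L ->
  finitely_spanned k L -> minimal_closed_normal (stabilizing k L) N ->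
  N = fixing k L.
Proof.
move=> hL fL [[nN clN N1] Nmin].
have [hN NS NJ] := nN; have /is_subgroupP[N1' NM NV] := hN.
have [_ _ LJ] := fixing_normal (stabilizing_subgroup k L)
  (@subset_refl _ _) (@fixing_sub_stabilizing _ k L).
have /is_subgroupP[L1' LM LV] := fixing_subgroup k L.
pose N0 := N `&` fixing k L.
have N0n : normal_subgroup N0 (stabilizing k L).
  split.
  - apply/is_subgroupP; split=> [//|s t [? ?] [? ?]|s [? ?]].
      by split; [apply: NM|apply: LM].
    by split; [apply: NV|apply: LV].
  - by move=> s [/NS].
  - by move=> s t sL [? ?]; split; [apply: NJ|apply: LJ].
have N01 : N0 <> [set 1%g].
  move=> E; apply: N1; apply/seteqP; split=> [v Nv|_ -> //].
  apply: centralizing_trivial hL fL _ => t tL.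
  have : N0 ((v * t * v^-1) * t^-1)%g.
    split.
      rewrite -!mulgA; apply: NM => //.
      have := NJ (t^-1)%g (v^-1)%g (fixing_sub_stabilizing (LV _ tL)) (NV _ Nv).
      by rewrite conjgE invgK.
    apply: LM; last exact: LV.
    have /is_subgroupP[_ _ SV] := stabilizing_subgroup k L.
    by have := LJ (v^-1)%g t (SV _ (NS _ Nv)) tL; rewrite conjgE invgK mulgA.
  rewrite E => E1; have : ((v * t * v^-1 * t^-1) * (t * v))%g = (t * v)%g by rewrite E1 mul1g.
  by rewrite !mulgA -(mulgA _ (t^-1)%g) mulVg mulg1 -(mulgA _ (v^-1)%g) mulVg mulg1.
have N0N : N0 = N.
  apply: Nmin; last by move=> s [].
  split=> //; exact: closedI clN (fixing_closed k L).
apply: normal_fixing_dense => //; by rewrite -N0N => s [].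
Qed.

Lemma minimal_closed_normal_subgroupsE :
  [set fixing k L | L in proper_core] = minimal_closed_normal_subgroups k.
Proof.
apply/seteqP; split=> [_ [L pL <-]|N [H]].
  have [hL fL _] := pL.
  exists (stabilizing k L); last exact: fixing_minimal.
  by rewrite -maximal_open_subgroupsE; exists L.
rewrite -maximal_open_subgroupsE => -[L pL <-] mN; exists L => //.
by have [hL fL _] := pL; rewrite (minimal_closed_normal_eq hL fL mN).
Qed.

End NormalSubgroups.

(** * Finite orbits *)

Section FiniteOrbits.
Variables (F : closedFieldType) (k : set F).
Hypothesis char0 : [pchar F] =i pred0.
Local Notation acl := (acl k).
Local Notation acl_closed := (acl_closed k).
Implicit Types (s t g h : fieldAut k) (S K L M : set F).
Implicit Types (xs ys zs ms bs : seq F) (U V : set (fieldAut k)).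

Lemma alg_closure_fieldAut K s x : is_subfield K -> fixing k K s ->
  alg_closure K x -> alg_closure K (s x).
Proof.
move=> hK sK; have K0 := subfield0 hK.
move=> /(alg_closureP _ K0)[p [Kp p0 px]]; apply/(alg_closureP _ K0).
exists p; split=> //; have <- : map_poly s p = p.
  by apply/polyP => i; rewrite coef_map /= sK.
by apply/rootP; rewrite horner_map (rootP px) rmorph0.
Qed.

Lemma fixing_stabilizing_alg_closure K s : is_subfield K -> fixing k K s ->
  stabilizing k (alg_closure K) s.
Proof.
move=> hK sK; apply/seteqP; split=> [_ [x Kx <-]|x Kx].
  exact: alg_closure_fieldAut.
exists ((s^-1)%g x); last exact: fieldAutVK.
by apply: alg_closure_fieldAut => //; apply: fixingV.
Qed.

Lemma finite_roots (p : {poly F}) : p != 0 ->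
  exists rs : seq F, forall x, root p x -> x \in rs.
Proof.
move=> p0; have [rs pE] := closed_field_poly_normal p; exists rs => x.
by rewrite pE rootZ ?lead_coef_eq0 // root_prod_XsubC.
Qed.

Lemma alg_orbit K x : is_subfield K -> alg_closure K x ->
  exists rs : seq F, forall s : fieldAut k, fixing k K s -> s x \in rs.
Proof.
move=> hK /(alg_closureP _ (subfield0 hK))[p [Kp p0 px]].
have [rs rsP] := finite_roots p0; exists rs => s sK; apply: rsP.
have <- : map_poly s p = p by apply/polyP => i; rewrite coef_map /= sK.
by apply/rootP; rewrite horner_map (rootP px) rmorph0.
Qed.

Lemma adjoin_setU1 K S x : adjoin (adjoin K S) [set x] = adjoin K (x |` S).
Proof.
have h1 := @adjoin_subfield _ (adjoin K S) [set x].
have h2 := @adjoin_subfield _ K (x |` S).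
apply/seteqP; split.
  apply: adjoin_min => //; last by move=> _ ->; apply: sub_adjoinr; left.
  by apply: adjoin_min => // y; [apply: sub_adjoinl|move=> Sy; apply: sub_adjoinr; right].
apply: adjoin_min => // y; first by move=> Ky; do 2!apply: sub_adjoinl.
by move=> [->|Sy]; [apply: sub_adjoinr|apply: sub_adjoinl; apply: sub_adjoinr].
Qed.

Lemma adjoin_mono K S T : S `<=` T -> adjoin K S `<=` adjoin K T.
Proof.
move=> ST; apply: adjoin_min; [exact: adjoin_subfield|exact: sub_adjoinl|].
by apply: subset_trans ST _; apply: sub_adjoinr.
Qed.

Lemma adjoin_finite M S x : adjoin M S x -> exists2 bs : seq F, [set` bs] `<=` M &
  adjoin k ([set` bs] `|` S) x.
Proof.
pose P : set F := [set x | exists2 bs : seq F, [set` bs] `<=` M & adjoin k ([set` bs] `|` S) x].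
have P2 (f : F -> F -> F) : (forall T x y, adjoin k T x -> adjoin k T y -> adjoin k T (f x y)) ->
    forall x y, P x -> P y -> P (f x y).
  move=> fA u v [bs bM ub] [cs cM vc]; exists (bs ++ cs).
    by move=> z /=; rewrite mem_cat => /orP[/bM|/cM].
  apply: fA; [apply: adjoin_mono ub|apply: adjoin_mono vc] => z [zb|]; try by right.
    by left; rewrite /= mem_cat zb.
  by left; rewrite /= mem_cat (zb : z \in cs) orbT.
have hA T := @adjoin_subfield _ k T.
have hP : is_subfield P.
  apply: subfieldP.
  - by exists [::] => //; apply: (subfield1 (hA _)).
  - by apply: (P2 (fun x y => x - y)) => T u v; apply: subfieldB.
  - by apply: (P2 (fun x y => x / y)) => T u v; apply: subfield_div.
move: x; apply: adjoin_min => // x.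
  move=> Mx; exists [:: x]; first by move=> z /=; rewrite inE => /eqP->.
  by apply: sub_adjoinr; left; rewrite /= mem_head.
by move=> Sx; exists [::] => //; apply: sub_adjoinr; right.
Qed.

Lemma adjoin_finite_seq M S xs : [set` xs] `<=` adjoin M S ->
  exists2 bs : seq F, [set` bs] `<=` M & [set` xs] `<=` adjoin k ([set` bs] `|` S).
Proof.
elim: xs => [|x xs IHxs] sub; first by exists [::].
have [|bs bM xb] := IHxs.
  by move=> z zx; apply: sub; rewrite /= inE (zx : z \in xs) orbT.
have [|cs cM xc] := @adjoin_finite M S x; first by apply: sub; rewrite /= mem_head.
exists (bs ++ cs); first by move=> z /=; rewrite mem_cat => /orP[/bM|/cM].
move=> z /=; rewrite inE => /orP[/eqP->|/xb].
  by apply: adjoin_mono xc => w [wc|]; [left; rewrite /= mem_cat (wc : w \in cs) orbT|right].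
by apply: adjoin_mono => w [wc|]; [left; rewrite /= mem_cat (wc : w \in bs)|right].
Qed.

(* The minimal polynomial of an element of ms over M and its predecessors
   involves finitely many elements bs of M; fixing them is enough to extend. *)
Lemma lift_fixing_graph M ms : is_subfield M -> k `<=` M ->
  exists2 bs : seq F, [set` bs] `<=` M & forall g, stabilizing k M g ->
    fixing k [set` bs] g -> exists H, [/\ field_graph H,
      forall x, M x -> H (x, g x), forall a, a \in ms -> H (a, a),
      dom H = adjoin M [set` ms] & im H = adjoin M [set` ms]].
Proof.
move=> hM kM; elim: ms => [|a ms [bs bM IH]].
  exists [::] => // g gM _; exists [set z | M z.1 /\ z.2 = g z.1].
  have MA : adjoin M [set` [::]] = M.
    by apply/seteqP; split; [apply: adjoin_min|apply: sub_adjoinl].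
  split; rewrite ?MA //.
  - split; first split=> /=.
    + by split; [apply: subfield1|rewrite rmorph1].
    + by move=> x y x' y' [Mx ->] [Mx' ->]; split; [apply: subfieldB|rewrite rmorphB].
    + by move=> x y x' y' [Mx ->] [Mx' ->]; split; [apply: subfieldM|rewrite rmorphM].
    + move=> x y [Mx ->]; split=> [->|/eqP]; first exact: rmorph0.
      by rewrite fmorph_eq0 => /eqP.
    + by move=> x y [/= Mx ->]; split; [apply: subfieldV|rewrite fmorphV].
  - by apply/seteqP; split=> [x [y []]|x Mx] //; exists (g x).
  - by rewrite -[in RHS]gM; apply/seteqP; split=> [y [x [/= Mx ->]]|_ [x Mx <-]]; exists x.
pose K := adjoin M [set` ms].
have hK : is_subfield K by apply: adjoin_subfield.
have KE : adjoin M [set` a :: ms] = adjoin K [set a].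
  rewrite adjoin_setU1; congr (adjoin _ _); apply/seteqP; split=> z /=; rewrite inE.
    by move=> /orP[/eqP->|]; [left|right].
  by move=> [->|->]; rewrite ?eqxx ?orbT.
have [Ka|nKa] := pselect (alg_closure K a); last first.
  exists bs => // g gM gb; have [H [hH HM Hms dH iH]] := IH g gM gb; have [rH _] := hH.
  have aa : compatible H a a by apply: compatible_transcendental; rewrite ?dH ?iH.
  exists (adjoin_graph H a a); split.
  - exact: adjoin_graph_field.
  - by move=> x /HM; apply: sub_adjoin_graph.
  - move=> b; rewrite inE => /orP[/eqP->|/Hms]; first exact: mem_adjoin_graph.
    exact: sub_adjoin_graph.
  - by rewrite dom_adjoin_graph // dH KE.
  - by rewrite im_adjoin_graph // iH KE.
have [p [Kp p0 pa pmin]] := minimal_poly (subfield0 hK) Ka.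
have [cs cM pc] : exists2 bs : seq F, [set` bs] `<=` M &
    [set` (p : seq F)] `<=` adjoin k ([set` bs] `|` [set` ms]).
  by apply: adjoin_finite_seq => x /= /(nthP 0)[i _ <-]; apply: Kp.
exists (bs ++ cs); first by move=> z /=; rewrite mem_cat => /orP[/bM|/cM].
move=> g gM gbc.
have [|H [hH HM Hms dH iH]] := IH g gM.
  by move=> z zb; apply: gbc; rewrite /= mem_cat (zb : z \in bs).
have [rH hV] := hH.
have diag : adjoin k ([set` cs] `|` [set` ms]) `<=` [set c | H (c, c)].
  apply: adjoin_min.
  - apply: subfieldP => [|x y|x y] /=; [exact: ring_graph1|exact: ring_graphB|].
    exact: field_graph_div.
  - by move=> x kx; have := HM x (kM _ kx); rewrite fieldAut_id.
  - move=> x [xc|/Hms //]; have := HM x (cM _ xc).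
    by rewrite gbc // /= mem_cat (xc : x \in cs) orbT.
have pp : poly_graph H p p.
  move=> i; have [ip|ip] := ltnP i (size p); first by apply: diag; apply: pc; apply: mem_nth.
  by rewrite nth_default //; apply: ring_graph0.
have aa : compatible H a a.
  by apply: (compatible_minimal_poly hH pp p0 pa pa) => f; rewrite dH; apply: pmin.
exists (adjoin_graph H a a); split.
- exact: adjoin_graph_field.
- by move=> x /HM; apply: sub_adjoin_graph.
- move=> b; rewrite inE => /orP[/eqP->|/Hms]; first exact: mem_adjoin_graph.
  exact: sub_adjoin_graph.
- by rewrite dom_adjoin_graph // dH KE.
- by rewrite im_adjoin_graph // iH KE.
Qed.

(** Restriction to M is open: an automorphism close enough to the identity on M agrees there with
    one fixing the prescribed ms, which may lie outside M. *)
Lemma lift_fixing M ms : is_subfield M -> k `<=` M ->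
  exists2 bs : seq F, [set` bs] `<=` M & forall g, stabilizing k M g ->
    fixing k [set` bs] g -> exists2 h : fieldAut k, fixing k [set` ms] h &
      forall x, M x -> h x = g x.
Proof.
move=> hM kM; have [bs bM bP] := lift_fixing_graph ms hM kM; exists bs => // g gM gb.
have [H [hH HM Hms dH iH]] := bP g gM gb.
have hT := subfield_setT F; have cT := alg_closure_setT F.
have [|//||h [hP _]] := extend_fieldAut_in (N := setT) (k := k) hH _ _ _ hT cT.
- by rewrite dH.
- by move=> [x _] [/= kx <-]; have := HM x (kM _ kx); rewrite fieldAut_id.
by exists h => x; [move=> /Hms/hP|move=> /HM/hP].
Qed.

Lemma map_prod_XsubC (R : idomainType) (f : {rmorphism R -> R}) (O : seq R) :
  injective f -> uniq O -> (forall y, y \in O -> f y \in O) ->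
  map_poly f (\prod_(y <- O) ('X - y%:P)) = \prod_(y <- O) ('X - y%:P).
Proof.
move=> fI uO fO; rewrite rmorph_prod /=.
under eq_bigr do rewrite rmorphB /= map_polyX map_polyC /=.
rewrite -(big_map f xpredT (fun y => 'X - y%:P)) /=; apply: perm_big.
have ufO : uniq (map f O) by rewrite map_inj_uniq.
apply: uniq_perm => // y.
have [||_ E] := uniq_min_size ufO (_ : {subset map f O <= O}) _.
- by move=> _ /mapP[z zO ->]; apply: fO.
- by rewrite size_map.
by rewrite E.
Qed.

Lemma map_poly_Poly s bs i : (map_poly s (Poly bs))`_i = s bs`_i.
Proof. by rewrite coef_map coef_Poly. Qed.

(** The tuple bs is encoded as a polynomial, on which automorphisms act through [map_poly]; its
    orbit is finite as soon as the orbit of each entry is. *)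
Lemma orbit_poly V bs :
  (forall b, b \in bs -> exists rs : seq F, forall s, V s -> s b \in rs) ->
  exists O : seq {poly F}, uniq O /\
    forall R, R \in O <-> exists2 s, V s & map_poly s (Poly bs) = R.
Proof.
move=> Vb; suff [O OP] : exists O : seq {poly F}, forall s, V s -> map_poly s (Poly bs) \in O.
  exists (undup [seq R <- O | `[< exists2 s, V s & map_poly s (Poly bs) = R >]]).
  split=> [|R]; first exact: undup_uniq.
  rewrite mem_undup mem_filter; split=> [/andP[/asboolP //]|[s Vs <-]].
  by rewrite OP // andbT; apply/asboolP; exists s.
elim: bs Vb => [|b bs IHbs] Vb.
  by exists [:: 0] => s _; rewrite rmorph0 mem_head.
have [|O OP] := IHbs; first by move=> c cb; apply: Vb; rewrite inE cb orbT.
have [rs rsP] := Vb b (mem_head _ _).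
exists [seq R * 'X + r%:P | R <- O, r <- rs] => s Vs.
apply/allpairsP; exists (map_poly s (Poly bs), s b); split; [exact: OP|exact: rsP|].
by rewrite /= cons_poly_def rmorphD rmorphM /= map_polyX map_polyC.
Qed.

(** * Fixed fields of groups with finite orbits *)

Section FixedFieldOfGroup.
Variable U : set (fieldAut k).
Hypothesis hU : is_subgroup U.

Definition fixed_set : set F := [set x | forall s, U s -> s x = x].

Lemma fixed_set_subfield : is_subfield fixed_set.
Proof.
apply: subfieldP => [s _|x y Ux Uy s Us|x y Ux Uy s Us]; first exact: rmorph1.
  by rewrite rmorphB /= Ux ?Uy.
by rewrite fmorph_div /= Ux ?Uy.
Qed.

Lemma sub_fixed_set : k `<=` fixed_set.
Proof. by move=> x kx s _; apply: fieldAut_id. Qed.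

Lemma sub_fixing_fixed_set : U `<=` fixing k fixed_set.
Proof. by move=> s Us x; apply. Qed.

Lemma finite_orbit_algebraic x :
  (exists rs : seq F, forall s, U s -> s x \in rs) -> alg_closure fixed_set x.
Proof.
move=> [rs rsP]; have /is_subgroupP[U1 UM UV] := hU.
pose O := undup [seq y <- rs | `[< exists2 s, U s & s x = y >]].
have OP y : y \in O <-> exists2 s, U s & s x = y.
  rewrite mem_undup mem_filter; split=> [/andP[/asboolP //]|[s Us <-]].
  by rewrite rsP // andbT; apply/asboolP; exists s.
apply/alg_closureP; first exact: subfield0 fixed_set_subfield.
exists (\prod_(y <- O) ('X - y%:P)); split.
- move=> i s Us; rewrite -coef_map /= (map_prod_XsubC (f := s)) //.
  + exact: fieldAut_inj.
  + exact: undup_uniq.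
  + by move=> y /OP[t Ut <-]; apply/OP; exists (s * t)%g; [apply: UM|].
- by rewrite monic_neq0 // monic_prod_XsubC.
- by rewrite root_prod_XsubC; apply/OP; exists 1%g.
Qed.

(* Artin's argument, with the orbit of the polynomial \sum_i b_i X^i playing
   the role of a primitive element. *)
Lemma artin bs s :
  (forall b, b \in bs -> exists rs : seq F, forall s, U s -> s b \in rs) ->
  fixing k fixed_set s -> exists2 u, U u & forall b, b \in bs -> u b = s b.
Proof.
move=> /orbit_poly[O [uO OP]] sL; have /is_subgroupP[U1 UM UV] := hU.
pose Q : {poly {poly F}} := \prod_(R <- O) ('X - R%:P).
have mapI t : injective (map_poly t).
  by apply: map_poly_inj.
have fixQ u : U u -> map_poly (map_poly u) Q = Q.
  move=> Uu; apply: (map_prod_XsubC (f := map_poly u)) => //.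
    exact: mapI.
  move=> R /OP[t Ut <-]; apply/OP; exists (u * t)%g; first exact: UM.
  by apply/polyP => i; rewrite !coef_map.
have LQ i j : fixed_set Q`_i`_j.
  by move=> u Uu; rewrite -coef_map /= -coef_map /= fixQ.
have sQ : map_poly (map_poly s) Q = Q.
  by apply/polyP => i; apply/polyP => j; rewrite !coef_map /= sL.
have PO : Poly bs \in O.
  by apply/OP; exists 1%g => //; apply/polyP => i; rewrite coef_map.
have : root Q (map_poly s (Poly bs)).
  rewrite -sQ; apply/rootP; rewrite horner_map /=.
  suff /rootP -> : root Q (Poly bs) by rewrite rmorph0.
  by rewrite root_prod_XsubC.
rewrite root_prod_XsubC => /OP[u Uu E]; exists u => // b /(nthP 0)[i _ <-].
by rewrite -!map_poly_Poly E.
Qed.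

End FixedFieldOfGroup.

(* Enlarging the finite set S strictly shrinks the orbit of the generators of an
   overfield of L, as long as adjoin k S is not L. *)
Lemma finite_type_subfield L bs xs : is_subfield L -> k `<=` L ->
    [set` xs] `<=` L -> L `<=` adjoin k [set` xs ++ bs] ->
    [set` bs] `<=` acl [set` xs] ->
  finite_type k L.
Proof.
move=> hL kL xL LE bx.
pose orb (S : seq F) (O : seq {poly F}) := uniq O /\ forall R, R \in O <->
  exists2 s : fieldAut k, fixing k [set` S] s & map_poly s (Poly bs) = R.
have orbP (S : seq F) : {subset xs <= S} -> exists O, orb S O.
  move=> xS; apply: orbit_poly => b bb.
  have [rs rsP] := alg_orbit (@adjoin_subfield _ k [set` xs]) (bx _ bb).
  exists rs => s sS; apply: rsP; apply: fixing_adjoin.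
  by move=> z /xS; apply: sS.
pose Q n := `[< exists (S : seq F) O, [/\ {subset xs <= S}, [set` S] `<=` L, orb S O & size O = n] >].
have exQ : exists n, Q n.
  have [O OP] := orbP xs (fun _ => id).
  exists (size O); apply/asboolP; exists xs, O; split=> //.
have [_ /asboolP[S [O [xS SL [uO OP] <-]]] nmin] := ex_minnP exQ.
exists [set` S]; first exact: finite_seq.
have hS := @adjoin_subfield _ k [set` S].
apply/seteqP; split; last exact: adjoin_min.
move=> l Ll; apply: contrapT => nSl.
have [g gS gl] := fixed_field char0 hS (@sub_adjoinl _ k _) nSl.
have [|O' [uO' OP']] := orbP (l :: S).
  by move=> z /xS zS; rewrite inE zS orbT.
have : Q (size O').
  apply/asboolP; exists (l :: S), O'; split=> //.
    by move=> z /xS zS; rewrite inE zS orbT.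
  by move=> z /=; rewrite inE => /orP[/eqP->|/SL].
move=> /nmin; rewrite leqNgt => /negP; apply.
(* The image under g is not in the smaller orbit O': if h fixes [l :: S] and acts on bs as g does,
   the quotient of g by h fixes xs and bs, hence l, although g moves l. *)
have : (size (map_poly g (Poly bs) :: O') <= size O)%N.
  apply: uniq_leq_size.
    rewrite /= uO' andbT; apply/negP => /OP'[h hS' E]; apply: gl.
    have hl : h l = l by apply: hS'; rewrite /= mem_head.
    have : fixing k [set` xs ++ bs] (h^-1 * g)%g.
      move=> z zxb; have : z \in xs ++ bs by [].
      rewrite mem_cat fieldAutME => /orP[/xS zS|/(nthP 0)[i _ <-]].
        have gz : g z = z by apply: gS; apply: sub_adjoinr.
        have hz : h z = z by apply: hS'; rewrite /= inE zS orbT.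
        by rewrite gz -{1}hz fieldAutK.
      by rewrite -map_poly_Poly -E map_poly_Poly fieldAutK.
    move=> /fixing_adjoin/(_ l (LE _ Ll)); rewrite fieldAutME => E'.
    by rewrite -[LHS](fieldAutVK h) E' hl.
  move=> R; rewrite inE => /orP[/eqP->|/OP'[s sS <-]]; apply/OP.
    by exists g => // z zS; apply: gS; apply: sub_adjoinr.
  by exists s => // z zS; apply: sS; rewrite /= inE (zS : z \in S) orbT.
by [].
Qed.

End FiniteOrbits.

(** * Co-compact subgroups *)

Lemma filter_seq (T : Type) (I : eqType) (FF : set_system T) (P : I -> set T)
    (bs : seq I) : Filter FF -> (forall b, b \in bs -> FF (P b)) ->
  FF [set q | forall b, b \in bs -> P b q].
Proof.
move=> hF; elim: bs => [|b bs IHbs] bP; first exact: filterS filterT.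
have h1 := bP b (mem_head _ _).
have h2 : FF [set q | forall b, b \in bs -> P b q].
  by apply: IHbs => c cb; apply: bP; rewrite inE cb orbT.
apply: filterS (filterI h1 h2) => q [q1 q2] c; rewrite inE => /orP[/eqP->|] //.
exact: q2.
Qed.

Lemma ultra_finite_range (T : Type) (I : eqType) (f : T -> I) (rs : seq I)
    (FF : set_system T) : UltraFilter FF -> FF [set q | f q \in rs] ->
  exists y, FF [set q | f q = y].
Proof.
move=> FU; elim: rs => [|r rs IHrs] Frs.
  by have [q] := filter_ex Frs.
have [|nr] := in_ultra_setVsetC [set q | f q = r] FU; first by exists r.
apply: IHrs; apply: filterS (filterI Frs nr) => q [].
by rewrite /= inE => /orP[/eqP|].
Qed.

Section CosetSpace.
Variables (F : closedFieldType) (k : set F).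
Variables (U N : set (fieldAut k)).

Definition coset_pi (u : U) : cosets U N :=
  (\pi_({eq_quot (same_coset_equiv U N)}) u)%qT.

Lemma coset_piP (u v : U) : coset_pi u = coset_pi v <->
  [set (val u * n)%g | n in N] = [set (val v * n)%g | n in N].
Proof. by split=> [/eqmodP/asboolP|h] //; apply/eqmodP/asboolP. Qed.

Lemma coset_pi_surj (q : cosets U N) : exists u, coset_pi u = q.
Proof. by exists (repr q); apply: reprK. Qed.

Lemma open_cosetP (V : set (cosets U N)) : open V <->
  exists2 O : set (fieldAut k), open O & forall u : U, V (coset_pi u) <-> O (val u).
Proof.
split=> [[O oO OE]|[O oO OE]].
  exists O => // u; have := congr1 (fun A : set U => A u) OE.
  by rewrite /preimage /= => E; split; rewrite /coset_pi -E.
exists O => //; apply/seteqP; split=> u /=; first by move=> Ou; apply/OE.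
by move=> /OE.
Qed.

End CosetSpace.

Section FixingCosets.
Variables (F : closedFieldType) (k : set F).
Hypothesis char0 : [pchar F] =i pred0.
Implicit Types (U : set (fieldAut k)) (L M : set F).

(** Cosets of [fixing k M] are thus restrictions to M, and the quotient acts on M. *)
Lemma fixing_coset_eq U M (u v : U) :
  coset_pi (fixing k M) u = coset_pi (fixing k M) v <->
  forall x, M x -> val u x = val v x.
Proof.
rewrite coset_piP; split=> [E x Mx|uv].
  have : [set (val u * n)%g | n in fixing k M] (val u) by exists 1%g; rewrite ?mulg1.
  by rewrite E => -[n nM <-]; rewrite fieldAutME nM.
have sub (s t : fieldAut k) : (forall x, M x -> s x = t x) ->
    [set (s * n)%g | n in fixing k M] `<=` [set (t * n)%g | n in fixing k M].
  move=> st _ [n nM <-]; exists (t^-1 * (s * n))%g.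
    by move=> x Mx; rewrite !fieldAutME nM // st // fieldAutK.
  by rewrite !mulgA mulgV mul1g.
by apply/seteqP; split; apply: sub => x /uv.
Qed.

(** Elements of the closure M have finite orbits under [fixing k L], so an ultrafilter on the cosets
    selects one value phi x for each x in M. These values form an automorphism of M over L; the
    coset of any extension of it to F is a limit. *)
Lemma fixing_cocompact L : is_subfield L -> k `<=` L ->
  cocompact (fixing k L) (fixing k (alg_closure L)).
Proof.
move=> hL kL; pose M := alg_closure L; rewrite -/M.
have hM : is_subfield M by apply: alg_closure_subfield.
have LM : L `<=` M by apply: sub_alg_closure.
have kM : k `<=` M by apply: subset_trans LM.
pose U := fixing k L; rewrite /cocompact -/U compact_ultra => FF FU _.
pose rep (q : cosets U (fixing k M)) : U := sval (cid (coset_pi_surj q)).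
have repE q : coset_pi _ (rep q) = q by apply: svalP (cid (coset_pi_surj q)).
pose ev q : fieldAut k := val (rep q).
have evL q x : L x -> ev q x = x by apply: (set_valP (rep q)).
have evM q : stabilizing k M (ev q).
  by apply: fixing_stabilizing_alg_closure => // x; apply: evL.
have FT : FF setT by apply: filterT.
have /choice[phi phiP] : forall x, exists y, M x -> FF [set q | ev q x = y].
  move=> x; have [Mx|nMx] := pselect (M x); last by exists 0.
  have [rs rsP] := alg_orbit k hL Mx.
  have [|y Fy] := @ultra_finite_range _ _ (fun q => ev q x) rs FF FU.
    by apply: filterS FT => q _; apply: rsP => z; apply: evL.
  by exists y.
(* The limit of the inverses is needed for surjectivity of phi. *)
have /choice[psi psiP] : forall x, exists y, M x -> FF [set q | ((ev q)^-1)%g x = y].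
  move=> x; have [Mx|nMx] := pselect (M x); last by exists 0.
  have [rs rsP] := alg_orbit k hL Mx.
  have [|y Fy] := @ultra_finite_range _ _ (fun q => ((ev q)^-1)%g x) rs FF FU.
    by apply: filterS FT => q _; apply: rsP; apply: fixingV => z; apply: evL.
  by exists y.
have phiM x : M x -> M (phi x).
  move=> Mx; have [q <-] := filter_ex (phiP x Mx).
  exact: stabilizing_mem Mx.
have psiM x : M x -> M (psi x).
  move=> Mx; have [q <-] := filter_ex (psiP x Mx).
  have /is_subgroupP[_ _ SV] := stabilizing_subgroup k M.
  exact: stabilizing_mem (SV _ (evM q)) Mx.
have phipsi x : M x -> phi (psi x) = x.
  move=> Mx; have Mp := psiM x Mx.
  have [q [/= h1 h2]] := filter_ex (filterI (psiP x Mx) (phiP _ Mp)).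
  by rewrite -h2 -h1 fieldAutVK.
have phiL x : L x -> phi x = x.
  move=> Lx; have [q /= <-] := filter_ex (phiP x (LM x Lx)); exact: evL.
have phi1 : phi 1 = 1 by apply: phiL; apply: subfield1.
(* The three values involved are attained together at a single q, where phi may be replaced by an
   actual automorphism. *)
have phi2 (f : F -> F -> F) : (forall (s : fieldAut k) x y, s (f x y) = f (s x) (s y)) ->
    (forall x y, M x -> M y -> M (f x y)) ->
    forall x y, M x -> M y -> phi (f x y) = f (phi x) (phi y).
  move=> fs fM x y Mx My.
  have [q [[/= h1 h2] /= h3]] := filter_ex (filterI (filterI (phiP x Mx) (phiP y My)) (phiP _ (fM _ _ Mx My))).
  by rewrite -h3 fs h1 h2.
have phiB := phi2 (fun x y => x - y) (fun s => rmorphB s) (subfieldB hM).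
have phi_mul := phi2 (fun x y => x * y) (fun s => rmorphM s) (subfieldM hM).
have phi_div := phi2 (fun x y => x / y) (fun s => fmorph_div s) (subfield_div hM).
have phi0 : phi 0 = 0 by apply: phiL; apply: subfield0.
pose G : set (F * F) := [set z | M z.1 /\ z.2 = phi z.1].
have hG : field_graph G.
  split; first split=> /=.
  - by split=> //; apply: subfield1.
  - by move=> x y x' y' [/= Mx ->] [/= Mx' ->]; split; [apply: subfieldB|rewrite phiB].
  - by move=> x y x' y' [/= Mx ->] [/= Mx' ->]; split; [apply: subfieldM|rewrite phi_mul].
  - move=> x y [/= Mx ->]; split=> [->//|]; have [q /= <-] := filter_ex (phiP x Mx).
    by move/eqP; rewrite fmorph_eq0 => /eqP.
  - move=> x y [/= Mx ->]; split; first exact: subfieldV.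
    by have := phi_div 1 x (subfield1 hM) Mx; rewrite phi1 !div1r /= => ->.
have dG : dom G = M by apply/seteqP; split=> [x [y []]|x Mx] //; exists (phi x).
have iG : im G = M.
  apply/seteqP; split=> [y [x [/= Mx ->]]|y My]; first exact: phiM.
  by exists (psi y); split=> /=; [apply: psiM|rewrite phipsi].
have hT := subfield_setT F; have cT := alg_closure_setT F.
have [|//||s [sP _]] := extend_fieldAut_in (N := setT) (k := k) hG _ _ _ hT cT.
- by rewrite dG.
- by move=> [x _] [/= kx <-]; split=> /=; [apply: kM|rewrite phiL //; apply: kL].
have sphi x : M x -> s x = phi x by move=> Mx; apply: sP.
have sU : U s by move=> x Lx; rewrite sphi ?phiL //; apply: LM.
exists (coset_pi _ (SigSub (mem_set sU) : U)); split=> // W.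
rewrite nbhsE => -[V [oV Vs] VW]; apply: filterS VW _.
have [O oO VO] := (open_cosetP V).1 oV.
have Os : O s by have /VO := Vs.
move: oO; rewrite open_fieldAutE => /(_ s Os)[A /finite_seqP[ms ->] sA].
(* The neighbourhood of s is given by ms, on which phi says nothing; lifting trades it for the
   condition on bs inside M, which the ultrafilter controls. *)
have [bs bM bP] := lift_fixing ms hM kM.
have Fbs : FF [set q | forall b, b \in bs -> ev q b = phi b].
  by apply: (filter_seq (P := fun b => [set q | ev q b = phi b])) => b /bM/phiP.
apply: filterS Fbs => q /= qb.
have sM : stabilizing k M s.
  by apply: fixing_stabilizing_alg_closure.
have /is_subgroupP[_ SM SV] := stabilizing_subgroup k M.
have [||h hms hM'] := bP (s^-1 * ev q)%g.
- by apply: SM => //; apply: SV.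
- by move=> b bb; rewrite fieldAutME qb // -sphi ?fieldAutK //; apply: bM.
have shM x : M x -> (s * h)%g x = ev q x.
  by move=> Mx; rewrite !fieldAutME hM' // fieldAutME fieldAutVK.
have Ush : U (s * h)%g by move=> x Lx; rewrite shM ?evL //; apply: LM.
have -> : q = coset_pi _ (SigSub (mem_set Ush) : U).
  by rewrite -[LHS]repE; apply/fixing_coset_eq => x Mx; symmetry; exact: shM.
by apply/VO; apply: sA; exists h.
Qed.

(** If the orbit were infinite, avoiding finite sets of values at x would define a proper filter on
    the cosets. It has no cluster point p, since taking the value of p at x is an open condition. *)
Lemma cocompact_finite_orbit U M x : cocompact U (fixing k M) -> M x ->
  exists rs : seq F, forall s, U s -> s x \in rs.
Proof.
move=> cU Mx; apply: contrapT => inf.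
pose rep (q : cosets U (fixing k M)) : U := sval (cid (coset_pi_surj q)).
have repE q : coset_pi _ (rep q) = q by apply: svalP (cid (coset_pi_surj q)).
have rep_pi u : val (rep (coset_pi _ u)) x = val u x.
  by have /fixing_coset_eq := repE (coset_pi (fixing k M) u); apply.
pose FF : set_system (cosets U (fixing k M)) :=
  [set W | exists rs : seq F, [set q | val (rep q) x \notin rs] `<=` W].
have hFF : ProperFilter FF.
  split.
    move=> [rs rsW]; apply: inf; exists rs => s Us; apply: contrapT => /negP ns.
    apply: (rsW (coset_pi _ (SigSub (mem_set Us) : U))).
    by rewrite /= rep_pi.
  split.
  - by exists [::].
  - move=> A B [rs rsA] [rs' rsB]; exists (rs ++ rs') => q /=.
    by rewrite mem_cat negb_or => /andP[/rsA ? /rsB ?].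
  - by move=> A B AB [rs rsA]; exists rs; apply: subset_trans AB.
have FT : FF setT by exists [::].
have [p [_ pcl]] := cU FF hFF FT.
have [q [/= q1 q2]] : [set q | val (rep q) x \notin [:: val (rep p) x]] `&`
    [set q | val (rep q) x = val (rep p) x] !=set0.
  apply: pcl; first by exists [:: val (rep p) x].
  apply: open_nbhs_nbhs; split=> //; apply/open_cosetP.
  exists [set t : fieldAut k | t x = val (rep p) x].
    rewrite open_fieldAutE => t /= tx; exists [set x]; first exact: finite_set1.
    move=> _ [h hx <-]; change ((t * h)%g x = val (rep p) x).
    by rewrite fieldAutME (hx x erefl).
  by move=> u /=; rewrite rep_pi.
by move: q1; rewrite q2 mem_head.
Qed.

End FixingCosets.

(** * Subfields of finite type and intersections of their groups *)

Section OpenCocompact.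
Variables (F : closedFieldType) (k : set F).
Hypothesis char0 : [pchar F] =i pred0.
Hypothesis hk : acl_closed k k.
Hypothesis Finf : ~ finitely_spanned k [set: F].
Local Notation acl := (acl k).
Local Notation acl_closed := (acl_closed k).

Lemma finite_type_alg_closure L : finite_type k L -> L <> k ->
  [/\ is_subfield L, k `<=` L & proper_core k (alg_closure L)].
Proof.
move=> [S /finite_seqP[ms ->] LE] nk; have hL := @adjoin_subfield _ k [set` ms].
rewrite LE; split=> //; first exact: sub_adjoinl.
split; [exact: acl_aclosed|exact/finitely_spanned_acl/finitely_spanned_seq|].
move=> E; apply: nk; rewrite LE; apply/seteqP; split; last exact: sub_adjoinl.
by rewrite -[X in _ `<=` X]E; apply: sub_alg_closure.
Qed.

Lemma finite_type_cocompact_overgroup L : finite_type k L -> L <> k ->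
  cocompact_overgroup (fixing k (alg_closure L)) (fixing k L).
Proof.
move=> fL nk; have [hL kL _] := finite_type_alg_closure fL nk.
split; last exact: fixing_cocompact.
apply: fixing_normal; first exact: fixing_subgroup.
  by move=> s; apply: fixing_stabilizing_alg_closure.
by apply: fixing_sub; apply: sub_alg_closure.
Qed.

Lemma finite_type_fixing_open L : finite_type k L -> open (fixing k L).
Proof.
move=> [S /finite_seqP[ms ->] ->]; apply/open_subgroupP; first exact: fixing_subgroup.
by exists ms => s; apply: fixing_adjoin.
Qed.

(** [artin] only matches an element of [fixing k L] with one of U on a finite set. Openness makes
    this enough, and it also bounds L by a finitely generated field. *)
Lemma open_cocompact_fixing (U : set (fieldAut k)) M : is_subgroup U -> open U -> proper_core k M ->
  cocompact_overgroup (fixing k M) U ->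
  exists L, [/\ finite_type k L, L <> k & U = fixing k L].
Proof.
move=> hU oU [hM fM nk] [[_ MU MJ] cU].
have [hM1 kM cM] := hM; have /is_subgroupP[U1 UM UV] := hU.
have UsM : U `<=` stabilizing k M.
  move=> s Us; rewrite -(normalizing_fixing char0 hM1 kM).
  apply/seteqP; split=> [_ [t tM <-]|t tM]; first exact: MJ.
  exists (conjg t (s^-1)%g); first by apply: MJ => //; apply: UV.
  by rewrite !conjgE invgK !mulgA mulVg mul1g -mulgA mulVg mulg1.
pose L := fixed_set U.
have hL := fixed_set_subfield U; have kL := @sub_fixed_set _ k U.
have UL : U `<=` fixing k L := @sub_fixing_fixed_set _ k U.
have LM : L `<=` M by exact: (fixing_subset char0 hM1 kM (subset_trans MU UL)).
have orb x : M x -> exists rs : seq F, forall s, U s -> s x \in rs.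
  by move=> Mx; apply: cocompact_finite_orbit cU Mx.
have ML : alg_closure L = M.
  apply/seteqP; split; first by rewrite -[X in _ `<=` X]cM; apply: alg_closure_mono.
  by move=> x /orb; apply: finite_orbit_algebraic.
have [ms Ums] := (open_subgroupP hU).1 oU.
have [bs bM bP] := lift_fixing ms hM1 kM.
(* U is open and contains [fixing k M], so among the automorphisms stabilizing M, membership in U
   follows from fixing the finite set bs inside M. *)
have inU g : stabilizing k M g -> fixing k [set` bs] g -> U g.
  move=> gM gb; have [h hms hg] := bP g gM gb.
  have -> : g = (h * (h^-1 * g))%g by rewrite mulgA mulgV mul1g.
  apply: UM; first exact: Ums.
  by apply: MU => x Mx; rewrite fieldAutME -hg // fieldAutK.
have UE : U = fixing k L.
  apply/seteqP; split=> // s sL.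
  have [|u Uu ub] := artin hU _ sL (bs := bs); first by move=> b /bM/orb.
  have -> : s = (u * (u^-1 * s))%g by rewrite mulgA mulgV mul1g.
  apply: UM => //; apply: inU.
    have /is_subgroupP[_ SM SV] := stabilizing_subgroup k M.
    apply: SM; first by apply/SV/UsM.
    by rewrite -ML; apply: fixing_stabilizing_alg_closure.
  by move=> b bb; rewrite fieldAutME -ub // fieldAutK.
have [zs Mzs] := fM.
have [|xs [_ xL Lx]] := @exists_basis _ k set0 L zs.
  by rewrite set0U; apply: subset_trans Mzs.
rewrite set0U in Lx.
have Mx : M = acl [set` xs].
  apply/seteqP; split; last by apply: acl_min => //; apply: subset_trans LM.
  rewrite -ML; have [_ _ <-] := acl_aclosed k [set` xs].
  exact: alg_closure_mono.
exists L; split=> //; last first.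
  by move=> Lk; apply: nk; rewrite -ML Lk; case: hk.
apply: (@finite_type_subfield _ _ char0 L bs xs) => //; last by rewrite -Mx.
apply: (fixing_subset char0 (@adjoin_subfield _ k _) (@sub_adjoinl _ k _)).
move=> s sxb; apply: UL; apply: inU.
  rewrite Mx; apply: fixing_seq_stabilizing => x xx; apply: sxb; apply: sub_adjoinr.
  by rewrite /= mem_cat (xx : x \in xs).
move=> b bb; apply: sxb; apply: sub_adjoinr.
by rewrite /= mem_cat (bb : b \in bs) orbT.
Qed.

Lemma open_cocompact_overgroupsE :
  [set fixing k L | L in finite_type k `\ k] = open_cocompact_overgroups k.
Proof.
have E := minimal_closed_normal_subgroupsE char0 hk Finf.
apply/seteqP; split=> [_ [L [fL nk] <-]|U [hU oU [N]]].
  have [hL kL pL] := finite_type_alg_closure fL nk.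
  split; [exact: fixing_subgroup|exact: finite_type_fixing_open|].
  exists (fixing k (alg_closure L)); last exact: finite_type_cocompact_overgroup.
  by rewrite -E; exists (alg_closure L).
rewrite -E => -[M pM <-] co.
have [L [fL nk ->]] := open_cocompact_fixing hU oU pM co.
by exists L.
Qed.

Lemma fixing_intersections :
  fixing k @` intermediate_fields k `\ [set: fieldAut k] =
    intersections_of (open_cocompact_overgroups k).
Proof.
rewrite -open_cocompact_overgroupsE; have [hk1 _ ck] := hk.
apply/seteqP; split=> [_ [[K [hK kK] <-] nT]|H [E [ED [U0 EU0] ->]]].
  have [x Kx nkx] : exists2 x, K x & ~ k x.
    apply: contrapT => h; apply: nT; apply/seteqP; split=> // s _ x Kx.
    by apply: fieldAut_id; apply: contrapT => nkx; apply: h; exists x.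
  (* K is the union of its simple subextensions k(y); those with y outside k suffice, and there is
     one because the group is proper. *)
  pose E := [set fixing k (adjoin k [set y]) | y in K `\` k].
  exists E; split.
  - move=> _ [y [Ky nky] <-]; exists (adjoin k [set y]) => //; split.
      by exists [set y]; [exact: finite_set1|].
    by move=> Ek; apply: nky; rewrite -Ek; apply: sub_adjoinr.
  - by exists (fixing k (adjoin k [set x])), x.
  - apply/seteqP; split=> s sK.
      by move=> _ [y [Ky nky] <-]; apply: fixing_adjoin => _ ->; apply: sK.
    move=> y Ky; have [ky|nky] := pselect (k y); first exact: fieldAut_id.
    have : fixing k (adjoin k [set y]) s by apply: sK; exists y.
    by apply; apply: sub_adjoinr.
pose K := fixed_set (\bigcap_(U in E) U).
have LK L : E (fixing k L) -> L `<=` K by move=> EL x Lx s sE; apply: (sE _ EL).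
split.
  exists K; first by split; [exact: fixed_set_subfield|exact: sub_fixed_set].
  apply/seteqP; split=> s sK; last exact: sub_fixing_fixed_set.
  move=> U EU; have [L _ UL] := ED _ EU; rewrite -UL => x Lx; apply: sK.
  by apply: LK Lx; rewrite UL.
move=> HT; have [L [fL nk] UL] := ED _ EU0; apply: nk.
have [hL kL _] : [/\ is_subfield L, k `<=` L & True].
  case: fL => S _ ->; split=> //; [exact: adjoin_subfield|exact: sub_adjoinl].
apply/seteqP; split=> //; apply: (fixing_subset char0 hk1 (@subset_refl _ k)) => s _.
rewrite UL; have : [set: fieldAut k] s by [].
by rewrite -HT; apply.
Qed.

End OpenCocompact.

(** * Algebraic independence *)

Section AlgebraicIndependence.
Variables (F : closedFieldType) (k : set F).
Hypothesis char0 : [pchar F] =i pred0.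
Hypothesis hk : is_subfield k.
Local Notation acl := (acl k).

Definition others (n : nat) (x : 'I_n -> F) (i : 'I_n) : set F :=
  [set x j | j in [set j | j != i]].

(* A relation for x i over k(x j | j != i), cleared of denominators, is a
   polynomial relation between the x j. *)
Lemma alg_independent_others (n : nat) (x : 'I_n -> F) (i : 'I_n) :
  (forall p : {mpoly F[n]}, p \is a mpolyOver n (mem k) -> p.@[x] = 0 -> p = 0) ->
  ~ acl (others x i) (x i).
Proof.
move=> xind.
(* Polynomials over k not involving the variable i, described through their values rather than their
   monomials. *)
pose V (p : {mpoly F[n]}) := p \is a mpolyOver n (subfield_pred hk) /\
  forall v v' : 'I_n -> F, (forall j, j != i -> v j = v' j) -> p.@[v] = p.@[v'].
pose R : set (F * F) := [set z | exists2 p, V p & z = (p.@[x], p.@[x])].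
have rR : ring_graph R.
  split=> [|? ? ? ? [p [kp pv] [-> ->]] [q [kq qv] [-> ->]]|? ? ? ? [p [kp pv] [-> ->]] [q [kq qv] [-> ->]]|? ? [p _ [-> ->]] //].
  - exists 1; last by rewrite meval1.
    by split=> [|v v' _]; [apply: rpred1|rewrite !meval1].
  - exists (p - q); last by rewrite mevalB.
    split=> [|v v' vv]; first exact: rpredB.
    by rewrite !mevalB (pv v v') // (qv v v').
  - exists (p * q); last by rewrite mevalM.
    split=> [|v v' vv]; first exact: rpredM.
    by rewrite !mevalM (pv v v') // (qv v v').
have RE u v : R (u, v) -> u = v by move=> [p _ [-> ->]].
have sub : adjoin k (others x i) `<=` dom (fractions R).
  apply: adjoin_min; first exact/dom_subfield/fractions_field_graph.
    move=> c kc; exists c; apply: sub_fractions => //; exists c%:MP; last by rewrite !mevalC.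
    split=> [|v v' _]; last by rewrite !mevalC.
    by rewrite mpolyOverC; apply: (mem_set kc).
  move=> _ [j /= ji <-]; exists (x j); apply: sub_fractions => //; exists 'X_j; last by rewrite !mevalXU.
  by split=> [|v v' vv]; [apply: mpolyOverX|rewrite !mevalXU vv].
have frac u : adjoin k (others x i) u -> exists ab : F * F,
    [/\ R (ab.1, ab.1), R (ab.2, ab.2), ab.2 != 0 & u = ab.1 / ab.2].
  move=> /sub[? [a [a' [b [b' [ab bb b0 [-> _]]]]]]]; exists (a, b); split=> //=.
    by rewrite {2}(RE _ _ ab).
  by rewrite {2}(RE _ _ bb).
move=> /(alg_closureP _ (subfield0 (@adjoin_subfield _ k _)))[p [Kp p0 /rootP px]].
have /choice[ab abP] : forall l, exists ab : F * F,
    [/\ R (ab.1, ab.1), R (ab.2, ab.2), ab.2 != 0 & p`_l = ab.1 / ab.2].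
  by move=> l; apply: frac.
pose c := \prod_(j < size p) (ab j).2.
have c0 : c != 0 by apply/prodf_neq0 => j _; case: (abP j).
have /choice[r rP] : forall l, exists r, V r /\ c * p`_l = r.@[x].
  move=> l; suff [r Vr [E _]] : R (c * p`_l, c * p`_l) by exists r.
  have [lp|lp] := ltnP l (size p); last first.
    by rewrite nth_default // mulr0; apply: ring_graph0.
  have [h1 h2 h3 ->] := abP l.
  rewrite /c (bigD1 (Ordinal lp)) //= [_ * \prod_(_ < _ | _) _]mulrC -mulrA.
  rewrite [(ab l).2 * _]mulrC divfK // .
  apply: ring_graphM => //; apply: ring_graph_prod => // j _; by case: (abP j).
pose q : {mpoly F[n]} := \sum_(l < size p) r l * 'X_i ^+ l.
have qv v : (forall j, j != i -> v j = x j) -> q.@[v] = (c *: p).[v i].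
  move=> vx; rewrite hornerZ horner_coef mulr_sumr raddf_sum /=; apply: eq_bigr => l _.
  have [[_ rv] rE] := rP l.
  by rewrite mevalM (rv v x) // -rE mulrA rmorphXn /= mevalXU.
have q0 : q = 0.
  apply: xind; last by rewrite qv // hornerZ px mulr0.
  have : q \is a mpolyOver n (subfield_pred hk).
    apply: rpred_sum => l _; apply: rpredM; first by have [[]] := rP l.
    by apply: rpredX; apply: mpolyOverX.
  by [].
(* As q is the zero polynomial, its variable i may take any value t while the others stay at x. Then
   c p vanishes everywhere, whereas c p + 1 has a root. *)
have all0 t : (c *: p).[t] = 0.
  have := qv (fun j => if j == i then t else x j); rewrite q0 meval0 eqxx => <- //.
  by move=> j /negPf->.
have sp : (1 < size (c *: p))%N.
  rewrite size_scale // ltnNge; apply/negP => /size1_polyC pE.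
  by move: px p0; rewrite pE hornerC => ->; rewrite eqxx.
have [|t] := @closed_field_root F (c *: p + 1).
  by rewrite size_addl // size_poly1.
rewrite rootE hornerD all0 add0r hornerC; by rewrite oner_eq0.
Qed.

Lemma mcoeff_weight (n : nat) (w : 'X_{1..n} -> F) (p : {mpoly F[n]}) m :
  (\sum_(m <- msupp p) (w m * p@_m) *: 'X_[m])@_m = w m * p@_m.
Proof.
rewrite raddf_sum /=; have [mp|mp] := boolP (m \in msupp p).
  rewrite (bigD1_seq m) ?msupp_uniq //= mcoeffZ mcoeffX eqxx mulr1.
  rewrite big1_seq ?addr0 // => m' /andP[mm _].
  by rewrite mcoeffZ mcoeffX (negPf mm) mulr0.
rewrite (memN_msupp_eq0 mp) mulr0 big1_seq // => m' /= m'p.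
rewrite mcoeffZ mcoeffX; case: eqP => [E|]; last by rewrite mulr0.
by move: mp; rewrite -E m'p.
Qed.

(* Distinct monomials are eigenvectors with distinct eigenvalues of the
   automorphisms x i |-> 2 x i. *)
Lemma others_alg_independent (n : nat) (x : 'I_n -> F) :
  (forall i, ~ acl (others x i) (x i)) ->
  forall p : {mpoly F[n]}, p \is a mpolyOver n (mem k) -> p.@[x] = 0 -> p = 0.
Proof.
move=> xind p; have [d] := ubnP (size (msupp p)); elim: d p => // d IHd p sp kp px.
have kpm m : k p@_m.
  by move: (kp : p \is a mpolyOver n (subfield_pred hk)) => /mpolyOverP/(_ m)/set_mem.
have x0 i : x i != 0.
  apply/eqP => xi0; apply: (xind i); rewrite xi0.
  exact: subfield0 (acl_subfield k _).
apply: contrapT => /eqP p0.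
have [m0 m0p] : exists m0, m0 \in msupp p.
  by case E: (msupp p) => [|m0 s]; [move: p0; rewrite -msupp_eq0 E|exists m0; rewrite mem_head].
have [m1 m1p m10] : exists2 m1, m1 \in msupp p & m1 != m0.
  apply: contrapT => none; move: px.
  rewrite mevalE (bigD1_seq m0) ?msupp_uniq //= [X in _ + X]big1_seq ?addr0; last first.
    move=> m /andP[mm mp]; case: none; by exists m.
  move/eqP; rewrite mulf_eq0 -[_ == 0]negbK -mcoeff_msupp m0p /=.
  by apply/negP/prodf_neq0 => i _; rewrite expf_neq0.
have [i mi] : exists i, m1 i != m0 i.
  apply: contrapT => h; case/eqP: m10; apply/mnmP => i.
  by apply: contrapT => /eqP mi; apply: h; exists i.
pose P := acl (others x i).
have PN : P `<=` acl (x i |` P) by move=> y Py; apply: sub_acl; right.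
have Nx : acl (x i |` P) (x i) by apply: sub_acl; left.
have hP := acl_subfield k (others x i).
have [s [sP _ sx _]] := affine_fieldAut (acl_aclosed k (others x i))
  (acl_aclosed k (x i |` P)) PN Nx (xind i) (subfield_nat hP 2) (subfield0 hP)
  (natr_neq0 char0 1) (indep_nil k _).
rewrite addr0 in sx.
have sX (m : 'X_{1..n}) : s (\prod_j x j ^+ m j) = 2%:R ^+ m i * \prod_j x j ^+ m j.
  rewrite rmorph_prod (bigD1 i) //= [in RHS](bigD1 i) //= rmorphXn /= sx exprMn mulrA.
  congr (_ * _); apply: eq_bigr => j ji; rewrite rmorphXn /= sP //.
  by apply: sub_acl; exists j.
(* At x, the polynomial q takes the value s(p(x)) - 2^(m0 i) p(x) = 0. Its support omits m0, so it
   vanishes by induction, yet m1 keeps a nonzero coefficient since its exponent at i differs from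
   that of m0. *)
pose w (m : 'X_{1..n}) : F := 2%:R ^+ m i - 2%:R ^+ m0 i.
pose q : {mpoly F[n]} := \sum_(m <- msupp p) (w m * p@_m) *: 'X_[m].
have qE m : q@_m = w m * p@_m by apply: mcoeff_weight.
have q0 : q = 0.
  apply: IHd.
  - rewrite ltnS in sp; apply: leq_trans sp; apply: (@uniq_leq_size _ (m0 :: msupp q)).
      rewrite /= msupp_uniq andbT mcoeff_msupp qE /w subrr mul0r eqxx //.
    move=> m; rewrite inE => /orP[/eqP->//|]; rewrite !mcoeff_msupp qE.
    by apply: contra_neq => ->; rewrite mulr0.
  - suff : q \is a mpolyOver n (subfield_pred hk) by [].
    apply/mpolyOverP => m; rewrite qE; apply: (@mem_set _ k).
    by apply: (subfieldM hk) => //; apply: (subfieldB hk); apply: (subfieldX hk); apply: subfield_nat.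
  - have s0 : \sum_(m <- msupp p) p@_m * (2%:R ^+ m i * \prod_j x j ^+ m j) = 0.
      transitivity (s p.@[x]); last by rewrite px rmorph0.
      rewrite mevalE rmorph_sum /=; apply: eq_bigr => m _.
      by rewrite rmorphM /= sX fieldAut_id.
    rewrite /q raddf_sum /=.
    transitivity (\sum_(m <- msupp p) p@_m * (2%:R ^+ m i * \prod_j x j ^+ m j) -
      2%:R ^+ m0 i * p.@[x]); last by rewrite s0 px mulr0 subr0.
    rewrite mevalE mulr_sumr -sumrB; apply: eq_bigr => m _.
    by rewrite mevalZ mevalX /w !mulrBl -!mulrA mulrCA.
move: (qE m1); rewrite q0 mcoeff0 => /esym/eqP; rewrite mulf_eq0 /w subr_eq0.
rewrite -!natrX => /orP[E|]; last by rewrite -[_ == 0]negbK -mcoeff_msupp m1p.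
have natrI (a b : nat) : (a <= b)%N -> (a%:R : F) = b%:R -> a = b.
  move=> ab /eqP; rewrite eq_sym -subr_eq0 -natrB // => /eqP ba.
  apply/eqP; rewrite eqn_leq ab -subn_eq0; case: (b - a)%N ba => // c c0.
  by have := natr_neq0 char0 c; rewrite c0 eqxx.
have : (2 ^ m1 i = 2 ^ m0 i)%N.
  have [h|/ltnW h] := leqP (2 ^ m1 i) (2 ^ m0 i); first by apply: natrI => //; apply/eqP.
  by apply/esym/natrI => //; apply/esym/eqP.
by move/eqP; rewrite eqn_exp2l // (negPf mi).
Qed.

Lemma not_finitely_spanned (B : set F) : alg_independent k B ->
  (B #= [set: nat])%card -> ~ finitely_spanned k [set: F].
Proof.
move=> indB /card_esym/card_bijP[f fbij] [ms msP].
pose g (m : nat) : F := val (f (to_setT m)).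
have gB m : B (g m) by apply: set_valP.
have gI : injective g.
  move=> m m' /val_inj/(bij_inj fbij) E.
  by have := congr1 val E.
have ind N : indep k set0 (map g (iota 0 N)).
  elim: N => [//|N IHN]; rewrite -addn1 iotaD map_cat; apply/indep_cat; split=> //=.
  split=> //; rewrite set0U add0n.
  have := @alg_independent_others N.+1 (fun i => g i) ord_max _.
  move=> h h'; apply: h.
    move=> p kp px; apply: (indB _ (fun i : 'I_N.+1 => g i)) => // i j /gI /val_inj //.
  apply: acl_mono h' => _ /mapP[m mN ->]; move: mN; rewrite mem_iota add0n => /andP[_ mN].
  exists (widen_ord (leqnSn N) (Ordinal mN)) => //=.
  by rewrite -val_eqE /= neq_ltn mN.
have := steinitz (ys := ms) (ind (size ms).+1).
rewrite set0U size_map size_iota ltnn => h; suff : false by [].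
by apply: h => y _; apply: msP.
Qed.

(** Here the polynomial notion of independence meets the sequential one: a basis for [indep] is a
    transcendence basis by [others_alg_independent]. *)
Lemma APi_proper_core : APi k `\ k = proper_core k.
Proof.
apply/seteqP; split=> L.
  move=> [[[hL kL] cL [B [BL _ LB] /finite_seqP[ms BE]]] nk].
  split=> //; last by exists ms; rewrite -BE.
  by split=> //; apply: algebraically_closed_alg_closure.
move=> [[hL kL cL] fL nk]; split=> //; split=> //.
  by rewrite -cL; apply: alg_closure_closed.
have [ms Lms] := fL.
have [|xs [ix xL Lx]] := @exists_basis _ k set0 L ms; first by rewrite set0U.
exists [set` xs]; last exact: finite_seq.
split=> //; last by move: Lx; rewrite set0U.
move=> n x xI xB; apply: others_alg_independent => i ai.
(* Moving x i to the end makes its independence refer to all the other entries. *)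
have : indep k set0 (rem (x i) xs ++ [:: x i]).
  apply: indep_perm ix; rewrite cats1 perm_sym perm_rcons perm_sym.
  exact: (perm_to_rem (xB i : x i \in xs)).
move=> /indep_cat[_ [ni _]]; apply: ni; rewrite set0U; apply: acl_mono ai.
move=> _ [j /= ji <-].
have : x j \in x i :: rem (x i) xs.
  by rewrite -(perm_mem (perm_to_rem (xB i : x i \in xs))); apply: xB.
by rewrite inE => /orP[/eqP/xI/eqP|//]; rewrite (negPf ji).
Qed.

End AlgebraicIndependence.

(** * The four steps assembled *)

Theorem mainTheorem2 (F : closedFieldType) (k : set F)
    (charF0 : [pchar F] =i pred0)
    (k_subfield : is_subfield k) (k_closed : algebraically_closed k)
    (trdegF : countably_infinite_trdeg k [set: F]) :
  let beta (K : set F) : set (fieldAut k) := fixing k K in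
  let maximal_open := maximal_open_subgroups k in
  let minimal_normal := minimal_closed_normal_subgroups k in
  let cocompact_over := open_cocompact_overgroups k in
  [/\ (forall K, intermediate_fields k K ->
         is_subgroup (beta K) /\ closed (beta K)),
      (forall L, (APi k `\ k) L -> normalizing (beta L) = stabilizing k L) /\
        [set stabilizing k L | L in APi k `\ k] = maximal_open,
      (forall L, (APi k `\ k) L ->
         minimal_closed_normal (stabilizing k L) (beta L)) /\
        [set beta L | L in APi k `\ k] = minimal_normal,
      (forall L, (finite_type k `\ k) L ->
         minimal_normal (beta (alg_closure L)) /\
         cocompact_overgroup (beta (alg_closure L)) (beta L)) /\
        [set beta L | L in finite_type k `\ k] = cocompact_over &
      beta @` intermediate_fields k `\ [set: fieldAut k] =
        intersections_of cocompact_over].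
Proof.
have hk : acl_closed k k.
  by split=> //; apply: algebraically_closed_alg_closure.
have Finf : ~ finitely_spanned k [set: F].
  by case: trdegF => B [_ indB _] cB; apply: not_finitely_spanned indB cB.
have APiE := APi_proper_core charF0 k_subfield.
have core L : (APi k `\ k) L -> proper_core k L by rewrite APiE.
rewrite /= APiE; split.
- by move=> K _; split; [apply: fixing_subgroup|apply: fixing_closed].
- split; last exact: maximal_open_subgroupsE.
  by move=> L /core[[hL kL _] _ _]; apply: normalizing_fixing.
- split; last exact: minimal_closed_normal_subgroupsE.
  by move=> L /core[hL fL _]; apply: fixing_minimal.
- split; last exact: open_cocompact_overgroupsE.
  move=> L [fL nk]; split; last exact: finite_type_cocompact_overgroup.
  have [_ _ pL] := finite_type_alg_closure fL nk.
  by rewrite -minimal_closed_normal_subgroupsE //; exists (alg_closure L).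
- exact: fixing_intersections.
Qed.
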